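(* In the normal-cell setting described in the context, fix one piece $\alpha$ with $d:=d_\alpha\ge1$ and suppress the index $\alpha$. Fix $\boldsymbol\beta\in(0,\infty)^d$, $Q:=\sum_i\beta_i$, let $c:P\to(0,\infty)$ be measurable with $0<c_-\le c(p)\le c_+<\infty$, and let $G:P\times\mathbb R^d\to[0,\infty)$ be measurable with $G(p,D_u^{\boldsymbol\beta}t)=uG(p,t)$ for all $p,t$, $u>0$. Let $(C(p),\Theta_q,j_q)$ be a scaled cell representation with transported amplitude $\widetilde b_q$, transported phase $\Phi_q$ and transported density $\widetilde{\mathcal D}_q=\widetilde b_qe^{G-\Phi_q}$ (see context). Assume that, uniformly in $p$, $g_-\rho_{\boldsymbol\beta}(t)\le G(p,t)\le g_+\rho_{\boldsymbol\beta}(t)$ for $t\in C(p)$, for some $0<g_-\le g_+<\infty$. Fix $R>0$. Suppose there are finite sets $\Lambda_b\subset[0,R]$ and $\Lambda_\phi\subset(0,R]$, measurable functions $b_\lambda$ ($\lambda\in\Lambda_b$) and $\phi_\nu$ ($\nu\in\Lambda_\phi$) on $\{(p,t):t\in C(p)\}$, and an exponent $L_{\mathrm{gr}}<\infty$ such that $$|b_\lambda(p,t)|+|\phi_\nu(p,t)|\le C(1+\rho_{\boldsymbol\beta}(t))^{L_{\mathrm{gr}}}.$$ For every fixed $A>0$, let $\ell_q:=A\log(1/q)$, and assume that on $C(p)\cap\{\rho_{\boldsymbol\beta}\le\ell_q\}$ $$\widetilde b_q(p,t)=\sum_{\lambda\in\Lambda_b}q^\lambda b_\lambda(p,t)+r_{b,q}(p,t),\qquad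 \Phi_q(p,t)=G(p,t)+\sum_{\nu\in\Lambda_\phi}q^\nu\phi_\nu(p,t)+r_{\phi,q}(p,t),$$ with $$\sup_{p\in P}\ \sup_{t\in C(p),\ \rho_{\boldsymbol\beta}(t)\le\ell_q}\frac{|r_{b,q}(p,t)|+|r_{\phi,q}(p,t)|}{q^R(1+\rho_{\boldsymbol\beta}(t))^{L_{\mathrm{gr}}}}\longrightarrow0\qquad(q\downarrow0).$$ Finally assume that for some $\kappa_G>0$ and all sufficiently small $q$, $$|\widetilde b_q(p,t)|\le C(1+\rho_{\boldsymbol\beta}(t))^{L_{\mathrm{gr}}},\qquad \Phi_q(p,t)\ge\kappa_GG(p,t)\qquad(p\in P,\ t\in C(p)).$$ Let $\mathcal E_R$ be the additive semigroup generated by $\Lambda_\phi$, truncated at $R$ (i.e. intersected with $[0,R]$), with $0$ adjoined. Define $E_0:=1$ and, for $0<\eta\le R$, $$E_\eta(p,t):=\sum_{m\ge1}\frac{(-1)^m}{m!}\sum_{\substack{\nu_1,\dots,\nu_m\in\Lambda_\phi\\ \nu_1+\cdots+\nu_m=\eta}}\ \prod_{r=1}^m\phi_{\nu_r}(p,t)$$ (all sums are finite). Put $$\Lambda_R:=(\Lambda_b+\mathcal E_R)\cap[0,R],\qquad \mathcal D_\xi(p,t):=\sum_{\substack{\lambda\in\Lambda_b,\ \eta\in\mathcal E_R\\ \lambda+\eta=\xi}}b_\lambda(p,t)E_\eta(p,t)\quad(\xi\in\Lambda_R).$$ Then $\sup_{p\in P}\int_{C(p)}|\mathcal D_\xi(p,t)|e^{-G(p,t)}\,dt<\infty$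 for every $\xi\in\Lambda_R$, and $$\sup_{p\in P}q^{-R}\int_{C(p)}\Bigl|\widetilde{\mathcal D}_q(p,t)-\sum_{\xi\in\Lambda_R}q^\xi\mathcal D_\xi(p,t)\Bigr|e^{-G(p,t)}\,dt\longrightarrow0\qquad(q\downarrow0).$$ Consequently, with $\mathcal L_\xi(p):=\int_{C(p)}\mathcal D_\xi(p,t)e^{-G(p,t)}\,dt$, as $z\to\infty$, uniformly in $p\in P$, $$\mathcal I(z,p)=e^{-zf_0}\sum_{\xi\in\Lambda_R}z^{-(Q+\xi)}c(p)^{-(Q+\xi)}\mathcal L_\xi(p)+o\bigl(e^{-zf_0}z^{-(Q+R)}\bigr),$$ and if $P$ has finite volume the same expansion holds after integration over $P$ against $\mathrm{dvol}_P$.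
   Context: Setting. $(N,g)$ is a $C^2$ Riemannian manifold of dimension $n$ with Riemannian volume measure $\mathrm{dvol}_g$; $f:N\to\mathbb R$ is continuous and bounded below; $a:N\to\mathbb C$ is measurable; $f_0:=\inf_Nf$; $M:=\{x\in N:f(x)=f_0\}$ is nonempty and compact. $\mathcal T_\varepsilon(M):=\{x:\operatorname{dist}_g(x,M)<\varepsilon\}$; $B_r$ is the open Euclidean ball of radius $r$ at $0$. $M=\bigsqcup_{j=0}^{\ell}\Sigma_j$ is a disjoint union of finitely many $C^2$ embedded strata, $\Sigma_j$ a (possibly empty or disconnected) $j$-dimensional submanifold. Normal-cell decomposition. There are $\varepsilon>0$ and a finite index set $\mathcal A$, and for each $\alpha\in\mathcal A$: a Borel set $P_\alpha\subset\Sigma_{j_\alpha}$ of finite $j_\alpha$-dimensional Riemannian volume, with $M=\bigsqcup_\alpha P_\alpha$; an open neighborhood $U_\alpha$ of $P_\alpha$ in $\Sigma_{j_\alpha}$; $d_\alpha:=n-j_\alpha$; a $C^1$ map $F_\alpha:U_\alpha\times B_\varepsilon\to N$ with $F_\alpha(p,0)=p$; and sets (cells) $\mathsf A_\alpha(p)\subset\mathbb R^{d_\alpha}$, $p\in P_\alpha$, with measurable graph. With $\mathfrak D_\alpha(\varepsilon):=\{(p,s):p\in P_\alpha,\ s\in\mathsf A_\alpha(p)\cap B_\varepsilon\}$, the sets $F_\alpha(\mathfrak D_\alpha(\varepsilon))$ are pairwise disjoint up to null sets and cover $\mathcal T_\varepsilon(M)$ up to a null set, and there are measurable $J_\alpha:\mathfrak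 D_\alpha(\varepsilon)\to(0,\infty)$ such that for every nonnegative measurable $h$ $$\int_{F_\alpha(\mathfrak D_\alpha(\varepsilon))}h\,\mathrm{dvol}_g=\int_{P_\alpha}\int_{\mathsf A_\alpha(p)\cap B_\varepsilon}h(F_\alpha(p,s))J_\alpha(p,s)\,ds\,\mathrm{dvol}_{P_\alpha}(p).$$ For $z>0$ put $\mathcal I_\alpha(z,p):=\int_{\mathsf A_\alpha(p)\cap B_\varepsilon}a(F_\alpha(p,s))J_\alpha(p,s)e^{-zf(F_\alpha(p,s))}\,ds$. Dilations. $D_u^{\boldsymbol\beta}t:=(u^{\beta_1}t_1,\dots,u^{\beta_d}t_d)$ for $u>0$; $\rho_{\boldsymbol\beta}(0)=0$ and for $t\neq0$, $\rho_{\boldsymbol\beta}(t)$ is the unique $r>0$ with $|D_{1/r}^{\boldsymbol\beta}t|=1$. Scaled quantities (index suppressed). $b(p,s):=a(F(p,s))J(p,s)$, $\phi(p,s):=(f(F(p,s))-f_0)/c(p)$ and, for $q>0$, $\mathsf A_q(p):=D_{1/q}^{\boldsymbol\beta}(\mathsf A(p)\cap B_\varepsilon)$. Scaled cell representation. It consists of sets (reference cells) $C(p)\subset\mathbb R^d$ with measurable graph in $P\times\mathbb R^d$, and families $\Theta_q(p,t)\in\mathbb R^d$, $j_q(p,t)\ge0$, jointly measurable in $(q,p,t)$ on that graph, such that for every nonnegative measurable $\psi$, $\int_{\mathsf A_q(p)}\psi(u)\,du=\int_{C(p)}\psi(\Theta_q(p,t))\,j_q(p,t)\,dt$. No injectivity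 or smoothness is required; on $\{j_q>0\}$ the map $\Theta_q(p,\cdot)$ takes values in $\mathsf A_q(p)$. Transported quantities. On $\{j_q>0\}$: $\widetilde b_q(p,t):=b(p,D_q^{\boldsymbol\beta}\Theta_q(p,t))\,j_q(p,t)$ and $\Phi_q(p,t):=q^{-1}\phi(p,D_q^{\boldsymbol\beta}\Theta_q(p,t))$; on $\{j_q=0\}$: $\widetilde b_q=0$, $\Phi_q=G$. $C$ denotes a finite constant independent of $p,t,q$. *)

(* Defs.v *)
From HB Require Import structures.
From mathcomp Require Import all_boot all_order all_algebra finmap.
From mathcomp Require Import all_classical all_reals all_analysis.
From mathcomp Require Import measurable_realfun complex.
Set Implicit Arguments. Unset Strict Implicit. Unset Printing Implicit Defensive.
Import Order.TTheory GRing.Theory Num.Theory.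
Import numFieldNormedType.Exports.
Local Open Scope classical_set_scope.
Local Open Scope ring_scope.


(* Measurability is always understood with respect to Borel sigma-algebras. *)
Notation borelType T := (g_sigma_algebraType (@open T)).

Section lebesgue.
Context {R : realType}.

Lemma open_rV_bigcup n (U : set 'rV[R]_n) : open U ->
  U = \bigcup_(vk in [set vk : 'rV[rat]_n * nat |
         ball (map_mx ratr vk.1 : 'rV[R]_n) vk.2.+1%:R^-1 `<=` U])
       ball (map_mx ratr vk.1 : 'rV[R]_n) vk.2.+1%:R^-1.
Proof.
move=> oU; apply/seteqP; split=> [x Ux|x [[v k] /= sub]]; last exact: sub.
have /nbhs_ballP[e /= e0 eU] : nbhs x U by exact: open_nbhs_nbhs.
have [k ke] : exists k : nat, k.+1%:R^-1 < e / 2.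
  have [k _ Hk] := near_infty_natSinv_lt (PosNum (divr_gt0 e0 (ltr0n _ 2))).
  by exists k; apply: Hk => /=.
have k0 : 0 < k.+1%:R^-1 :> R by rewrite invr_gt0.
have ex i : exists q : rat, `|x ord0 i - ratr q| < k.+1%:R^-1.
  have := @rat_in_itvoo R (x ord0 i - k.+1%:R^-1) (x ord0 i + k.+1%:R^-1).
  have lt : x ord0 i - k.+1%:R^-1 < x ord0 i + k.+1%:R^-1.
    by rewrite ltrBlDr -addrA ltrDl addr_gt0.
  move=> /(_ lt)[q]; rewrite in_itv/= => /andP[h1 h2].
  by exists q; rewrite distrC ltr_distl h1 h2.
have [q qP] := choice ex.
have xb : ball (map_mx ratr (\row_i q i) : 'rV[R]_n) k.+1%:R^-1 x.
  split=> // i j; rewrite ord1 !mxE /ball/= distrC.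
  exact: qP.
exists (\row_i q i, k) => //= y yb.
apply: eU; apply: (@le_ball _ _ _ (k.+1%:R^-1 + k.+1%:R^-1)).
  by rewrite (splitr e) lerD// ltW.
by apply: ball_triangle yb; exact: ball_sym.
Qed.

Definition cons_rV n (xv : measurableTypeR R * borelType 'rV[R]_n) :
    borelType 'rV[R]_n.+1 :=
  \row_i (if unlift ord0 i is Some j then xv.2 ord0 j else xv.1).

Lemma cons_rV0 n (xv : measurableTypeR R * borelType 'rV[R]_n) : cons_rV xv ord0 ord0 = xv.1.
Proof. by rewrite mxE unlift_none. Qed.

Lemma cons_rVS n (xv : measurableTypeR R * borelType 'rV[R]_n) (j : 'I_n) :
  cons_rV xv ord0 (lift ord0 j) = xv.2 ord0 j.
Proof. by rewrite mxE liftK. Qed.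

Definition behead_rV n (w : 'rV[R]_n.+1) : 'rV[R]_n :=
  \row_j w ord0 (lift ord0 j).

Lemma cons_rVK n (w : 'rV[R]_n.+1) : cons_rV (w ord0 ord0, behead_rV w) = w.
Proof.
apply/rowP => j; case: (unliftP ord0 j) => [k|] ->.
  by rewrite cons_rVS mxE.
by rewrite cons_rV0.
Qed.

Lemma measurable_cons_rV n : measurable_fun setT (@cons_rV n).
Proof.
refine (@measurability _ _ (measurableTypeR R * borelType 'rV[R]_n)%type (borelType 'rV[R]_n.+1) setT _ (@open 'rV[R]_n.+1) erefl _).
move=> _ [U oU <-]; rewrite setTI.
rewrite (open_rV_bigcup oU) preimage_bigcup.
rewrite bigcup_mkcond; apply: countable_bigcupT_measurable => // -[v k].
case: ifP => [_|_]; last exact: measurable0.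
rewrite [X in measurable X](_ : _ =
  ball (ratr (v ord0 ord0) : R) k.+1%:R^-1 `*`
  ball (behead_rV (map_mx ratr v) : 'rV[R]_n) k.+1%:R^-1).
  apply: measurableX; first by apply: open_measurable; exact: ball_open.
  by apply: sub_sigma_algebra; exact: ball_open.
apply/seteqP; split=> -[x w] /=.
  move=> [k0 H]; split.
    by have := H ord0 ord0; rewrite cons_rV0 mxE.
  split=> // i j; have := H ord0 (lift ord0 j).
  by rewrite (ord1 i) cons_rVS !mxE.
move=> [H0 [k0 H]]; split=> // i j; rewrite !ord1.
case: (unliftP ord0 j) => [l|] ->; last by rewrite cons_rV0 mxE.
by have := H ord0 l; rewrite cons_rVS !mxE.
Qed.
HB.instance Definition _ n :=
  isMeasurableFun.Build _ _ _ _ (@cons_rV n) (@measurable_cons_rV n).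

Lemma measurable_uncons_rV n : measurable_fun setT
  (fun w : borelType 'rV[R]_n.+1 =>
    (w ord0 ord0, behead_rV w) : measurableTypeR R * borelType 'rV[R]_n).
Proof.
apply: measurable_fun_pair.
  apply: (measurability _ (RGenOpens.measurableE R)).
  move=> _ [_ [a [b ->] <-]]; rewrite setTI; apply: sub_sigma_algebra.
  apply: open_comp; last exact: interval_open.
  by move=> w _; exact: coord_continuous.
refine (@measurability _ _ (borelType 'rV[R]_n.+1) (borelType 'rV[R]_n) setT _
  (@open 'rV[R]_n) erefl _).
move=> _ [U oU <-]; rewrite setTI; apply: sub_sigma_algebra.
apply: open_comp => // w _ V /= /nbhs_ballP[e e0 eV].
apply/nbhs_ballP; exists e => // w' [_ ww']; apply: eV; split=> // i j.
by rewrite !mxE; exact: ww'.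
Qed.

Section lebesgue_cons.
Context n (m : {sigma_finite_measure set (borelType 'rV[R]_n) -> \bar R}).
Local Open Scope ereal_scope.

Definition lebesgue_cons : set (borelType 'rV[R]_n.+1) -> \bar R :=
  pushforward (@lebesgue_measure R \x m) (@cons_rV n).

Let lc0 : lebesgue_cons set0 = 0.
Proof. by rewrite /lebesgue_cons /pushforward preimage_set0 measure0. Qed.
Let lc_ge0 A : 0 <= lebesgue_cons A.
Proof. exact: measure_ge0. Qed.
Let lc_sigma : semi_sigma_additive lebesgue_cons.
Proof.
exact: (@measure_semi_sigma_additive _ _ _
  (pushforward (@lebesgue_measure R \x m) (@cons_rV n))).
Qed.
HB.instance Definition _ := isMeasure.Build _ _ _ lebesgue_cons
  lc0 lc_ge0 lc_sigma.

Let lc_sfin : sigma_finite setT lebesgue_cons.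
Proof.
have /sigma_finiteP[F [TF ndF Foo]] := sigma_finiteT (@lebesgue_measure R).
have /sigma_finiteP[G [TG ndG Goo]] := sigma_finiteT m.
pose H k := F k `*` G k.
exists (fun k => [set w : 'rV[R]_n.+1 | H k (w ord0 ord0, behead_rV w)]).
  apply/seteqP; split=> // w _.
  have : [set: R] (w ord0 ord0) by [].
  have : [set: borelType 'rV[R]_n] (behead_rV w) by [].
  rewrite TF TG => -[k _ Gk] [l _ Fl]; exists (maxn k l) => //; split.
    by move: Fl; exact/subsetPset/ndF/leq_maxr.
  by move: Gk; exact/subsetPset/ndG/leq_maxl.
have E k :
    @cons_rV n @^-1` [set w : 'rV[R]_n.+1 | H k (w ord0 ord0, behead_rV w)]
    = H k.
  apply/seteqP; split=> -[x v] /=; rewrite cons_rV0 (_ : behead_rV _ = v)//;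
    by apply/rowP => j; rewrite mxE cons_rVS.
move=> k; have [mF Fk] := Foo k; have [mG Gk] := Goo k.
have mH : measurable (H k) by exact: measurableX.
split; last first.
  rewrite /lebesgue_cons /pushforward E /H product_measure1E//.
  by rewrite lte_mul_pinfty// ge0_fin_numE.
by rewrite -[X in measurable X]setTI; exact: measurable_uncons_rV.
Qed.
HB.instance Definition _ :=
  Measure_isSigmaFinite.Build _ _ _ lebesgue_cons lc_sfin.
End lebesgue_cons.

(* Lebesgue measure on 'rV[R]_n with its Borel sigma-algebra, by recursion on n:
   the image of (lebesgue_measure \x lebesgue_rV n) under (x, v) |-> (x | v). *)
Fixpoint lebesgue_rV n :
    {sigma_finite_measure set (borelType 'rV[R]_n) -> \bar R} :=
  if n is n'.+1 then lebesgue_cons (lebesgue_rV n') else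
  @dirac _ (borelType 'rV[R]_0) (0 : 'rV[R]_0) R.
End lebesgue.

Section complex_valued.
Context {R : realType} d (T : measurableType d).
Implicit Types (D : set T) (h : T -> R[i]).

Definition cmeasurable D h :=
  measurable_fun D (fun x => complex.Re (h x)) /\
  measurable_fun D (fun x => complex.Im (h x)).

Definition cintegrable (mu : {measure set T -> \bar R}) D h :=
  mu.-integrable D (fun x => (complex.Re (h x))%:E) /\
  mu.-integrable D (fun x => (complex.Im (h x))%:E).

Definition cintegral (mu : {measure set T -> \bar R}) D h : R[i] :=
  Complex (\int[mu]_(x in D) complex.Re (h x))
          (\int[mu]_(x in D) complex.Im (h x)).

End complex_valued.

Notation cabs := Normc.normc.

(* Supremum of a nonnegative function, with value 0 on the empty set. *)
Definition nnsup {R : realType} {T : Type} (D : set T) (h : T -> \bar R) :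
  \bar R := ereal_sup (0%E |` [set h x | x in D]).

Section euclidean.
Context {R : realType}.

Definition enorm n (v : 'rV[R]_n) : R := Num.sqrt (\sum_i v ord0 i ^+ 2).

Definition eball n (r : R) : set 'rV[R]_n := [set v | enorm v < r].

(* Meant for open U: all partial derivatives of order <= k exist and are
   continuous on U. *)
Fixpoint Ck m (W : normedModType R) (k : nat) (U : set 'rV[R]_m)
    (h : 'rV[R]_m -> W) : Prop :=
  (forall x, U x -> {for x, continuous h}) /\
  (if k is k'.+1 then
     forall i : 'I_m, (forall x, U x -> derivable h x (delta_mx ord0 i)) /\
       Ck k' U (fun x => 'D_(delta_mx ord0 i) h x : W)
   else True).

Definition dilation d (beta : 'I_d -> R) (u : R) (t : 'rV[R]_d) : 'rV[R]_d :=
  \row_i (u `^ beta i * t ord0 i).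

Definition rho d (beta : 'I_d -> R) (t : 'rV[R]_d) : R :=
  if t == 0 then 0
  else xget 0 [set r | 0 < r /\ enorm (dilation beta r^-1 t) = 1].

End euclidean.

Section manifold.
Context {R : realType} {n : nat}.

(* chart_map and chart_inv only matter on chart_dom and chart_img. *)
Record chart (N : Type) := Chart {
  chart_dom : set N;
  chart_map : N -> 'rV[R]_n;
  chart_inv : 'rV[R]_n -> N }.

Definition chart_img N (c : chart N) : set 'rV[R]_n :=
  chart_map c @` chart_dom c.

Record is_chart (N : ptopologicalType) (c : chart N) : Prop := {
  chart_open_dom : open (chart_dom c);
  chart_open_img : open (chart_img c);
  chart_mapK : forall x, chart_dom c x -> chart_inv c (chart_map c x) = x;
  chart_map_cont : {within chart_dom c, continuous (chart_map c)};
  chart_inv_cont : {within chart_img c, continuous (chart_inv c)} }.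

Definition transition N (c c' : chart N) : 'rV[R]_n -> 'rV[R]_n :=
  chart_map c' \o chart_inv c.

Definition transition_dom N (c c' : chart N) : set 'rV[R]_n :=
  chart_map c @` (chart_dom c `&` chart_dom c').

Definition C2_compatible N (c c' : chart N) :=
  Ck 2 (transition_dom c c') (transition c c').

Record C2_atlas (N : ptopologicalType) (A : set (chart N)) : Prop := {
  atlas_chart : forall c, A c -> is_chart c;
  atlas_cover : forall x, exists2 c, A c & chart_dom c x;
  atlas_compatible : forall c c', A c -> A c' -> C2_compatible c c';
  atlas_maximal : forall c, is_chart c ->
    (forall c', A c' -> C2_compatible c c' /\ C2_compatible c' c) -> A c }.

(* g c x is the Gram matrix at x of the metric in the chart c, acting on row
   vectors; C^1 is the best regularity that makes sense on a C^2 manifold. *)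
Record C1_metric (N : ptopologicalType) (A : set (chart N))
    (g : chart N -> 'rV[R]_n -> 'M[R]_n) : Prop := {
  metric_sym : forall c x, A c -> chart_img c x -> (g c x)^T = g c x;
  metric_pos : forall c x (v : 'rV[R]_n), A c -> chart_img c x -> v != 0 ->
    0 < (v *m g c x *m v^T) ord0 ord0;
  metric_C1 : forall c, A c -> Ck 1 (chart_img c) (g c);
  metric_change : forall c c' x, A c -> A c' -> transition_dom c c' x ->
    g c x = 'J (transition c c') x *m g c' (transition c c' x)
            *m ('J (transition c c') x)^T }.

End manifold.
Arguments chart R n N : clear implicits.

Record riemannianManifold (R : realType) (n : nat) := RiemannianManifold {
  rm_carrier :> ptopologicalType;
  rm_hausdorff : hausdorff_space rm_carrier;
  rm_second_countable : @second_countable rm_carrier;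
  rm_atlas : set (chart R n rm_carrier);
  rm_atlasP : C2_atlas rm_atlas;
  rm_metric : chart R n rm_carrier -> 'rV[R]_n -> 'M[R]_n;
  rm_metricP : C1_metric rm_atlas rm_metric }.

Section riemannian.
Context {R : realType} {n : nat} (N : riemannianManifold R n).

(* A piecewise C^1 curve is cut into finitely many C^1 pieces, each lying in a
   chart c and given by its coordinate expression u on [0, 1]. *)
Fixpoint is_curve (x : N) (s : seq (chart R n N * (R -> 'rV[R]_n))) (y : N) :
    Prop :=
  if s is (c, u) :: s' then
    [/\ rm_atlas c,
        (forall t, derivable u t 1) /\ continuous (derive1 u : R -> 'rV[R]_n),
        (forall t, 0 <= t <= 1 -> chart_img c (u t)),
        chart_inv c (u 0) = x &
        is_curve (chart_inv c (u 1)) s' y]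
  else x = y.

Definition curve_length (s : seq (chart R n N * (R -> 'rV[R]_n))) : \bar R :=
  (\sum_(cu <- s) \int[lebesgue_measure]_(t in `[0%R, 1%R])
     (Num.sqrt ((derive1 cu.2 t *m rm_metric cu.1 (cu.2 t)
                 *m (derive1 cu.2 t)^T) ord0 ord0))%:E)%E.

Definition rdist (x y : N) : \bar R :=
  ereal_inf [set curve_length s | s in [set s | is_curve x s y]].

Definition tube (M : set N) (e : R) : set N :=
  [set x | (ereal_inf [set rdist x y | y in M] < e%:E)%E].

Definition slice_chart (j : nat) (S : set N) (c : chart R n N) :=
  rm_atlas c /\ forall x, chart_dom c x ->
    (S x <-> forall i : 'I_n, (j <= i)%N -> chart_map c x ord0 i = 0).

(* Embedded C^2 submanifold of dimension j. *)
Definition submanifold (j : nat) (S : set N) :=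
  forall x, S x -> (j <= n)%N /\ exists2 c, slice_chart j S c & chart_dom c x.

(* 'rV_j is embedded in 'rV_n by y |-> y *m pid_mx j = (y, 0). *)
Definition slice_inv j (c : chart R n N) (y : 'rV[R]_j) : N :=
  chart_inv c (y *m pid_mx j).

Definition slice_img j (c : chart R n N) : set 'rV[R]_j :=
  [set y | chart_img c (y *m pid_mx j)].

Definition slice_metric j (c : chart R n N) (y : 'rV[R]_j) : 'M[R]_j :=
  pid_mx j *m rm_metric c (y *m pid_mx j) *m (pid_mx j)^T.

(* The j-dimensional Riemannian volume of S for the induced metric, seen as a
   Borel measure on N carried by S. *)
Definition riemannian_volume (j : nat) (S : set N)
    (mu : {measure set (borelType N) -> \bar R}) : Prop :=
  mu (~` S) = 0%E /\
  forall c, slice_chart j S c ->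
  forall B : set (borelType N), measurable B -> B `<=` S `&` chart_dom c ->
    mu B = (\int[lebesgue_rV j]_(y in slice_img c `&` slice_inv c @^-1` B)
              (Num.sqrt (\det (slice_metric c y)))%:E)%E.

(* F : U x B_r -> N is C^1, for U open in the submanifold S. *)
Definition C1_on_cylinder (j d : nat) (S U : set N) (r : R)
    (F : N -> 'rV[R]_d -> N) : Prop :=
  {within U `*` @eball R d r, continuous (fun ps => F ps.1 ps.2)} /\
  forall c c', slice_chart j S c -> rm_atlas c' ->
    let Fc (w : 'rV[R]_(j + d)) := F (slice_inv c (lsubmx w)) (rsubmx w) in
    Ck 1 [set w | [/\ slice_img c (lsubmx w), U (slice_inv c (lsubmx w)),
                      eball r (rsubmx w) & chart_dom c' (Fc w)]]
         (fun w => chart_map c' (Fc w)).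

Definition argmin (f : N -> R) : set N := [set x | f x = inf (range f)].


(* One normal piece: its base P in the stratum of dimension pc_dim, the open
   neighbourhood U of P in that stratum, F, the cells A p, and J. *)
Record piece := Piece {
  pc_dim : nat;
  pc_base : set N;
  pc_nbhd : set N;
  pc_map : N -> 'rV[R]_(n - pc_dim) -> N;
  pc_A : N -> set 'rV[R]_(n - pc_dim);
  pc_J : N -> 'rV[R]_(n - pc_dim) -> R }.

Definition pc_codim (c : piece) : nat := (n - pc_dim c)%N.

Definition pc_space (c : piece) := borelType 'rV[R]_(pc_codim c).

Definition fiber_graph (c : piece) (C : N -> set 'rV[R]_(pc_codim c)) :
    set (borelType N * pc_space c) :=
  [set ps | pc_base c ps.1 /\ C ps.1 ps.2].

Definition pc_cell (c : piece) (e : R) (p : N) : set 'rV[R]_(pc_codim c) :=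
  pc_A p `&` eball e.

Definition pc_dom (c : piece) (e : R) : set (borelType N * pc_space c) :=
  fiber_graph (@pc_cell c e).

Definition pc_image (c : piece) (e : R) : set N :=
  [set pc_map ps.1 ps.2 | ps in @pc_dom c e].

(* The integral over pc_image makes sense although this image is in general only
   an analytic set: it is measurable for the completion of vol, and the library
   integral of a nonnegative function is then the integral for the completion. *)
Record is_normal_piece (vol svol : {measure set (borelType N) -> \bar R})
    (S : set N) (e : R) (c : piece) : Prop := {
  pc_base_sub : pc_base c `<=` S;
  pc_base_measurable : measurable (pc_base c : set (borelType N));
  pc_base_finite : (svol (pc_base c) < +oo)%E;
  pc_nbhd_open : exists2 O, open O & pc_nbhd c = O `&` S;
  pc_nbhd_base : pc_base c `<=` pc_nbhd c;
  pc_map_C1 : C1_on_cylinder (pc_dim c) S (pc_nbhd c) e (@pc_map c);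
  pc_map0 : forall p, pc_nbhd c p -> @pc_map c p 0 = p;
  pc_A_measurable : measurable (fiber_graph (@pc_A c));
  pc_J_measurable :
    measurable_fun (@pc_dom c e) (fun ps => @pc_J c ps.1 ps.2 : R);
  pc_J_gt0 : forall p s, pc_base c p -> @pc_cell c e p s -> 0 < @pc_J c p s;
  pc_integral : forall h : borelType N -> \bar R,
    measurable_fun setT h -> (forall x, 0 <= h x)%E ->
    (\int[vol]_(x in @pc_image c e) h x =
     \int[svol]_(p in pc_base c)
       \int[lebesgue_rV (pc_codim c)]_(s in @pc_cell c e p)
         (h (pc_map p s) * (pc_J p s)%:E))%E }.

Record normalCells (f : N -> R)
    (vol : {measure set (borelType N) -> \bar R}) := NormalCells {
  nc_ell : nat;
  nc_stratum : nat -> set N;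
  nc_stratum_sub : forall j, (j <= nc_ell)%N -> submanifold j (nc_stratum j);
  nc_stratum_disj : trivIset [set j | (j <= nc_ell)%N] nc_stratum;
  nc_stratum_cover :
    \bigcup_(j in [set j | (j <= nc_ell)%N]) nc_stratum j = argmin f;
  nc_svol : nat -> {measure set (borelType N) -> \bar R};
  nc_svolP : forall j, (j <= nc_ell)%N ->
    riemannian_volume j (nc_stratum j) (nc_svol j);
  nc_eps : R;
  nc_eps_gt0 : 0 < nc_eps;
  nc_index : finType;
  nc_piece : nc_index -> piece;
  nc_dim_le : forall al, (pc_dim (nc_piece al) <= nc_ell)%N;
  nc_pieceP : forall al, let j := pc_dim (nc_piece al) in
    is_normal_piece vol (nc_svol j) (nc_stratum j) nc_eps (nc_piece al);
  nc_base_disj : trivIset setT (fun al => pc_base (nc_piece al));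
  nc_base_cover : \bigcup_al pc_base (nc_piece al) = argmin f;
  nc_image_disj : forall al al', al != al' ->
    vol.-negligible (pc_image (nc_piece al) nc_eps `&`
                     pc_image (nc_piece al') nc_eps);
  nc_image_cover :
    vol.-negligible (tube (argmin f) nc_eps `\`
                     \bigcup_al pc_image (nc_piece al) nc_eps) }.

End riemannian.

Section scaled.
Context {R : realType} {n : nat} {N : riemannianManifold R n}.
Variables (f : N -> R) (a : N -> R[i]) (pc : piece N) (e : R).
Let d := pc_codim pc.
Let P := pc_base pc.

Definition amplitude (p : N) (s : 'rV[R]_d) : R[i] :=
  a (pc_map p s) * (pc_J p s)%:C%C.

Definition laplace_integrand (z : R) (p : N) (s : 'rV[R]_d) : R[i] :=
  amplitude p s * (expR (- z * f (pc_map p s)))%:C%C.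

Definition laplace (z : R) (p : N) : R[i] :=
  cintegral (lebesgue_rV d) (pc_cell e p) (laplace_integrand z p).

Variables (beta : 'I_d -> R) (c : N -> R) (G : N -> 'rV[R]_d -> R).

Definition phase (p : N) (s : 'rV[R]_d) : R :=
  (f (pc_map p s) - inf (range f)) / c p.

Definition scaled_cell (q : R) (p : N) : set 'rV[R]_d :=
  dilation beta q^-1 @` pc_cell e p.

Record scaledCellRep := ScaledCellRep {
  sc_cell : N -> set 'rV[R]_d;
  sc_map : R -> N -> 'rV[R]_d -> 'rV[R]_d;
  sc_jac : R -> N -> 'rV[R]_d -> R;
  sc_cell_measurable : measurable (fiber_graph sc_cell);
  sc_dom := [set x : measurableTypeR R * (borelType N * pc_space pc) |
    0 < x.1 /\ fiber_graph sc_cell x.2];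
  sc_map_measurable : measurable_fun sc_dom
    (fun x => sc_map x.1 x.2.1 x.2.2 : pc_space pc);
  sc_jac_measurable : measurable_fun sc_dom
    (fun x => sc_jac x.1 x.2.1 x.2.2 : measurableTypeR R);
  sc_jac_ge0 : forall q p t, 0 < q -> P p -> sc_cell p t -> 0 <= sc_jac q p t;
  sc_map_cell : forall q p t, 0 < q -> P p -> sc_cell p t ->
    0 < sc_jac q p t -> scaled_cell q p (sc_map q p t);
  sc_integral : forall q p (psi : pc_space pc -> \bar R), 0 < q -> P p ->
    measurable_fun setT psi -> (forall u, 0 <= psi u)%E ->
    (\int[lebesgue_rV d]_(u in scaled_cell q p) psi u =
     \int[lebesgue_rV d]_(t in sc_cell p)
       (psi (sc_map q p t) * (sc_jac q p t)%:E))%E }.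

Variable S : scaledCellRep.

Definition tamplitude (q : R) (p : N) (t : 'rV[R]_d) : R[i] :=
  if 0 < sc_jac S q p t then
    amplitude p (dilation beta q (sc_map S q p t)) * (sc_jac S q p t)%:C%C
  else 0.

Definition tphase (q : R) (p : N) (t : 'rV[R]_d) : R :=
  if 0 < sc_jac S q p t then
    q^-1 * phase p (dilation beta q (sc_map S q p t))
  else G p t.

Definition tdensity (q : R) (p : N) (t : 'rV[R]_d) : R[i] :=
  tamplitude q p t * (expR (G p t - tphase q p t))%:C%C.

End scaled.

Section expansion.
Context {R : realType} {X Y : Type}.
Variables (Lb Lphi : {fset R}) (b : R -> X -> Y -> R[i]) (phi : R -> X -> Y -> R).

Inductive add_semigroup (L : {fset R}) : R -> Prop :=
| add_semigroup_gen x of x \in L : add_semigroup L x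
| add_semigroup_add x y of add_semigroup L x & add_semigroup L y :
    add_semigroup L (x + y).

Definition phase_exponents (r : R) : set R :=
  [set x | x = 0 \/ (add_semigroup Lphi x /\ 0 <= x <= r)].

Definition exponents (r : R) : set R :=
  [set x | 0 <= x <= r /\
    exists l, exists2 eta, l \in Lb /\ phase_exponents r eta & x = l + eta].

(* Only finitely many m contribute to the sum when Lphi is a set of positive
   reals. *)
Definition exp_coef (eta : R) (p : X) (t : Y) : R :=
  if eta == 0 then 1 else
  \sum_(m \in [set m : nat | (0 < m)%N])
    ((-1) ^+ m / m`!%:R *
     \sum_(nu : {ffun 'I_m -> Lphi} | \sum_(i < m) val (nu i) == eta)
       \prod_(i < m) phi (val (nu i)) p t).

Definition density_coef (r xi : R) (p : X) (t : Y) : R[i] :=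
  \sum_(x \in [set x : R * R |
      [/\ x.1 \in Lb, phase_exponents r x.2 & x.1 + x.2 = xi]])
    b x.1 p t * (exp_coef x.2 p t)%:C%C.

Definition amplitude_sum (q : R) (p : X) (t : Y) : R[i] :=
  \sum_(l <- Lb) (q `^ l)%:C%C * b l p t.

Definition phase_sum (q : R) (p : X) (t : Y) : R :=
  \sum_(nu <- Lphi) q `^ nu * phi nu p t.

End expansion.

(* Main.v *)
Require Import Defs.
From mathcomp Require Import all_boot all_order all_algebra finmap.
From mathcomp Require Import all_classical all_reals all_analysis.
From mathcomp Require Import measurable_realfun complex.
From mathcomp Require Import ring lra.
Import Order.TTheory GRing.Theory Num.Theory.
Import numFieldNormedType.Exports.
Local Open Scope classical_set_scope.
Local Open Scope ring_scope.

(* On the region rho <= A log(1/q) the transported amplitude and phase are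
   replaced by their expansions, and exp (G - Phi) by its Taylor polynomial in
   the phase correction; regrouping the monomials q^(nu_1 + ... + nu_m) by
   exponent gives the coefficients D_xi up to o(q^R) times a power of 1 + rho.
   Outside that region every term carries a factor exp (- kappa rho), which is
   O(q^(R+1)) once A is large.  Since |t_i| <= rho(t)^beta_i, the weight
   (1 + rho)^M exp (- kappa rho) is bounded by a multiple of the integrable
   function prod_i 1 / (1 + t_i^2), so the pointwise bounds integrate, uniformly
   in p.  The Laplace integral at z is, up to the factor q^Q exp (- z f_0), the
   integral of the density at q = 1 / (c(p) z), by dilation and the scaled cell
   representation. *)

Set Implicit Arguments.
Unset Strict Implicit.
Unset Printing Implicit Defensive.

(** * Modulus and growth estimates *)

Section modulus.
Context {R : realType}.
Implicit Types (x y : R[i]) (r : R).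

(** The estimates run over pairs [(p, t)], with a weight that in the application depends on [t]
    alone, so uniformity in [p] costs nothing. The logarithmic radius is what makes it possible to
    exponentiate the phase correction: there any power of [1 + rho] is beaten by any positive power
    of [q], so the correction is eventually at most 1 and Taylor's remainder carries no growing
    exponential. The decay rate is common to [exp (- G)] and [exp (- Phi)], and it is halved: one
    half pays for the tail, the other is kept for integrability. The cell representation is an
    identity for nonnegative functions, and its map is controlled only where the density [j] is
    positive; hence real and imaginary parts, then positive and negative parts, are transported
    separately, with the value 0 imposed where [j = 0]. The scale [q] depends on [p]; the lower
    bound on [c] turns limits in [q] into limits in [z] uniform in [p]. *)

Lemma cabsM x y : cabs (x * y) = cabs x * cabs y.
Proof. exact: Normc.normcM. Qed.

Lemma cabsD x y : cabs (x + y) <= cabs x + cabs y.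
Proof. exact: (le_normcD (x : Rcomplex R) y). Qed.

Lemma cabsN x : cabs (- x) = cabs x.
Proof. exact: normcN. Qed.

Lemma cabsB x y : cabs (x - y) <= cabs x + cabs y.
Proof. by rewrite -(cabsN y); exact: cabsD. Qed.

Lemma cabs0 : cabs (0 : R[i]) = 0.
Proof. exact: Normc.normc0. Qed.

Lemma cabsR r : cabs r%:C%C = `|r|.
Proof. by rewrite /= expr0n addr0 sqrtr_sqr. Qed.

Lemma cabs_ge0 x : 0 <= cabs x.
Proof. by case: x => a b; exact: sqrtr_ge0. Qed.

Lemma cabs_sum (I : Type) (s : seq I) (P : pred I) (F : I -> R[i]) :
  cabs (\sum_(i <- s | P i) F i) <= \sum_(i <- s | P i) cabs (F i).
Proof.
elim/big_rec2: _ => [|i y x _ xy]; first by rewrite cabs0.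
by apply: le_trans (cabsD _ _) _; rewrite lerD2l.
Qed.

Lemma ler_cabs_ReIm x :
  `|complex.Re x| <= cabs x /\ `|complex.Im x| <= cabs x.
Proof.
case: x => a b /=; rewrite -(sqrtr_sqr a) -(sqrtr_sqr b).
by split; rewrite ler_sqrt ?addr_ge0 ?sqr_ge0// ?lerDl ?lerDr sqr_ge0.
Qed.

Lemma cabs_le_ReIm x : cabs x <= `|complex.Re x| + `|complex.Im x|.
Proof.
case: x => a b /=.
rewrite -[leRHS]ger0_norm ?addr_ge0// -sqrtr_sqr ler_sqrt ?sqr_ge0//.
rewrite sqrrD !real_normK ?num_real// -addrA lerD2l.
by rewrite lerDr mulrn_wge0// mulr_ge0.
Qed.

End modulus.

Section growth.
Context {R : realType}.

(** For positive [k] put [h = g / k]: then [1 + r <= (1 + 1/h) * (1 + h * r)], and [1 + x <= exp x]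
    gives the bound after taking [k]-th powers. *)
Lemma exprD1_le_expR (k : nat) (g : R) : 0 < g ->
  exists2 K, 0 < K & forall r, 0 <= r -> (1 + r) ^+ k <= K * expR (g * r).
Proof.
move=> g0; case: k => [|k].
  exists 1 => // r r0; rewrite expr0 mul1r -expR0 ler_expR.
  by rewrite mulr_ge0// ltW.
pose h := g / k.+1%:R; have h0 : 0 < h by rewrite divr_gt0.
exists ((1 + h^-1) ^+ k.+1); first by rewrite exprn_gt0// addr_gt0// invr_gt0.
move=> r r0; rewrite (_ : g * r = (h * r) * k.+1%:R); last first.
  by rewrite /h mulrAC divfK ?pnatr_eq0.
rewrite expRM_natr -exprMn lerXn2r ?nnegrE ?addr_ge0//.
  by rewrite mulr_ge0 ?expR_ge0// addr_ge0// invr_ge0 ltW.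
apply: (@le_trans _ _ ((1 + h^-1) * (1 + h * r))); last first.
  by rewrite ler_wpM2l ?expR_ge1Dx// addr_ge0// invr_ge0 ltW.
have -> : (1 + h^-1) * (1 + h * r) = 1 + r + (h * r + h^-1).
  by field; rewrite gt_eqF.
by rewrite lerDl addr_ge0 ?mulr_ge0 ?invr_ge0 // ltW.
Qed.

Lemma near0_lt (e : R) : 0 < e -> \forall q \near 0^'+, 0 < q < e.
Proof.
move=> e0; near=> q; apply/andP; split; near: q.
  exact: nbhs_right_gt.
exact: nbhs_right_lt.
Unshelve. all: by end_near. Qed.

Lemma near0_powR_lt (s K e : R) : 0 < s -> 0 < e ->
  \forall q \near 0^'+, K * q `^ s <= e.
Proof.
move=> s0 e0.
have : K * q `^ s @[q --> 0^'+] --> K * 0.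
  by apply: cvgM; [exact: cvg_cst|exact: powR_cvg0].
rewrite mulr0 => /cvgrPdist_le /(_ _ e0) H.
near=> q; have : `|0 - K * q `^ s| <= e by near: q.
by rewrite sub0r normrN; exact/le_trans/ler_norm.
Unshelve. all: by end_near. Qed.

(** Half of the power pays for the weight: in this range the weight is at most [K * exp (s / (2A) *
    r) <= K * q^(- s / 2)], and the remaining [q^(s / 2)] tends to 0. *)
Lemma near0_powR_log (A s e : R) (M : nat) : 0 < A -> 0 < s -> 0 < e ->
  \forall q \near 0^'+, forall r, 0 <= r -> r <= A * ln q^-1 ->
    q `^ s * (1 + r) ^+ M <= e.
Proof.
move=> A0 s0 e0.
have g0 : 0 < s / (2 * A) by rewrite divr_gt0// mulr_gt0.
have [K K0 HK] := exprD1_le_expR M g0.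
near=> q => r r0 rA.
have q0 : 0 < q by near: q; exact: nbhs_right_gt.
apply: (@le_trans _ _ (K * q `^ (s / 2))); last first.
  by near: q; apply: near0_powR_lt => //; rewrite divr_gt0.
have -> : q `^ s = q `^ (s / 2) * q `^ (s / 2).
  by rewrite -powRD ?gt_eqF ?implybT// -splitr.
rewrite mulrAC ler_wpM2r ?powR_ge0//.
rewrite -ler_pdivlMl ?powR_gt0// -powRN.
apply: (le_trans (HK _ r0)); rewrite mulrC ler_wpM2r ?(ltW K0)//.
rewrite /powR gt_eqF// ler_expR.
rewrite lnV ?posrE// in rA.
apply: (le_trans (ler_wpM2l (ltW g0) rA)).
rewrite le_eqVlt; apply/orP; left; apply/eqP.
by field; rewrite gt_eqF.
Unshelve. all: by end_near. Qed.

(** Tail terms are [x^m * x^k / (k + m)!], and [(k + m)! >= k!] leaves a partial sum of the series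
    of [exp |x|]. The bound serves at [m = 1] as a Lipschitz estimate and at high order as a
    remainder. *)
Lemma expR_taylor_le (x : R) (m : nat) :
  `|expR x - \sum_(k < m) x ^+ k / k`!%:R| <= `|x| ^+ m * expR `|x|.
Proof.
have cx : series (exp_coeff x) n @[n --> \oo] --> expR x.
  exact: is_cvg_series_exp_coeff.
have : `|series (exp_coeff x) n - \sum_(k < m) x ^+ k / k`!%:R| @[n --> \oo]
   --> `|expR x - \sum_(k < m) x ^+ k / k`!%:R|.
  by apply: cvg_norm; apply: cvgB => //; exact: cvg_cst.
move=> H; rewrite -(cvg_lim _ H)//.
apply: limr_le; first by apply/cvg_ex; eexists; exact: H.
near=> n.
have mn : (m <= n)%N by near: n; exact: nbhs_infty_ge.
rewrite /series/= (@big_cat_nat _ _ _ m)//= /exp_coeff/=.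
rewrite big_mkord addrAC subrr add0r.
apply: (le_trans (ler_norm_sum _ _ _)).
rewrite -{1}(add0n m) big_addn.
apply: (@le_trans _ _ (`|x| ^+ m * \sum_(0 <= k < n - m) `|x| ^+ k / k`!%:R)).
  rewrite big_distrr/=; apply: ler_sum => k _.
  rewrite normrM normrX normfV normr_nat addnC exprD -mulrA.
  rewrite ler_wpM2l ?exprn_ge0// ler_wpM2l ?exprn_ge0//.
  rewrite lef_pV2 ?posrE ?ltr0n ?fact_gt0// ler_nat.
  by rewrite leq_fact// leq_addl.
rewrite ler_wpM2l ?exprn_ge0//.
have cx' : series (exp_coeff `|x|) n @[n --> \oo] --> expR `|x|.
  exact: is_cvg_series_exp_coeff.
rewrite -(cvg_lim _ cx')//.
apply: (@nondecreasing_cvgn_le _ (series (exp_coeff `|x|))).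
  apply: nondecreasing_series => k _ _.
  by rewrite /exp_coeff/= divr_ge0 ?exprn_ge0.
exact: is_cvg_series_exp_coeff.
Unshelve. all: by end_near. Qed.

End growth.

(** * Exponents and coefficients of the density *)

Section exponent_sets.
Context {R : realType}.
Variables (Lb Lphi : {fset R}) (r : R).
Hypothesis r0 : 0 < r.
Hypothesis Lb_r : forall l, l \in Lb -> 0 <= l <= r.
Hypothesis Lphi_r : forall nu, nu \in Lphi -> 0 < nu <= r.

Definition multisum m (nu : {ffun 'I_m -> Lphi}) : R := \sum_(i < m) val (nu i).

Lemma Lphi_lbound : exists2 s, 0 < s & forall nu, nu \in Lphi -> s <= nu.
Proof.
(* The default [r] keeps the minimum positive when [Lphi] is empty. *)
exists (\big[Order.min/r]_(nu <- Lphi) nu).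
  rewrite big_seq; elim/big_ind: _ => //[x y x0 y0|nu /Lphi_r /andP[]//].
  by rewrite lt_min x0.
by move=> nu nuL; apply: ge_bigmin_seq => //; exact: nuL.
Qed.

Lemma multisum_ge s : (forall nu, nu \in Lphi -> s <= nu) ->
  forall m (nu : {ffun 'I_m -> Lphi}), m%:R * s <= multisum nu.
Proof.
move=> Hs m nu; rewrite mulr_natl -[m in leLHS]card_ord -sumr_const.
by apply: ler_sum => i _; apply: Hs; exact: valP.
Qed.

Lemma multisum0 (nu : {ffun 'I_0 -> Lphi}) : multisum nu = 0.
Proof. by rewrite /multisum big_ord0. Qed.

Lemma multisum_gt0 m (nu : {ffun 'I_m -> Lphi}) : (0 < m)%N -> 0 < multisum nu.
Proof.
have [s s0 Hs] := Lphi_lbound => m0.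
by apply: lt_le_trans (multisum_ge Hs nu); rewrite mulr_gt0// ltr0n.
Qed.

(** Each term is at least a fixed [s > 0], so more than [r / s] of them overshoot [r]. This cuts the
    sums over [m] to one finite range, common to all exponents up to [r]. *)
Lemma multisum_large : exists M, forall m (nu : {ffun 'I_m -> Lphi}),
  (M <= m)%N -> r < multisum nu.
Proof.
have [s s0 Hs] := Lphi_lbound; exists (Num.truncn (r / s)).+1 => m nu Mm.
apply: lt_le_trans (multisum_ge Hs nu); rewrite -ltr_pdivrMr//.
by apply: (lt_le_trans (truncnS_gt _)); rewrite ler_nat.
Qed.

Lemma add_semigroup_seq (s : seq Lphi) : s != [::] ->
  add_semigroup Lphi (\sum_(x <- s) val x).
Proof.
case: s => // x s _; elim: s x => [|y s ih] x.
  by rewrite big_seq1; apply: add_semigroup_gen; exact: valP.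
rewrite big_cons; apply: add_semigroup_add (ih y).
by apply: add_semigroup_gen; exact: valP.
Qed.

Lemma add_semigroupP (x : R) : add_semigroup Lphi x <->
  exists m (nu : {ffun 'I_m -> Lphi}), (0 < m)%N /\ x = multisum nu.
Proof.
split=> [|[m [nu [m0 ->]]]]; last first.
  rewrite /multisum -big_enum/= -(big_map nu xpredT val).
  apply: add_semigroup_seq; rewrite -size_eq0 size_map size_enum_ord.
  by rewrite -lt0n.
move=> Sx; have [s s0 ->] : exists2 s : seq Lphi, s != [::] &
    x = \sum_(y <- s) val y.
  elim: Sx => [y yL|y1 y2 _ [s1 s10 ->] _ [s2 s20 ->]].
    by exists [:: [` yL]%fset]; rewrite ?big_seq1.
  by exists (s1 ++ s2); [case: s1 s10|rewrite big_cat].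
exists (size s), [ffun i => tnth (in_tuple s) i]; split.
  by rewrite lt0n size_eq0.
rewrite big_tnth; apply: eq_bigr => i _; by rewrite ffunE.
Qed.

(** The empty tuple accounts for the adjoined 0, so [m = 0] can be treated like every other
    length. *)
Lemma phase_exponentsP (x : R) : phase_exponents Lphi r x <->
  exists m (nu : {ffun 'I_m -> Lphi}), x = multisum nu /\ multisum nu <= r.
Proof.
split=> [[->|[/add_semigroupP[m [nu [m0 ->]]] /andP[_ ?]]]|].
- by exists 0%N, (ffun0 (card_ord 0)); rewrite multisum0 ltW.
- by exists m, nu.
move=> [[|m] [nu [-> nur]]]; first by left; rewrite multisum0.
right; split; first by apply/add_semigroupP; exists m.+1, nu.
by rewrite nur (ltW (multisum_gt0 _ _)).
Qed.

Lemma phase_exponents_ge0 x : phase_exponents Lphi r x -> 0 <= x <= r.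
Proof. by move=> [->|[_ ->]//]; rewrite lexx ltW. Qed.

Lemma finite_phase_exponents : finite_set (phase_exponents Lphi r).
Proof.
have [M HM] := multisum_large.
apply: (@sub_finite_set _ _
  (\bigcup_(m in `I_M) (range (@multisum m)))); last first.
  apply: bigcup_finite => // m _.
  by apply: finite_image; exact: finite_finset.
move=> x /phase_exponentsP[m [nu [-> nur]]].
exists m; last by exists nu.
by rewrite /= ltnNge; apply/negP => /HM -/(_ nu); rewrite ltNge nur.
Qed.

Lemma finite_exponents : finite_set (exponents Lb Lphi r).
Proof.
apply: (@sub_finite_set _ _
  [set x.1 + x.2 | x in [set` Lb] `*` phase_exponents Lphi r]).
  by move=> x [_ [l [eta [lL Eeta] ->]]]; exists (l, eta).
by apply/finite_image/finite_setX => //; exact: finite_phase_exponents.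
Qed.

End exponent_sets.

Section expansion_identities.
Context {R : realType} {X Y : Type}.
Variables (Lb Lphi : {fset R}) (r : R).
Variables (b : R -> X -> Y -> R[i]) (phi : R -> X -> Y -> R).
Hypothesis r0 : 0 < r.
Hypothesis Lb_r : forall l, l \in Lb -> 0 <= l <= r.
Hypothesis Lphi_r : forall nu, nu \in Lphi -> 0 < nu <= r.

Let E := fset_set (phase_exponents Lphi r).

Lemma in_phase_exponents x : (x \in E) = (x \in phase_exponents Lphi r).
Proof. by rewrite in_fset_set//; exact: finite_phase_exponents. Qed.

(** One formula covers both branches of [exp_coef]: for [eta = 0] only the empty tuple survives,
    since longer ones have positive sum, and it gives 1; for [eta != 0] the term [m = 0] vanishes.
    Lengths from [M] on give sums beyond [r], hence nothing. *)
Lemma exp_coefE M : (forall m (nu : {ffun 'I_m -> Lphi}), (M <= m)%N -> r < multisum nu) ->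
  forall eta p t, eta \in E -> exp_coef Lphi phi eta p t =
    \sum_(m < M) ((-1) ^+ m / m`!%:R *
      \sum_(nu : {ffun 'I_m -> Lphi} | multisum nu == eta)
        \prod_(i < m) phi (val (nu i)) p t).
Proof.
move=> HM eta p t; rewrite in_phase_exponents inE => Eeta.
have /andP[eta0 etar] := phase_exponents_ge0 r0 Eeta.
have M0 : (0 < M)%N.
  rewrite lt0n; apply/eqP => M0.
  have := HM 0%N (ffun0 (card_ord 0)); rewrite M0 => /(_ isT).
  by rewrite multisum0 ltNge ltW.
rewrite /exp_coef; case: eqVneq => [->|etan0].
  case: M M0 {HM} => // M _.
  rewrite big_ord_recl/= expr0 fact0 divr1 mul1r.
  rewrite (big_pred1 (ffun0 (card_ord 0))); last first.
    move=> nu /=; rewrite multisum0 eqxx.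
    by apply/esym/eqP/ffunP => -[].
  rewrite big_ord0 big1 ?addr0// => m _.
  rewrite big1 ?mulr0// => nu /eqP nu0.
  by have := @multisum_gt0 R Lphi r r0 Lphi_r m.+1 nu isT; rewrite nu0 ltxx.
case: M M0 HM => // M _ HM.
rewrite (fsbigE [seq i.+1 | i <- index_iota 0 M]); last 3 first.
- by rewrite map_inj_uniq ?iota_uniq// => ? ? [].
- by move=> m /= /mapP[k _ ->].
- move=> m /= m0 mM; rewrite big1 ?mulr0// => nu /eqP nueta.
  have : r < multisum nu.
    apply: HM; rewrite leqNgt; apply: contra mM => mM.
    apply/mapP; exists m.-1; last by rewrite prednK.
    by rewrite mem_index_iota/= -ltnS prednK.
  by rewrite /multisum nueta ltNge etar.
rewrite big_ord_recl/= [X in _ = _ * X + _]big1 ?mulr0 ?add0r; last first.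
  by move=> nu; rewrite multisum0 eq_sym (negbTE etan0).
rewrite big_map big_mkord; apply: eq_big => m //=.
by rewrite mem_set.
Qed.

(** Each tuple feeds the single exponent [multisum nu], which belongs to [E] exactly when it is at
    most [r]; exchanging the sums turns the grouping by exponent into a cut-off on tuples. *)
Lemma sum_exp_coef M : (forall m (nu : {ffun 'I_m -> Lphi}), (M <= m)%N -> r < multisum nu) ->
  forall (q : R) p t, 0 < q -> \sum_(eta <- E) q `^ eta * exp_coef Lphi phi eta p t =
    \sum_(m < M) ((-1) ^+ m / m`!%:R *
      \sum_(nu : {ffun 'I_m -> Lphi} | multisum nu <= r)
        \prod_(i < m) (q `^ val (nu i) * phi (val (nu i)) p t)).
Proof.
move=> HM q p t q0.
rewrite big_seq.
under eq_bigr => eta Eeta do rewrite (exp_coefE HM)// big_distrr/=.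
rewrite exchange_big/=; apply: eq_bigr => m _.
rewrite -big_seq; under eq_bigr do rewrite mulrCA.
rewrite -big_distrr/=; congr (_ * _).
under eq_bigr do rewrite big_distrr/= big_mkcond/=.
rewrite exchange_big/= [RHS]big_mkcond/=; apply: eq_bigr => nu _.
case: ifPn => nur.
  have nuE : multisum nu \in E.
    by rewrite in_phase_exponents inE; apply/(phase_exponentsP r0 Lphi_r); exists m, nu.
  rewrite (bigD1_seq _ nuE) ?fset_uniq//= eqxx.
  rewrite [X in _ + X]big1 ?addr0; last by move=> i; rewrite eq_sym => /negbTE ->.
  rewrite big_split/=; congr (_ * _).
  rewrite /multisum; elim/big_rec2: _ => [|i x y _ <-]; first by rewrite powRr0.
  by rewrite powRD// (gt_eqF q0) implybT.
rewrite big_seq big1// => x xE; case: eqP => // nux.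
move: xE; rewrite in_phase_exponents inE => /(phase_exponents_ge0 r0).
by rewrite -nux (negbTE nur) andbF.
Qed.

Lemma phase_sum_exp (q : R) p t m : 
  phase_sum Lphi phi q p t ^+ m =
  \sum_(nu : {ffun 'I_m -> Lphi}) \prod_(i < m) (q `^ val (nu i) * phi (val (nu i)) p t).
Proof.
rewrite /phase_sum big_seq_fsetE/=.
rewrite -[m in LHS]card_ord -prodr_const.
by rewrite bigA_distr_bigA.
Qed.

(** Each pair [(l, eta)] feeds the single exponent [l + eta], and pairs beyond [r] have no slot on
    the left. Their absence is one of the errors estimated in [small_density]. *)
Lemma sum_density_coef (q : R) p t : 0 < q ->
  \sum_(xi \in exponents Lb Lphi r)
    (q `^ xi)%:C%C * density_coef Lb Lphi b phi r xi p t =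
  \sum_(l <- Lb) \sum_(eta <- E | l + eta <= r)
    (q `^ l)%:C%C * b l p t * (q `^ eta * exp_coef Lphi phi eta p t)%:C%C.
Proof.
move=> q0.
have fE := finite_phase_exponents r0 Lphi_r.
have fX := finite_exponents Lb r0 Lphi_r.
(* Writing [l + eta = xi] as an indicator over the full product of index sets frees the inner sums
   from [xi], so that they can be exchanged with the sum over [xi]. *)
have dE xi : density_coef Lb Lphi b phi r xi p t = \sum_(l <- Lb) \sum_(eta <- E)
    if l + eta == xi then b l p t * (exp_coef Lphi phi eta p t)%:C%C else 0.
  rewrite /density_coef.
  pose s := [seq x <- [seq (l, eta) | l <- enum_fset Lb, eta <- enum_fset E] | x.1 + x.2 == xi].
  rewrite (_ : [set x | _] = [set` s]); last first.
    apply/seteqP; split => -[l eta] /=.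
      move=> [lL Eeta lx]; rewrite mem_filter/= lx eqxx/=.
      by apply/allpairsP; exists (l, eta); split=> //=; rewrite in_phase_exponents inE.
    rewrite mem_filter/= => /andP[/eqP lx /allpairsP[[l' eta'] /= [lL + [ll ee]]]].
    by rewrite -ll -ee in_phase_exponents inE in lL *.
  rewrite -fsbig_seq; last first.
    by rewrite filter_uniq// allpairs_uniq ?fset_uniq// => -[? ?] [? ?].
  rewrite /s big_filter big_mkcond/= big_allpairs/=.
  by [].
rewrite fsbig_finite//.
under eq_bigr do rewrite dE big_distrr/=.
rewrite exchange_big/= big_seq [RHS]big_seq; apply: eq_bigr => l lL.
under eq_bigr do rewrite big_distrr/=.
rewrite exchange_big/= [RHS]big_mkcond/= big_seq [RHS]big_seq; apply: eq_bigr => eta Eeta.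
have /phase_exponents_ge0 : phase_exponents Lphi r eta.
  by move: Eeta; rewrite in_phase_exponents inE.
move=> /(_ r0) /andP[eta0 etar].
case: ifPn => ler.
  have lE : l + eta \in fset_set (exponents Lb Lphi r).
    rewrite in_fset_set// inE; split.
      by rewrite ler andbT addr_ge0//; case/andP: (Lb_r lL).
    exists l, eta => //; split=> //.
    by move: Eeta; rewrite in_phase_exponents inE.
  rewrite (bigD1_seq _ lE) ?fset_uniq//= eqxx.
  rewrite big1 ?addr0; last first.
    by move=> i il; rewrite eq_sym (negbTE il) mulr0.
  rewrite powRD ?(gt_eqF q0) ?implybT// !rmorphM/=.
  by rewrite -!mulrA; congr (_ * _); rewrite mulrCA.
rewrite big_seq big1// => x xE; case: ifPn; rewrite ?mulr0// => /eqP lx.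
move: xE; rewrite in_fset_set// inE => -[/andP[_ xr]].
by rewrite lx xr in ler.
Qed.

End expansion_identities.

(** * Polynomial growth and asymptotic families *)

Section polynomial_growth.
Context {R : realType} {I : Type}.
Variables (D : set I) (rho : I -> R).
Hypothesis rho0 : forall x, D x -> 0 <= rho x.

(** A natural exponent makes products a matter of adding exponents; [0 <= K] allows raising [M] at
    fixed [K]. *)
Definition polybounded (u : I -> R) := exists (M : nat) (K : R), 0 <= K /\
  forall x, D x -> `|u x| <= K * (1 + rho x) ^+ M.

Lemma weight_ge1 x : D x -> 1 <= 1 + rho x.
Proof. by move=> /rho0; rewrite lerDl. Qed.

Lemma weightX_ge0 x M : D x -> 0 <= (1 + rho x) ^+ M.
Proof. by move=> /weight_ge1 ?; rewrite exprn_ge0// (le_trans ler01). Qed.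

Lemma weightX_le M M' x : D x -> (M <= M')%N ->
  (1 + rho x) ^+ M <= (1 + rho x) ^+ M'.
Proof. by move=> /weight_ge1 w1 MM'; exact: ler_weXn2l. Qed.

Lemma polybounded_le u v : (forall x, D x -> `|u x| <= `|v x|) ->
  polybounded v -> polybounded u.
Proof.
move=> uv [M [K [K0 H]]]; exists M, K; split=> // x Dx.
exact: le_trans (uv x Dx) (H x Dx).
Qed.

Lemma polybounded_cst c : polybounded (fun=> c).
Proof. by exists 0%N, `|c|; split=> // x _; rewrite expr0 mulr1. Qed.

Lemma polyboundedD u v : polybounded u -> polybounded v ->
  polybounded (fun x => u x + v x).
Proof.
move=> [M [K [K0 Hu]]] [M' [K' [K'0 Hv]]].
exists (maxn M M'), (K + K'); split; first exact: addr_ge0.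
move=> x Dx; apply: le_trans (ler_normD _ _) _; rewrite mulrDl lerD//.
  apply: le_trans (Hu _ Dx) _; apply: ler_wpM2l => //.
  by apply: weightX_le => //; exact: leq_maxl.
apply: le_trans (Hv _ Dx) _; apply: ler_wpM2l => //.
by apply: weightX_le => //; exact: leq_maxr.
Qed.

Lemma polyboundedM u v : polybounded u -> polybounded v ->
  polybounded (fun x => u x * v x).
Proof.
move=> [M [K [K0 Hu]]] [M' [K' [K'0 Hv]]].
exists (M + M')%N, (K * K'); split; first exact: mulr_ge0.
move=> x Dx; rewrite normrM exprD mulrACA; apply: ler_pM => //; first exact: Hu.
exact: Hv.
Qed.

Lemma polybounded_sum (J : eqType) (s : seq J) (P : pred J) (u : J -> I -> R) :
  (forall j, j \in s -> P j -> polybounded (u j)) ->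
  polybounded (fun x => \sum_(j <- s | P j) u j x).
Proof.
elim: s => [_|j s ih H].
  by apply: polybounded_le (polybounded_cst 0) => x _; rewrite big_nil.
have {}ih := ih (fun i is_ => H i (@mem_behead _ (j :: _) i is_)).
have [Pj|Pj] := boolP (P j).
  have uj := H j (mem_head _ _) Pj.
  by apply: polybounded_le (polyboundedD uj ih) => x _; rewrite big_cons Pj.
by apply: polybounded_le ih => x _; rewrite big_cons (negbTE Pj).
Qed.

Lemma polybounded_prod (J : eqType) (s : seq J) (u : J -> I -> R) :
  (forall j, j \in s -> polybounded (u j)) ->
  polybounded (fun x => \prod_(j <- s) u j x).
Proof.
elim: s => [_|j s ih H].
  by apply: polybounded_le (polybounded_cst 1) => x _; rewrite big_nil.
have {}ih := ih (fun i is_ => H i (@mem_behead _ (j :: _) i is_)).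
have uj := H j (mem_head _ _).
by apply: polybounded_le (polyboundedM uj ih) => x _; rewrite big_cons.
Qed.


(** The base is at least 1, so a real exponent, possibly negative, is dominated by a natural number
    above its absolute value. *)
Lemma powR_weight_le (L : R) : exists M : nat, forall x, D x ->
  (1 + rho x) `^ L <= (1 + rho x) ^+ M.
Proof.
exists (Num.truncn `|L|).+1 => x Dx; have w1 := weight_ge1 Dx.
rewrite -powR_mulrn ?(le_trans ler01)//; apply: ler_powR => //.
by rewrite (le_trans (ler_norm _))// ltW// truncnS_gt.
Qed.

End polynomial_growth.

Section negligible_families.
Context {R : realType} {Z : Type}.
Variables (D : set Z) (rho : Z -> R) (A : R).
Hypothesis rho0 : forall z, D z -> 0 <= rho z.
Hypothesis A0 : 0 < A.

(** The range [q < 1] makes [q^s] harmless for [s >= 0]. Tame families are the multipliers that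
    preserve [small_o]. *)
Definition tame (u : R -> Z -> R) :=
  polybounded [set x : R * Z | 0 < x.1 < 1 /\ D x.2] (rho \o snd)
    (fun x => u x.1 x.2).

(** The exponent [M] is chosen before [eps]: this is [o(q^s)] with a polynomial loss in [rho],
    uniform over a region that grows as [q] decreases. *)
Definition small_o (s : R) (u : R -> Z -> R) := exists M : nat,
  forall eps : R, 0 < eps -> \forall q \near 0^'+, forall z, D z ->
    rho z <= A * ln q^-1 -> `|u q z| <= eps * q `^ s * (1 + rho z) ^+ M.

Lemma tame_static (u : Z -> R) : polybounded D rho u -> tame (fun=> u).
Proof.
move=> [M [K [K0 H]]]; exists M, K; split=> //.
by move=> x /= [_ Dx]; exact: H.
Qed.

Lemma tame_powR s (u : Z -> R) : 0 <= s -> polybounded D rho u ->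
  tame (fun q z => q `^ s * u z).
Proof.
move=> s0 /tame_static; apply: polybounded_le => -[q z] /= [/andP[q0 q1] Dz].
rewrite normrM ger0_norm ?powR_ge0// ler_piMl//.
by rewrite -(powRr0 q) ger_powR// q0 ltW.
Qed.

Lemma small_o_le s u v :
  (\forall q \near 0^'+, forall z, D z -> rho z <= A * ln q^-1 ->
    `|u q z| <= `|v q z|) -> small_o s v -> small_o s u.
Proof.
move=> uv [M H]; exists M => e e0; near=> q => z Dz zq.
apply: (@le_trans _ _ `|v q z|); first by move: z Dz zq; near: q.
by move: z Dz zq; near: q; exact: H.
Unshelve. all: by end_near. Qed.

Lemma small_oD s u v : small_o s u -> small_o s v ->
  small_o s (fun q z => u q z + v q z).
Proof.
move=> [M Hu] [M' Hv]; exists (maxn M M') => e e0; have e20 : 0 < e / 2 by rewrite divr_gt0.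
near=> q => z Dz zq.
apply: le_trans (ler_normD _ _) _; rewrite (splitr e) -mulrA mulrDl.
apply: lerD.
  apply: (@le_trans _ _ (e / 2 * q `^ s * (1 + rho z) ^+ M)).
    by move: z Dz zq; near: q; exact: Hu.
  rewrite -mulrA !ler_wpM2l ?powR_ge0 ?(ltW e20)//.
  by apply: (weightX_le rho0) => //; exact: leq_maxl.
apply: (@le_trans _ _ (e / 2 * q `^ s * (1 + rho z) ^+ M')).
  by move: z Dz zq; near: q; exact: Hv.
rewrite -mulrA !ler_wpM2l ?powR_ge0 ?(ltW e20)//.
by apply: (weightX_le rho0) => //; exact: leq_maxr.
Unshelve. all: by end_near. Qed.

Lemma small_o0 s : small_o s (fun _ _ => 0).
Proof.
exists 0%N => e e0; near=> q => z Dz zq.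
by rewrite normr0 expr0 mulr1 mulr_ge0 ?powR_ge0 ?ltW.
Unshelve. all: by end_near. Qed.

Lemma small_o_sum s (J : eqType) (r : seq J) (P : pred J) (u : J -> R -> Z -> R) :
  (forall j, j \in r -> P j -> small_o s (u j)) ->
  small_o s (fun q z => \sum_(j <- r | P j) u j q z).
Proof.
elim: r => [_|j r ih H].
  by apply: small_o_le (small_o0 s); near=> q => z _ _; rewrite big_nil.
have {}ih := ih (fun i is_ => H i (@mem_behead _ (j :: _) i is_)).
have [Pj|Pj] := boolP (P j).
  have uj := H j (mem_head _ _) Pj.
  by apply: small_o_le (small_oD uj ih); near=> q => z _ _; rewrite big_cons Pj.
by apply: small_o_le ih; near=> q => z _ _; rewrite big_cons (negbTE Pj).
Unshelve. all: by end_near. Qed.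

Lemma small_oM s u v : small_o s u -> tame v ->
  small_o s (fun q z => u q z * v q z).
Proof.
move=> [M Hu] [M' [K [K0 Hv]]]; exists (M + M')%N => e e0.
have eK : 0 < e / (K + 1) by rewrite divr_gt0// ltr_wpDl.
near=> q => z Dz zq.
have q01 : 0 < q < 1 by near: q; exact: near0_lt.
rewrite normrM exprD.
have -> : e * q `^ s * ((1 + rho z) ^+ M * (1 + rho z) ^+ M') =
  (e / (K + 1) * q `^ s * (1 + rho z) ^+ M) * ((K + 1) * (1 + rho z) ^+ M').
  by field; rewrite gt_eqF// ltr_wpDl.
apply: ler_pM => //.
  by move: z Dz zq; near: q; exact: Hu.
apply: le_trans (Hv (q, z) (conj q01 Dz)) _ => /=.
by rewrite ler_wpM2r ?lerDl// (weightX_ge0 rho0).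
Unshelve. all: by end_near. Qed.

Lemma small_o_powR s s' u : s < s' -> tame u ->
  small_o s (fun q z => q `^ s' * u q z).
Proof.
move=> ss' [M [K [K0 H]]]; exists M => e e0; near=> q => z Dz zq.
have q01 : 0 < q < 1 by near: q; exact: near0_lt.
rewrite normrM ger0_norm ?powR_ge0//.
apply: (le_trans (ler_wpM2l (powR_ge0 _ _) (H (q, z) (conj q01 Dz)))) => /=.
rewrite mulrA ler_wpM2r ?(weightX_ge0 rho0)//.
rewrite -(subrK s s') powRD; last first.
  by have /andP[q0 _] := q01; rewrite (gt_eqF q0) implybT.
rewrite mulrAC ler_wpM2r ?powR_ge0// mulrC.
by near: q; apply: near0_powR_lt => //; rewrite subr_gt0.
Unshelve. all: by end_near. Qed.

(** The logarithmic radius pays off: [q^s] absorbs the polynomial loss, so the family is small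
    without any weight. *)
Lemma small_o_to0 s u e : 0 < s -> small_o s u -> 0 < e ->
  \forall q \near 0^'+, forall z, D z -> rho z <= A * ln q^-1 -> `|u q z| <= e.
Proof.
move=> s0 [M H] e0; near=> q => z Dz zq.
apply: (@le_trans _ _ (1 * q `^ s * (1 + rho z) ^+ M)).
  by move: z Dz zq; near: q; exact: H.
rewrite mul1r.
by move: (rho z) (rho0 Dz) zq; near: q; apply: near0_powR_log.
Unshelve. all: by end_near. Qed.

End negligible_families.

(** * Expansion of the density in the logarithmic region *)

Section density_expansion.
Context {R : realType} {X Y : Type}.
Variables (Lb Lphi : {fset R}) (r : R).
Variables (b : R -> X -> Y -> R[i]) (phi : R -> X -> Y -> R).
Hypothesis r0 : 0 < r.
Hypothesis Lb_r : forall l, l \in Lb -> 0 <= l <= r.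
Hypothesis Lphi_r : forall nu, nu \in Lphi -> 0 < nu <= r.
Variables (D : set (X * Y)) (rho : X * Y -> R).
Hypothesis rho0 : forall z, D z -> 0 <= rho z.
Hypothesis b_poly : forall l, l \in Lb ->
  polybounded D rho (fun z => cabs (b l z.1 z.2)).
Hypothesis phi_poly : forall nu, nu \in Lphi ->
  polybounded D rho (fun z => phi nu z.1 z.2).

Let E := fset_set (phase_exponents Lphi r).

Lemma polybounded_prod_phase m (nu : {ffun 'I_m -> Lphi}) :
  polybounded D rho (fun z => \prod_(i < m) phi (val (nu i)) z.1 z.2).
Proof.
apply: (@polybounded_prod R _ D rho _ _
  (fun (i : 'I_m) z => phi (val (nu i)) z.1 z.2)) => i _.
by apply: phi_poly; exact: valP.
Qed.

Lemma polybounded_exp_coef eta : eta \in E ->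
  polybounded D rho (fun z => exp_coef Lphi phi eta z.1 z.2).
Proof.
move=> etaE; have [M HM] := multisum_large r0 Lphi_r.
apply: (@polybounded_le _ _ D rho _ (fun z => \sum_(m < M) ((-1) ^+ m / m`!%:R *
      \sum_(nu : {ffun 'I_m -> Lphi} | multisum nu == eta)
        \prod_(i < m) phi (val (nu i)) z.1 z.2))).
  by move=> z _; rewrite (exp_coefE phi r0 Lphi_r HM).
apply: (polybounded_sum rho0) => m _ _.
apply: polyboundedM; first exact: polybounded_cst.
by apply: (polybounded_sum rho0) => nu _ _; exact: polybounded_prod_phase.
Qed.

Lemma polybounded_density_coef xi :
  polybounded D rho (fun z => cabs (density_coef Lb Lphi b phi r xi z.1 z.2)).
Proof.
pose S := [set x : R * R |
  [/\ x.1 \in Lb, phase_exponents Lphi r x.2 & x.1 + x.2 = xi]].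
have fS : finite_set S.
  apply: (@sub_finite_set _ _ ([set` Lb] `*` phase_exponents Lphi r)).
    by move=> x [].
  by apply: finite_setX => //; exact: finite_phase_exponents.
(* Multiplying by the sign writes the absolute value of [exp_coef] as a product to which
   [polyboundedM] applies. *)
apply: (@polybounded_le _ _ D rho _ (fun z => \sum_(x <- fset_set S)
   (cabs (b x.1 z.1 z.2) * exp_coef Lphi phi x.2 z.1 z.2 *
    Num.sg (exp_coef Lphi phi x.2 z.1 z.2)))).
  move=> z _; rewrite /density_coef fsbig_finite//.
  rewrite ger0_norm ?cabs_ge0//; apply: (le_trans (cabs_sum _ _ _)).
  apply: (le_trans _ (ler_norm _)); apply: ler_sum => x _.
  by rewrite cabsM cabsR -mulrA ler_wpM2l ?cabs_ge0// mulrC -normrEsg.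
rewrite -/S; apply: (polybounded_sum rho0) => x; rewrite in_fset_set// inE.
move=> -[x1 x2 _] _; apply: polyboundedM.
  apply: polyboundedM; first exact: b_poly.
  by apply: polybounded_exp_coef; rewrite in_phase_exponents// inE.
apply: (@polybounded_le _ _ D rho _ (fun=> 1)); last exact: polybounded_cst.
by move=> z _; rewrite normr1 normr_sg; case: (_ != 0).
Qed.

Variable A : R.
Hypothesis A0 : 0 < A.
Let small := small_o D rho A r.
Let w := fun q (z : X * Y) => phase_sum Lphi phi q z.1 z.2.
Let T := fun q (z : X * Y) =>
  \sum_(eta <- E) q `^ eta * exp_coef Lphi phi eta z.1 z.2.

Lemma phase_sum_le s : 0 < s -> (forall nu, nu \in Lphi -> s <= nu) ->
  exists M K, 0 <= K /\ forall q z, 0 < q < 1 -> D z ->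
    `|w q z| <= q `^ s * (K * (1 + rho z) ^+ M).
Proof.
move=> s0 Hs.
have [M [K [K0 HK]]] : polybounded D rho
    (fun z => \sum_(nu <- Lphi) `|phi nu z.1 z.2|).
  apply: (polybounded_sum rho0) => nu nuL _.
  apply: (@polybounded_le _ _ D rho _ (fun z => phi nu z.1 z.2)).
    by move=> z _; rewrite normr_id.
  exact: phi_poly.
exists M, K; split=> // q z /andP[q0 q1] Dz.
apply: (@le_trans _ _ (q `^ s * \sum_(nu <- Lphi) `|phi nu z.1 z.2|)).
  rewrite /w /phase_sum; apply: (le_trans (ler_norm_sum _ _ _)).
  rewrite big_distrr/= big_seq [leRHS]big_seq; apply: ler_sum => nu nuL.
  rewrite normrM ger0_norm ?powR_ge0// ler_wpM2r// ger_powR ?Hs//.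
  by rewrite q0 ltW.
rewrite ler_wpM2l ?powR_ge0//; apply: le_trans (HK z Dz).
by rewrite ger0_norm// sumr_ge0.
Qed.

(** The smallest exponent [s] provides a factor [q^s], which beats the growth of the coefficients
    inside the logarithmic region; from here on exponentials of the correction are bounded by
    constants. *)
Lemma near_phase_sum_le1 : \forall q \near 0^'+, forall z, D z ->
  rho z <= A * ln q^-1 -> `|w q z| <= 1.
Proof.
have [s s0 Hs] := Lphi_lbound r0 Lphi_r.
have [M [K [K0 HK]]] := phase_sum_le s0 Hs.
have K1 : 0 < (K + 1)^-1 by rewrite invr_gt0 ltr_wpDl.
near=> q => z Dz zq.
have q01 : 0 < q < 1 by near: q; exact: near0_lt.
apply: (le_trans (HK _ _ q01 Dz)); rewrite mulrCA.
apply: (@le_trans _ _ ((K + 1) * (K + 1)^-1)); last first.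
  by rewrite divff// gt_eqF// ltr_wpDl.
apply: ler_pM => //; first by rewrite mulr_ge0 ?powR_ge0// (weightX_ge0 rho0).
  by rewrite lerDl.
by move: (rho z) (rho0 Dz) zq; near: q; exact: near0_powR_log.
Unshelve. all: by end_near. Qed.

(** The Taylor polynomial of [exp (- w)] and [T] are sums of the same monomials over tuples, except
    that the polynomial also contains tuples with sum above [r]. The error is Taylor's remainder
    plus finitely many monomials of exponent above [r]. *)
Lemma small_exp_phase_sum : small (fun q z => expR (- w q z) - T q z).
Proof.
have [s s0 Hs] := Lphi_lbound r0 Lphi_r.
have [M [K [K0 HK]]] := phase_sum_le s0 Hs.
(* One [m] with [m * s > r] serves twice: the remainder is [O(q^(m s))] up to weights, and tuples of
   length at least [m] have sum above [r], so [T] involves only shorter ones. *)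
pose m := (Num.truncn (r / s)).+1.
have rms : r < m%:R * s by rewrite -ltr_pdivrMr// truncnS_gt.
have Hm k (nu : {ffun 'I_k -> Lphi}) : (m <= k)%N -> r < multisum nu.
  move=> mk; apply: (lt_le_trans rms); apply: le_trans (multisum_ge Hs nu).
  by rewrite ler_pM2r// ler_nat.
pose S q z := \sum_(k < m) (- w q z) ^+ k / k`!%:R.
suff [H1 H2] : small (fun q z => expR (- w q z) - S q z) /\
              small (fun q z => S q z - T q z).
  apply: (small_o_le _ (small_oD rho0 H1 H2)).
  by apply: nearW => q z _ _; rewrite addrA subrK.
split.
  pose u := fun (q : R) (z : X * Y) =>
    q `^ (m%:R * s) * ((K * (1 + rho z) ^+ M) ^+ m * expR 1).
  apply: (@small_o_le _ _ _ _ _ _ _ u); last first.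
    rewrite /u; apply: (small_o_powR _ rho0) => //; apply: tame_static.
    exists (M * m)%N, (K ^+ m * expR 1); split.
      by rewrite mulr_ge0 ?exprn_ge0 ?expR_ge0.
    move=> z Dz; have ge0 := weightX_ge0 rho0 M Dz.
    rewrite ger0_norm; last by rewrite mulr_ge0 ?expR_ge0// exprn_ge0// mulr_ge0.
    by rewrite exprMn exprM mulrAC.
  near=> q => z Dz zq.
  have q01 : 0 < q < 1 by near: q; exact: near0_lt.
  have ge0 := weightX_ge0 rho0 M Dz.
  have w1 : `|w q z| <= 1.
    by move: z Dz zq {ge0}; near: q; exact: near_phase_sum_le1.
  apply: (le_trans (expR_taylor_le _ _)); rewrite normrN.
  rewrite /u [leRHS]ger0_norm; last first.
    by rewrite mulr_ge0 ?powR_ge0// mulr_ge0 ?expR_ge0// exprn_ge0// mulr_ge0.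
  rewrite mulrA ler_pM ?exprn_ge0 ?expR_ge0 ?ler_expR//.
  rewrite [m%:R * s]mulrC powRrM powR_mulrn ?powR_ge0// -exprMn.
  rewrite lerXn2r ?nnegrE ?mulr_ge0 ?powR_ge0//.
  exact: HK.
(* These are the monomials beyond [r]; [S - T] is shown to be equal to this sum. *)
pose u := fun (q : R) (z : X * Y) => \sum_(k < m) \sum_(nu : {ffun 'I_k -> Lphi} | ~~ (multisum nu <= r))
  q `^ multisum nu * ((-1) ^+ k / k`!%:R * \prod_(i < k) phi (val (nu i)) z.1 z.2).
apply: (@small_o_le _ _ _ _ _ _ _ u); last first.
  rewrite /u; apply: (small_o_sum rho0) => k _ _.
  apply: (small_o_sum rho0) => nu _ nur.
  apply: (small_o_powR _ rho0); first by rewrite ltNge.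
  apply: tame_static; apply: polyboundedM; first exact: polybounded_cst.
  exact: polybounded_prod_phase.
near=> q => z Dz zq.
have q0 : 0 < q by near: q; exact: nbhs_right_gt.
rewrite le_eqVlt; apply/orP; left; apply/eqP; congr (`| _ |).
rewrite /S /T (sum_exp_coef phi r0 Lphi_r Hm)// -sumrB; apply: eq_bigr => k _.
rewrite [(- w q z) ^+ k]exprNn [X in X - _]mulrAC /w phase_sum_exp.
rewrite (bigID (fun nu : {ffun 'I_k -> Lphi} => multisum nu <= r))/=.
rewrite mulrDr addrAC subrr add0r big_distrr/=; apply: eq_bigr => nu _.
rewrite mulrCA; congr (_ * _); rewrite big_split/=; congr (_ * _).
rewrite /multisum; elim/big_rec2: _ => [|i x y _ ->]; first by rewrite powRr0.
by rewrite powRD// (gt_eqF q0) implybT.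
Unshelve. all: by end_near. Qed.

Lemma tame_amplitude_sum :
  tame D rho (fun q z => cabs (amplitude_sum Lb b q z.1 z.2)).
Proof.
apply: (@polybounded_le _ _ _ _ _ (fun x : R * (X * Y) =>
   \sum_(l <- Lb) x.1 `^ l * cabs (b l x.2.1 x.2.2))).
  move=> x _; rewrite ger0_norm ?cabs_ge0//.
  apply: (le_trans (cabs_sum _ _ _)); apply: le_trans (ler_norm _).
  by apply: ler_sum => l _; rewrite cabsM cabsR ger0_norm ?powR_ge0.
apply: polybounded_sum => [x [_ Dx]|l lL _]; first exact: rho0.
apply: (@tame_powR _ _ D rho l (fun z => cabs (b l z.1 z.2))).
  by case/andP: (Lb_r lL).
exact: b_poly.
Qed.

Variables (bt : R -> X * Y -> R[i]) (Phi : R -> X * Y -> R) (G : X * Y -> R).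
Hypothesis bt_small : small (fun q z =>
  cabs (bt q z - amplitude_sum Lb b q z.1 z.2)).
Hypothesis Phi_small : small (fun q z =>
  Phi q z - (G z + phase_sum Lphi phi q z.1 z.2)).

(** Telescoping: replace the amplitude, then the exponential, by their expansions, and discard from
    the product of expansions the pairs with exponent above [r]. The exponential stays below [exp 2]
    because the phase correction and its remainder are eventually at most 1. *)
Lemma small_density : small (fun q z =>
  cabs (bt q z * (expR (G z - Phi q z))%:C%C -
    \sum_(xi \in exponents Lb Lphi r)
      (q `^ xi)%:C%C * density_coef Lb Lphi b phi r xi z.1 z.2)).
Proof.
pose rf q z := Phi q z - (G z + w q z).
pose B q (z : X * Y) := amplitude_sum Lb b q z.1 z.2.
have ex q z : G z - Phi q z = - w q z - rf q z by rewrite /rf; lra.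
have near_rf : \forall q \near 0^'+, forall z, D z ->
  rho z <= A * ln q^-1 -> `|rf q z| <= 1.
  by apply: (small_o_to0 rho0 A0 r0 Phi_small).
have H1 : small (fun q z => cabs (bt q z - B q z) * expR 2).
  apply: (small_oM rho0 bt_small); apply: polybounded_cst.
have H2 : small (fun q z => cabs (B q z) * `|expR (G z - Phi q z) - T q z|).
  apply: (@small_o_le _ _ _ _ _ _ _ (fun q z =>
    (expR (G z - Phi q z) - T q z) * cabs (B q z))).
    by apply: nearW => q z _ _; rewrite mulrC !normrM normr_id.
  apply: (small_oM rho0) tame_amplitude_sum.
  suff : small (fun q z => expR (G z - Phi q z) - expR (- w q z)).
    move=> H; apply: (small_o_le _ (small_oD rho0 H small_exp_phase_sum)).
    by apply: nearW => q z _ _; rewrite addrA subrK.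
  (* Factor out [exp (- w)]: the order 1 Taylor bound for [exp (- rf) - 1], with [w] and [rf] at
     most 1 in modulus, gives [|rf| * exp 2]. *)
  apply: (@small_o_le _ _ _ _ _ _ _ (fun q z => rf q z * expR 2)).
    near=> q => z Dz zq.
    have w1 : `|w q z| <= 1 by move: z Dz zq; near: q; exact: near_phase_sum_le1.
    have r1 : `|rf q z| <= 1 by move: z Dz zq {w1}; near: q; exact: near_rf.
    rewrite ex expRD -{2}[expR (- w q z)]mulr1 -mulrBr !normrM.
    rewrite !(ger0_norm (expR_ge0 _)).
    have := expR_taylor_le (- rf q z) 1.
    rewrite big_ord1 expr0 fact0 divr1 expr1 normrN => H.
    have -> : 2 = 1 + 1 :> R by lra.
    rewrite expRD mulrCA; apply: ler_pM; rewrite ?expR_ge0//.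
      by rewrite ler_expR; apply: le_trans w1; rewrite -normrN ler_norm.
    apply: (le_trans H); rewrite ler_wpM2l// ler_expR//.
  by apply: (small_oM rho0 Phi_small); apply: polybounded_cst.
(* Pairs produced by the product [B * T] whose exponent exceeds [r]. *)
have H3 : small (fun q z => \sum_(l <- Lb) \sum_(eta <- E | ~~ (l + eta <= r))
   q `^ (l + eta) * (cabs (b l z.1 z.2) * `|exp_coef Lphi phi eta z.1 z.2|)).
  apply: (small_o_sum rho0) => l lL _; apply: (small_o_sum rho0) => eta etaE ler.
  apply: (small_o_powR _ rho0); first by rewrite ltNge.
  apply: tame_static; apply: polyboundedM; first exact: b_poly.
  apply: polybounded_le (polybounded_exp_coef etaE) => z _.
  by rewrite normr_id.
apply: (small_o_le _ (small_oD rho0 (small_oD rho0 H1 H2) H3)).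
near=> q => z Dz zq.
have q0 : 0 < q by near: q; exact: nbhs_right_gt.
have w1 : `|w q z| <= 1 by move: z Dz zq; near: q; exact: near_phase_sum_le1.
have r1 : `|rf q z| <= 1 by move: z Dz zq {w1}; near: q; exact: near_rf.
rewrite ger0_norm ?cabs_ge0//.
pose H := expR (G z - Phi q z).
have H2e : `|H| <= expR 2.
  rewrite /H ger0_norm ?expR_ge0// ex ler_expR.
  move: w1 r1; rewrite !ler_norml => /andP[? ?] /andP[? ?].
  lra.
rewrite (sum_density_coef b phi r0 Lb_r Lphi_r)//.
set S1 := \sum_(l <- Lb) _.
pose S2 := \sum_(l <- Lb) \sum_(eta <- E | ~~ (l + eta <= r))
  (q `^ l)%:C%C * b l z.1 z.2 * (q `^ eta * exp_coef Lphi phi eta z.1 z.2)%:C%C.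
have BT : B q z * (T q z)%:C%C = S1 + S2.
  rewrite /S1 /S2 -big_split /B /amplitude_sum big_distrl/=.
  apply: eq_bigr => l _; rewrite /T rmorph_sum/= big_distrr/=.
  by rewrite (bigID (fun eta => l + eta <= r)).
have -> : bt q z * H%:C%C - S1 =
    (bt q z - B q z) * H%:C%C + B q z * (H - T q z)%:C%C + S2.
  rewrite (_ : S1 = B q z * (T q z)%:C%C - S2); last by rewrite BT addrK.
  by rewrite rmorphB/=; ring.
apply: le_trans (ler_norm _) => /=.
apply: (le_trans (cabsD _ _)); apply: (@lerD R).
  apply: (le_trans (cabsD _ _)); apply: (@lerD R).
    by rewrite cabsM cabsR ler_wpM2l ?cabs_ge0.
  by rewrite cabsM cabsR.
apply: (le_trans (cabs_sum _ _ _)); apply: ler_sum => l _.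
apply: (le_trans (cabs_sum _ _ _)); apply: ler_sum => eta _.
rewrite !cabsM !cabsR normrM !(ger0_norm (powR_ge0 _ _)).
by rewrite powRD ?(gt_eqF q0) ?implybT// mulrACA mulrA.
Unshelve. all: by end_near. Qed.

End density_expansion.

(** * Weighted expansion on whole cells *)

Section weighted_density_expansion.
Context {R : realType} {X Y : Type}.
Variables (Lb Lphi : {fset R}) (r : R).
Variables (b : R -> X -> Y -> R[i]) (phi : R -> X -> Y -> R).
Hypothesis r0 : 0 < r.
Hypothesis Lb_r : forall l, l \in Lb -> 0 <= l <= r.
Hypothesis Lphi_r : forall nu, nu \in Lphi -> 0 < nu <= r.
Variables (D : set (X * Y)) (rho : X * Y -> R).
Hypothesis rho0 : forall z, D z -> 0 <= rho z.
Hypothesis b_poly : forall l, l \in Lb ->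
  polybounded D rho (fun z => cabs (b l z.1 z.2)).
Hypothesis phi_poly : forall nu, nu \in Lphi ->
  polybounded D rho (fun z => phi nu z.1 z.2).
Variables (bt : R -> X * Y -> R[i]) (Phi : R -> X * Y -> R) (G : X * Y -> R).
Hypothesis bt_small : forall A, 0 < A -> small_o D rho A r (fun q z =>
  cabs (bt q z - amplitude_sum Lb b q z.1 z.2)).
Hypothesis Phi_small : forall A, 0 < A -> small_o D rho A r (fun q z =>
  Phi q z - (G z + phase_sum Lphi phi q z.1 z.2)).
Variable g : R.
Hypothesis g0 : 0 < g.
Hypothesis G_ge : forall z, D z -> g * rho z <= G z.
Variables (kG Kb : R) (Mb : nat).
Hypothesis kG0 : 0 < kG.
Hypothesis Kb0 : 0 <= Kb.
Hypothesis bt_le : \forall q \near 0^'+, forall z, D z ->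
  cabs (bt q z) <= Kb * (1 + rho z) ^+ Mb.
Hypothesis Phi_ge : \forall q \near 0^'+, forall z, D z -> kG * G z <= Phi q z.

(** A single rate for both kinds of terms: coefficients come with [exp (- G)], while the weighted
    density comes with [exp (- Phi)], which is at most [exp (- kG * G)]. *)
Let decay : R := g * Order.min 1 kG.

Let decay_gt0 : 0 < decay.
Proof. by rewrite mulr_gt0// lt_min ltr01. Qed.

Let decay_G z : D z -> expR (- G z) <= expR (- (decay * rho z)).
Proof.
move=> Dz; rewrite ler_expR lerN2; apply: le_trans (G_ge Dz).
rewrite ler_wpM2r ?rho0// -[leRHS]mulr1 ler_wpM2l ?(ltW g0)//.
by rewrite ge_min lexx.
Qed.

(** The factor [exp G] cancels, since [exp (G - Phi) * exp (- G) = exp (- Phi)], and the lower bound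
    on [Phi] is global, so no restriction on [rho] appears. *)
Lemma density_decay : \forall q \near 0^'+, forall z, D z ->
  cabs (bt q z * (expR (G z - Phi q z))%:C%C) * expR (- G z) <=
  Kb * (1 + rho z) ^+ Mb * expR (- (decay * rho z)).
Proof.
near=> q => z Dz.
rewrite cabsM cabsR ger0_norm ?expR_ge0// -mulrA -expRD addrAC subrr add0r.
apply: ler_pM; rewrite ?cabs_ge0 ?expR_ge0//.
  by move: z Dz; near: q; exact: bt_le.
rewrite ler_expR lerN2; apply: (@le_trans _ _ (kG * G z)).
  rewrite /decay mulrAC mulrC; apply: ler_pM.
  - by rewrite le_min ler01 ltW.
  - by rewrite mulr_ge0 ?rho0// ltW.
  - by rewrite ge_min lexx orbT.
  - exact: G_ge.
by move: z Dz; near: q; exact: Phi_ge.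
Unshelve. all: by end_near. Qed.

(** Inside the logarithmic region the pointwise expansion applies. Outside it no cancellation is
    available or sought: density and coefficients are bounded separately by their decay. *)
Lemma weighted_density_expansion : exists (M : nat) (k : R), 0 < k /\
  forall eps, 0 < eps -> \forall q \near 0^'+, forall z, D z ->
    cabs (bt q z * (expR (G z - Phi q z))%:C%C -
      \sum_(xi \in exponents Lb Lphi r)
        (q `^ xi)%:C%C * density_coef Lb Lphi b phi r xi z.1 z.2) *
      expR (- G z) <=
    eps * q `^ r * ((1 + rho z) ^+ M * expR (- (k * rho z))).
Proof.
(* Half of the decay is spent in the tail; the other half remains as [exp (- k * rho)]. *)
pose k := decay / 2; have k0 : 0 < k by rewrite divr_gt0.
(* Chosen so that [rho > A * ln q^-1] gives [exp (- k * rho) <= q^(r + 1)]; the spare factor [q]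
   finally brings the constant [Kb + K2] below [e]. *)
pose A := (r + 1) / k; have A0 : 0 < A by rewrite divr_gt0// addr_gt0.
have [M1 H1] := small_density r0 Lb_r Lphi_r rho0 b_poly phi_poly A0
  (bt_small A0) (Phi_small A0).
pose Lam := fset_set (exponents Lb Lphi r).
have fLam := finite_exponents Lb r0 Lphi_r.
have [M2 [K2 [K20 H2]]] : polybounded D rho (fun z =>
    \sum_(xi <- Lam) cabs (density_coef Lb Lphi b phi r xi z.1 z.2)).
  by apply: (polybounded_sum rho0) => xi _ _; exact: polybounded_density_coef.
exists (M1 + (Mb + M2))%N, k; split=> // e e0.
have w1 z : D z -> 1 <= 1 + rho z by move=> /rho0; rewrite lerDl.
near=> q => z Dz.
have q01 : 0 < q < 1 by near: q; exact: near0_lt.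
have /andP[q0 q1] := q01.
have kd : expR (- (decay * rho z)) = expR (- (k * rho z)) * expR (- (k * rho z)).
  by rewrite -expRD /k; congr expR; lra.
have ek1 : expR (- (k * rho z)) <= 1.
  by rewrite expR_le1 oppr_le0 mulr_ge0 ?rho0// ltW.
have [zq|zq] := leP (rho z) (A * ln q^-1).
  rewrite mulrA; apply: ler_pM; rewrite ?cabs_ge0 ?expR_ge0//.
    apply: (@le_trans _ _ (e * q `^ r * (1 + rho z) ^+ M1)).
      apply: (le_trans (ler_norm _)).
      by move: z Dz zq {kd ek1}; near: q; exact: H1.
    rewrite ler_wpM2l ?mulr_ge0 ?powR_ge0 ?(ltW e0)//.
    by rewrite (weightX_le rho0)// leq_addr.
  apply: (le_trans (decay_G Dz)).
  by rewrite kd ler_piMr ?expR_ge0.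
have tail : expR (- (k * rho z)) <= q * q `^ r.
  rewrite -{1}(powRr1 (ltW q0)) -powRD ?(gt_eqF q0) ?implybT//.
  rewrite /powR gt_eqF// ler_expR lerNl.
  move: zq; rewrite lnV ?posrE// => zq.
  apply: le_trans (ler_wpM2l (ltW k0) (ltW zq)).
  rewrite le_eqVlt; apply/orP; left; apply/eqP.
  by rewrite /A; field; exact: lt0r_neq0.
apply: (@le_trans _ _ ((Kb + K2) * (1 + rho z) ^+ (M1 + (Mb + M2)) *
  expR (- (decay * rho z)))).
  rewrite mulrDl mulrDl.
  apply: (@le_trans _ _ (cabs (bt q z * (expR (G z - Phi q z))%:C%C) * expR (- G z) +
    cabs (\sum_(xi \in exponents Lb Lphi r)
        (q `^ xi)%:C%C * density_coef Lb Lphi b phi r xi z.1 z.2) * expR (- G z))).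
    by rewrite -mulrDl ler_wpM2r ?expR_ge0// cabsB.
  apply: lerD.
    apply: (@le_trans _ _ (Kb * (1 + rho z) ^+ Mb * expR (- (decay * rho z)))).
      by move: z Dz {kd ek1 zq tail}; near: q; exact: density_decay.
    rewrite ler_wpM2r ?expR_ge0// ler_wpM2l//.
    by rewrite (weightX_le rho0)// addnCA leq_addr.
  apply: ler_pM; rewrite ?cabs_ge0 ?expR_ge0 ?decay_G//.
  apply: (@le_trans _ _ (K2 * (1 + rho z) ^+ M2)); last first.
    by rewrite ler_wpM2l// (weightX_le rho0)// addnA leq_addl.
  apply: le_trans (H2 z Dz); rewrite fsbig_finite//.
  apply: (le_trans (cabs_sum _ _ _)); apply: le_trans (ler_norm _).
  rewrite big_seq [leRHS]big_seq; apply: ler_sum => xi.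
  rewrite in_fset_set// inE => -[/andP[xi0 _] _].
  rewrite cabsM cabsR ger0_norm ?powR_ge0// ler_piMl ?cabs_ge0//.
  by rewrite -(powRr0 q) ger_powR// q0 ltW.
rewrite kd mulrA mulrAC [leRHS]mulrA ler_wpM2r ?expR_ge0//.
rewrite mulrAC ler_wpM2r ?(weightX_ge0 rho0)//.
apply: (le_trans (ler_wpM2l (addr_ge0 Kb0 K20) tail)).
rewrite mulrA ler_wpM2r ?powR_ge0//.
rewrite -(powRr1 (ltW q0)).
by near: q; apply: near0_powR_lt.
Unshelve. all: by end_near. Qed.

End weighted_density_expansion.

(** * Lebesgue measure on row vectors *)

Section lebesgue_rV_integration.
Context {R : realType}.
Local Notation leb := (@lebesgue_measure R).

Lemma measurable_coord n (i : 'I_n) :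
  measurable_fun setT (fun w : borelType 'rV[R]_n => w ord0 i : measurableTypeR R).
Proof.
apply: (measurability _ (RGenOpens.measurableE R)).
move=> _ [_ [a [b ->] <-]]; rewrite setTI; apply: sub_sigma_algebra.
apply: open_comp; last exact: interval_open.
by move=> w _; exact: coord_continuous.
Qed.

(** Balls for the sup norm are products of intervals, and every open set is a countable union of
    rational balls, so coordinates suffice. *)
Lemma measurable_rV d (T : measurableType d) n (F : T -> borelType 'rV[R]_n) (D : set T) :
  measurable D ->
  (forall i, measurable_fun D (fun x => F x ord0 i : measurableTypeR R)) ->
  measurable_fun D F.
Proof.
move=> mD mF.
refine (@measurability _ _ T (borelType 'rV[R]_n) D F (@open 'rV[R]_n) erefl _).
move=> _ [U oU <-].
rewrite (open_rV_bigcup oU) preimage_bigcup setI_bigcupr.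
rewrite bigcup_mkcond; apply: countable_bigcupT_measurable => // -[v k].
case: ifP => [_|_]; last exact: measurable0.
rewrite [X in measurable X](_ : _ = D `&` \bigcap_(i in [set: 'I_n])
    (D `&` (fun x => F x ord0 i) @^-1` ball (ratr (v ord0 i) : R) k.+1%:R^-1)).
  apply: measurableI => //; apply: fin_bigcap_measurable => // i _.
  apply: (mF i) => //; apply: open_measurable; exact: ball_open.
apply/seteqP; split=> x /= [Dx].
  by move=> [k0 H]; split=> // i _; split => //; have := H ord0 i; rewrite mxE.
by move=> H; split=> //; split=> // i j; rewrite ord1 mxE; case: (H j).
Qed.

Lemma ge0_integral_rVS n (h : borelType 'rV[R]_n.+1 -> \bar R) :
  measurable_fun setT h -> (forall w, 0 <= h w)%E ->
  (\int[lebesgue_rV n.+1]_w h w =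
   \int[leb]_x \int[lebesgue_rV n]_v h (cons_rV (x, v)))%E.
Proof.
move=> mh h0.
change (\int[pushforward (leb \x lebesgue_rV n) (@cons_rV R n)]_w h w =
   \int[leb]_x \int[lebesgue_rV n]_v h (cons_rV (x, v)))%E.
rewrite (ge0_integral_pushforward (@measurable_cons_rV R n))//.
rewrite preimage_setT fubini_tonelli1//=.
exact: (measurableT_comp mh (@measurable_cons_rV R n)).
Qed.

Lemma ge0_integral_rV0 (h : borelType 'rV[R]_0 -> \bar R) :
  measurable_fun setT h -> (\int[lebesgue_rV 0]_w h w)%E = h (0 : 'rV[R]_0).
Proof.
move=> mh; rewrite /= integral_dirac// diracE in_setT mul1e//.
Qed.

(** The measure [k] times the image of Lebesgue measure under [x |-> k * x] agrees with Lebesgue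
    measure on half-open intervals, which determine it. *)
Lemma ge0_integral_scale (k : R) (h : measurableTypeR R -> \bar R) :
  0 < k -> measurable_fun setT h -> (forall x, 0 <= h x)%E ->
  (\int[leb]_x h x = k%:E * \int[leb]_x h (k * x)%R)%E.
Proof.
move=> k0 mh h0.
have mk : measurable_fun setT (fun x : measurableTypeR R => k * x : measurableTypeR R).
  exact: measurable_funM.
pose nu : {measure set (measurableTypeR R) -> \bar R} :=
  mscale (NngNum (ltW k0)) (pushforward leb (fun x : measurableTypeR R => k * x : measurableTypeR R)).
(* [nu] abstracts over the measurability proof its measure structure needs. *)
pose mu := nu mk.
have E : forall X, measurable X -> leb X = mu X.
  apply: lebesgue_measure_unique => X /ocitvP[->|[[a b] /= ab ->]].
    by rewrite !measure0.
  rewrite /mu /nu /= /mscale /= /pushforward.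
  rewrite (_ : _ @^-1` _ = `](a / k), (b / k)]%classic); last first.
    apply/seteqP; split => x /=; rewrite !in_itv/= ltr_pdivrMr// ler_pdivlMr//;
    by rewrite mulrC.
  rewrite !lebesgue_measure_itv/= !lte_fin ab ltr_pM2r ?invr_gt0// ab.
  rewrite -!EFinD -EFinM -mulrBl mulrCA divff ?mulr1//; exact: lt0r_neq0.
transitivity (\int[mu]_x h x)%E.
  by apply: eq_measure_integral => A mA _; exact: E.
rewrite /mu /nu ge0_integral_mscale//=; congr (_ * _)%E.
by rewrite ge0_integral_pushforward.
Qed.

Lemma measurable_dilation n (beta : 'I_n -> R) (u : R) :
  measurable_fun setT (dilation beta u : borelType 'rV[R]_n -> borelType 'rV[R]_n).
Proof.
apply: measurable_rV => // i.
under eq_fun do rewrite mxE.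
by apply: measurable_funM => //; exact: measurable_coord.
Qed.

(** The induction hypothesis rescales the last [n] variables inside the integral, one-dimensional
    scaling handles the first, and the exponents add up. *)
Lemma ge0_integral_dilation n (beta : 'I_n -> R) (u : R)
    (h : borelType 'rV[R]_n -> \bar R) :
  0 < u -> measurable_fun setT h -> (forall w, 0 <= h w)%E ->
  (\int[lebesgue_rV n]_w h w =
   (u `^ (\sum_i beta i))%:E * \int[lebesgue_rV n]_w h (dilation beta u w))%E.
Proof.
move=> u0; elim: n => [|n ih] in beta h * => mh h0.
  rewrite !ge0_integral_rV0//; last first.
    exact: (measurableT_comp mh (@measurable_dilation _ beta u)).
  rewrite big_ord0 powRr0 mul1e; congr h.
  by apply/rowP => -[].
have mhd : measurable_fun setT (fun w : borelType 'rV[R]_n.+1 => h (dilation beta u w)).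
  exact: (measurableT_comp mh (@measurable_dilation _ beta u)).
rewrite !ge0_integral_rVS//.
pose beta' i := beta (lift ord0 i).
have mhc : measurable_fun setT (h \o @cons_rV R n).
  exact: (measurableT_comp mh (@measurable_cons_rV R n)).
have ihx x : (\int[lebesgue_rV n]_v h (cons_rV (x, v)) =
    (u `^ (\sum_i beta' i))%:E *
    \int[lebesgue_rV n]_v h (cons_rV (x, dilation beta' u v)))%E.
  rewrite (ih beta' (fun v => h (cons_rV (x, v))))//.
  apply: (measurableT_comp mhc (pair1_measurable x)).
have mhcd : measurable_fun setT (fun xv : measurableTypeR R * borelType 'rV[R]_n => h (cons_rV (xv.1, dilation beta' u xv.2))).
  apply: (measurableT_comp mhc); apply: measurable_fun_pair => //.
  by apply: (measurableT_comp (@measurable_dilation _ beta' u)).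
pose H (x : R) := (\int[lebesgue_rV n]_v h (cons_rV (x, dilation beta' u v)))%E.
have mH : measurable_fun setT H.
  by apply: (@measurable_fun_fubini_tonelli_F _ _ _ _ _ (lebesgue_rV n)
    (fun xv => h (cons_rV (xv.1, dilation beta' u xv.2)))).
have H0 x : (0 <= H x)%E by exact: integral_ge0.
under eq_integral do rewrite ihx.
rewrite ge0_integralZl//; last 2 first.
- by move=> x _; exact: H0.
- by rewrite lee_fin powR_ge0.
rewrite (ge0_integral_scale (powR_gt0 (beta ord0) u0) mH H0).
rewrite muleA -EFinM -powRD ?(gt_eqF u0) ?implybT//.
rewrite [in RHS]big_ord_recl addrC; congr (_ * _)%E.
apply: eq_integral => x _; apply: eq_integral => v _; congr h.
apply/rowP => i; rewrite [RHS]mxE.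
case: (unliftP ord0 i) => [j|] ->; first by rewrite !cons_rVS mxE.
by rewrite !cons_rV0.
Qed.

Lemma dilationKV n (beta : 'I_n -> R) u : 0 < u ->
  cancel (dilation beta u) (dilation beta u^-1).
Proof.
move=> u0 w; apply/rowP => i; rewrite !mxE mulrA -powRM ?invr_ge0 ?(ltW u0)//.
by rewrite mulVf ?gt_eqF// powR1 mul1r.
Qed.

Lemma dilationVK n (beta : 'I_n -> R) u : 0 < u ->
  cancel (dilation beta u^-1) (dilation beta u).
Proof.
move=> u0 w; apply/rowP => i; rewrite !mxE mulrA -powRM ?invr_ge0 ?(ltW u0)//.
by rewrite divff ?gt_eqF// powR1 mul1r.
Qed.

Lemma ge0_integral_dilation_image n (beta : 'I_n -> R) (u : R)
    (A : set (borelType 'rV[R]_n)) (h : borelType 'rV[R]_n -> \bar R) :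
  0 < u -> measurable A -> measurable_fun A h -> (forall w, A w -> 0 <= h w)%E ->
  (\int[lebesgue_rV n]_(w in A) h w = (u `^ (\sum_i beta i))%:E *
   \int[lebesgue_rV n]_(w in dilation beta u^-1 @` A) h (dilation beta u w))%E.
Proof.
move=> u0 mA mh h0.
rewrite integral_mkcond (ge0_integral_dilation beta u0); last 2 first.
- exact/(measurable_restrictT _ _).1.
- by move=> w; rewrite erestrict_ge0.
congr (_ * _)%E; rewrite [RHS]integral_mkcond; apply: eq_integral => w _.
rewrite !patchE; congr (if _ then _ else _).
apply/idP/idP; rewrite !inE; last by move=> [v Av <-]; rewrite dilationVK.
by move=> Aw; exists (dilation beta u w) => //; rewrite dilationKV.
Qed.

Lemma integral_oneDsqrV_lty : (\int[leb]_x ((1 + x ^+ 2)^-1)%:E < +oo)%E.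
Proof.
rewrite (@ge0_symfun_integralT _ (fun x => (1 + x ^+ 2)^-1)).
- rewrite (_ : [set x | _] = `[0, +oo[%classic); last first.
    by apply/seteqP; split => x /=; rewrite in_itv/= andbT.
  by rewrite integral0y_oneDsqr -EFinM ltry.
- by move=> x; rewrite invr_ge0 addr_ge0 ?sqr_ge0.
- exact: continuous_oneDsqrV.
- by move=> x /=; rewrite sqrrN.
Qed.

(** A product of one-variable densities, integrable by Tonelli one coordinate at a time; it replaces
    polar coordinates adapted to [rho]. *)
Definition cauchy_weight n (w : 'rV[R]_n) : R := \prod_i (1 + w ord0 i ^+ 2)^-1.

Lemma cauchy_weight_ge0 n (w : 'rV[R]_n) : 0 <= cauchy_weight w.
Proof. by apply: prodr_ge0 => i _; rewrite invr_ge0 addr_ge0 ?sqr_ge0. Qed.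

Lemma measurable_cauchy_weight n :
  measurable_fun setT (@cauchy_weight n : borelType 'rV[R]_n -> measurableTypeR R).
Proof.
apply: measurable_prod => i _.
apply: (@measurableT_comp _ _ _ _ _ _ (fun x : measurableTypeR R => (1 + x ^+ 2)^-1 : measurableTypeR R)).
  by apply: continuous_measurable_fun; exact: continuous_oneDsqrV.
exact: measurable_coord.
Qed.

Lemma integral_cauchy_weight_lty n :
  (\int[lebesgue_rV n]_w (cauchy_weight w)%:E < +oo)%E.
Proof.
elim: n => [|n ih].
  rewrite ge0_integral_rV0 ?ltry//.
  by apply/measurable_EFinP; exact: measurable_cauchy_weight.
rewrite ge0_integral_rVS; last 2 first.
- by apply/measurable_EFinP; exact: measurable_cauchy_weight.
- by move=> w; rewrite lee_fin cauchy_weight_ge0.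
have cE x v : cauchy_weight (cons_rV (x, v)) = (1 + x ^+ 2)^-1 * cauchy_weight v.
  rewrite /cauchy_weight big_ord_recl cons_rV0; congr (_ * _).
  by apply: eq_bigr => i _; rewrite cons_rVS.
under eq_integral => x _.
  under eq_integral do rewrite cE EFinM.
  rewrite ge0_integralZl//; last 3 first.
  - by apply/measurable_EFinP; exact: measurable_cauchy_weight.
  - by move=> w _; rewrite lee_fin cauchy_weight_ge0.
  - by rewrite lee_fin invr_ge0 addr_ge0 ?sqr_ge0.
  over.
rewrite /=.
have fin : (\int[lebesgue_rV n]_w (cauchy_weight w)%:E)%E \is a fin_num.
  by rewrite ge0_fin_numE// integral_ge0// => w _; rewrite lee_fin cauchy_weight_ge0.
rewrite -(fineK fin) ge0_integralZr//.
- rewrite muleC lte_mul_pinfty ?integral_oneDsqrV_lty// lee_fin fine_ge0//.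
  by apply: integral_ge0 => w _; rewrite lee_fin cauchy_weight_ge0.
- by apply/measurable_EFinP; apply: continuous_measurable_fun; exact: continuous_oneDsqrV.
- by move=> x _; rewrite lee_fin invr_ge0 addr_ge0 ?sqr_ge0.
- by rewrite lee_fin fine_ge0// integral_ge0// => w _; rewrite lee_fin cauchy_weight_ge0.
Qed.

End lebesgue_rV_integration.

(** * The homogeneous norm *)

Section homogeneous_norm.
Context {R : realType} {d : nat}.
Variable beta : 'I_d -> R.
Hypothesis beta0 : forall i, 0 < beta i.

(** The squared norm along the dilation orbit is continuous in [y = - ln r]; the intermediate value
    theorem applies between a value at most 1 and one at least 1. *)
Lemma rho_exists (t : 'rV[R]_d) : t != 0 ->
  exists r, 0 < r /\ enorm (dilation beta r^-1 t) = 1.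
Proof.
move=> t0.
pose f (y : R) := \sum_i (expR (y * beta i) * t ord0 i) ^+ 2.
have f_ge0 y : 0 <= f y by apply: sumr_ge0 => i _; rewrite sqr_ge0.
suff [y fy] : exists y, f y = 1.
  exists (expR (- y)); rewrite expR_gt0 -expRN opprK; split=> //.
  rewrite /enorm [X in Num.sqrt X](_ : _ = f y); first by rewrite fy sqrtr1.
  by rewrite /f; apply: eq_bigr => i _; rewrite mxE expRM.
have cf : continuous f.
  move=> y; apply: cvg_big; first exact: add_continuous.
  move=> i _; apply: (cvg_comp (fun y => expR (y * beta i) * t ord0 i)
    (fun x => x ^+ 2) _ (@exprn_continuous R 2 _)).
  apply: cvgM; last exact: cvg_cst.
  apply: continuous_comp; last exact: continuous_expR.
  by apply: cvgM; [exact: cvg_id|exact: cvg_cst].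
(* From [exp (- x) <= 1 / x], the terms of [f (- (s + 1))] add up to at most [s / (s + 1)]. *)
pose s := \sum_i (t ord0 i ^+ 2 / (2 * beta i)).
have s0 : 0 <= s.
  by apply: sumr_ge0 => i _; rewrite divr_ge0 ?sqr_ge0// mulr_ge0// ltW.
have lo : f (- (s + 1)) <= 1.
  apply: (@le_trans _ _ (s / (s + 1))).
    rewrite big_distrl/=; apply: ler_sum => i _.
    rewrite exprMn -expRM_natl mulNr mulrN expRN mulrC -mulrA ler_wpM2l ?sqr_ge0//.
    rewrite -invfM lef_pV2 ?posrE ?expR_gt0 ?mulr_gt0 ?ltr_wpDl//.
    apply: le_trans (expR_ge1Dx _); rewrite -[leLHS]add0r lerD//.
    by rewrite -mulrA ler_wpM2l// mulrC.
  by rewrite ler_pdivrMr ?ltr_wpDl// mul1r lerDl.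
have [i ti0] : exists i, t ord0 i != 0.
  apply/existsP; apply: contraNT t0; rewrite negb_exists => /forallP H.
  by apply/eqP/rowP => i; rewrite mxE; have := H i; rewrite negbK => /eqP.
(* Chosen so that [2 * Y * beta i = 1 / t_i^2]; the [i]-th term is then
   [t_i^2 * exp (1 / t_i^2) >= 1]. *)
pose Y := (t ord0 i ^+ 2)^-1 / (2 * beta i).
have Y0 : 0 <= Y by rewrite divr_ge0 ?invr_ge0 ?sqr_ge0// mulr_ge0// ltW.
have hi : 1 <= f Y.
  rewrite /f (bigD1 i)//= ler_wpDr//; first by apply: sumr_ge0 => j _; rewrite sqr_ge0.
  rewrite exprMn -expRM_natl.
  have t2 : 0 < t ord0 i ^+ 2 by rewrite exprn_even_gt0.
  rewrite -ler_pdivrMr// mul1r.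
  have -> : 2%:R * (Y * beta i) = (t ord0 i ^+ 2)^-1.
    by rewrite /Y; field; rewrite ti0 gt_eqF.
  by apply: le_trans (expR_ge1Dx _); rewrite lerDr.
have [y _ fy] : exists2 c, c \in `[- (s + 1), Y] & f c = 1.
  apply: IVT; first by rewrite (le_trans _ Y0)// oppr_le0 addr_ge0.
    exact: continuous_subspaceT.
  by rewrite ge_min lo/= le_max hi orbT.
by exists y.
Qed.

Lemma rhoP (t : 'rV[R]_d) : t != 0 ->
  0 < rho beta t /\ enorm (dilation beta (rho beta t)^-1 t) = 1.
Proof.
move=> t0; rewrite /rho (negbTE t0).
by case: xgetP => [r _ []//|H]; have [r /H] := rho_exists t0.
Qed.

Lemma rho_ge0 (t : 'rV[R]_d) : 0 <= rho beta t.
Proof.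
have [->|/rhoP[/ltW//]] := eqVneq t 0; by rewrite /rho eqxx.
Qed.

(** The rescaled vector is a Euclidean unit vector, so its coordinate [rho^(- beta i) * t_i] is at
    most 1 in modulus. *)
Lemma coord_le_rho (t : 'rV[R]_d) i : `|t ord0 i| <= rho beta t `^ beta i.
Proof.
have [->|t0] := eqVneq t 0; first by rewrite mxE normr0 powR_ge0.
have [r0 /eqP] := rhoP t0.
rewrite /enorm -sqrtr1 eqr_sqrt ?sumr_ge0// => [/eqP H|j _]; last exact: sqr_ge0.
have : (dilation beta (rho beta t)^-1 t) ord0 i ^+ 2 <= 1.
  rewrite -H (bigD1 i)//= lerDl; apply: sumr_ge0 => j _; exact: sqr_ge0.
rewrite mxE -[1](expr1n _ 2) -ler_sqrt ?sqr_ge0 ?expr1n//.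
rewrite sqrtr_sqr sqrtr1 normrM ger0_norm ?powR_ge0//.
by rewrite -powR_inv1 ?(ltW r0)// -powRrM mulN1r powRN ler_pdivrMl ?powR_gt0// mulr1.
Qed.

(** Each factor satisfies [1 + t_i^2 <= 2 * (1 + rho)^(2m)] for a natural [m >= beta i], so dividing
    by the Cauchy weight costs [2^d] and a power of [1 + rho], which the exponential absorbs. *)
Lemma rho_weight_le (M : nat) (k : R) : 0 < k -> exists2 K, 0 <= K &
  forall t : 'rV[R]_d, (1 + rho beta t) ^+ M * expR (- (k * rho beta t)) <=
    K * cauchy_weight t.
Proof.
move=> k0.
pose m := (Num.truncn (\sum_i beta i)).+1.
have bm i : beta i <= m%:R.
  apply: (@le_trans _ _ (\sum_i beta i)); last by rewrite ltW// truncnS_gt.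
  by rewrite (bigD1 i)//= lerDl sumr_ge0// => j _; exact: ltW.
have [K K0 HK] := exprD1_le_expR (M + (m + m) * d) k0.
exists (2 ^+ d * K); first by rewrite mulr_ge0 ?exprn_ge0// ltW.
move=> t; have r0 := rho_ge0 t; have w1 : 1 <= 1 + rho beta t by rewrite lerDl.
have c0 i : 0 < 1 + t ord0 i ^+ 2 by rewrite ltr_pwDl ?sqr_ge0.
rewrite /cauchy_weight prodfV ler_pdivlMr; last by apply: prodr_gt0.
have P : \prod_i (1 + t ord0 i ^+ 2) <= 2 ^+ d * (1 + rho beta t) ^+ ((m + m) * d).
  rewrite exprM -exprMn -[X in _ ^+ X]card_ord -prodr_const.
  apply: ler_prod => i _; rewrite (ltW (c0 i))/=.
  rewrite mulr2n mulrDl mul1r lerD//; first by rewrite exprn_ege1.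
  rewrite exprD -expr2 -real_normK ?num_real// lerXn2r ?nnegrE ?exprn_ge0//.
    exact: le_trans w1.
  apply: (le_trans (coord_le_rho t i)).
  apply: (@le_trans _ _ ((1 + rho beta t) `^ beta i)).
    by rewrite ge0_ler_powR ?nnegrE ?(ltW (beta0 i)) ?lerDr// (le_trans _ w1).
  by rewrite -powR_mulrn ?(le_trans _ w1)// ler_powR.
apply: (le_trans (ler_wpM2l _ P)).
  by rewrite mulr_ge0 ?expR_ge0// exprn_ge0// (le_trans _ w1).
rewrite mulrCA ler_wpM2l ?exprn_ge0// mulrAC -exprD expRN.
by rewrite ler_pdivrMr ?expR_gt0// HK.
Qed.

End homogeneous_norm.

(** * Complex-valued integrals *)

Section complex_integration.
Context {R : realType} {disp : measure_display} {T : measurableType disp}.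
Implicit Types (D : set T) (h : T -> R[i]) (r : T -> R).

Lemma Re_mul_real (x : R[i]) (r : R) : complex.Re (x * r%:C%C) = complex.Re x * r.
Proof. by case: x => a b /=; rewrite mulr0 subr0. Qed.

Lemma Im_mul_real (x : R[i]) (r : R) : complex.Im (x * r%:C%C) = complex.Im x * r.
Proof. by case: x => a b /=; rewrite mulr0 add0r. Qed.

Lemma Re_add (x y : R[i]) : complex.Re (x + y) = complex.Re x + complex.Re y.
Proof. by case: x; case: y. Qed.

Lemma Im_add (x y : R[i]) : complex.Im (x + y) = complex.Im x + complex.Im y.
Proof. by case: x; case: y. Qed.

Lemma cmeasurable_cst D (c : R[i]) : cmeasurable D (fun=> c).
Proof. by split; exact: measurable_cst. Qed.

Lemma cmeasurableD D h1 h2 : cmeasurable D h1 -> cmeasurable D h2 ->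
  cmeasurable D (fun x => h1 x + h2 x).
Proof.
move=> [r1 i1] [r2 i2]; split.
  by under eq_fun do rewrite Re_add; exact: measurable_funD.
by under eq_fun do rewrite Im_add; exact: measurable_funD.
Qed.

Lemma cmeasurableMr D h r : cmeasurable D h -> measurable_fun D r ->
  cmeasurable D (fun x => h x * (r x)%:C%C).
Proof.
move=> [rh ih] mr; split.
  by under eq_fun do rewrite Re_mul_real; exact: measurable_funM.
by under eq_fun do rewrite Im_mul_real; exact: measurable_funM.
Qed.

Lemma cmeasurable_sum D (I : eqType) (s : seq I) (h : I -> T -> R[i]) :
  (forall i, i \in s -> cmeasurable D (h i)) ->
  cmeasurable D (fun x => \sum_(i <- s) h i x).
Proof.
elim: s => [_|i s ih H].
  by under eq_fun do rewrite big_nil; exact: cmeasurable_cst.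
under eq_fun do rewrite big_cons.
apply: cmeasurableD; first by apply: H; exact: mem_head.
by apply: ih => j js; apply: H; rewrite in_cons js orbT.
Qed.

Lemma eq_cmeasurable D h1 h2 : {in D, h1 =1 h2} ->
  cmeasurable D h1 -> cmeasurable D h2.
Proof.
move=> h12 [mr mi]; split.
  by apply: eq_measurable_fun mr => x xD; rewrite h12.
by apply: eq_measurable_fun mi => x xD; rewrite h12.
Qed.

Lemma measurable_cabs D h : cmeasurable D h -> measurable_fun D (fun x => cabs (h x)).
Proof.
move=> [rh ih].
rewrite (_ : (fun x => cabs (h x)) = fun x =>
    Num.sqrt (complex.Re (h x) ^+ 2 + complex.Im (h x) ^+ 2)); last first.
  by apply/funext => x /=; case: (h x).
apply: (measurableT_comp (f := @Num.sqrt R)).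
  by apply: continuous_measurable_fun; exact: sqrt_continuous.
by apply: measurable_funD; exact: measurable_funX.
Qed.

Variable mu : {measure set T -> \bar R}.

Lemma cintegrable_lty D h : measurable D -> cmeasurable D h ->
  (\int[mu]_(x in D) (cabs (h x))%:E < +oo)%E -> cintegrable mu D h.
Proof.
move=> mD mh fh.
have ich : mu.-integrable D (fun x => (cabs (h x))%:E).
  apply/integrableP; split; first exact/measurable_EFinP/measurable_cabs.
  by under eq_integral do rewrite abse_EFin ger0_norm ?cabs_ge0//.
have [mr mi] := mh; split; apply: (le_integrable mD _ _ ich).
- exact/measurable_EFinP.
- move=> x _; rewrite !abse_EFin lee_fin (ger0_norm (cabs_ge0 _)).
  by have [] := ler_cabs_ReIm (h x).
- exact/measurable_EFinP.
- move=> x _; rewrite !abse_EFin lee_fin (ger0_norm (cabs_ge0 _)).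
  by have [] := ler_cabs_ReIm (h x).
Qed.

Lemma eq_cintegral D h1 h2 : {in D, h1 =1 h2} ->
  cintegral mu D h1 = cintegral mu D h2.
Proof.
by move=> h12; congr Complex; apply: eq_Rintegral => x xD; rewrite h12.
Qed.

Lemma cintegrable0 D : cintegrable mu D (fun=> 0).
Proof. by split; exact: integrable0. Qed.

Lemma cintegrableD D h1 h2 : measurable D ->
  cintegrable mu D h1 -> cintegrable mu D h2 ->
  cintegrable mu D (fun x => h1 x + h2 x).
Proof.
move=> mD [r1 i1] [r2 i2]; split.
  by under eq_fun do rewrite Re_add EFinD; exact: integrableD.
by under eq_fun do rewrite Im_add EFinD; exact: integrableD.
Qed.

Lemma cintegralD D h1 h2 : measurable D ->
  cintegrable mu D h1 -> cintegrable mu D h2 ->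
  cintegral mu D (fun x => h1 x + h2 x) = cintegral mu D h1 + cintegral mu D h2.
Proof.
move=> mD [r1 i1] [r2 i2]; rewrite /cintegral -[RHS]/(Complex _ _); congr Complex.
  under eq_Rintegral do rewrite Re_add.
  exact: RintegralD.
under eq_Rintegral do rewrite Im_add.
exact: RintegralD.
Qed.

Lemma cintegrableZ D (c : R) h : measurable D -> cintegrable mu D h ->
  cintegrable mu D (fun x => c%:C%C * h x).
Proof.
move=> mD [r1 i1]; split.
  under eq_fun do rewrite mulrC Re_mul_real mulrC EFinM; exact: integrableZl.
under eq_fun do rewrite mulrC Im_mul_real mulrC EFinM; exact: integrableZl.
Qed.

Lemma cintegralZ D (c : R) h : measurable D -> cintegrable mu D h ->
  cintegral mu D (fun x => c%:C%C * h x) = c%:C%C * cintegral mu D h.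
Proof.
move=> mD [r1 i1]; rewrite [RHS]mulrC; apply/eqP; rewrite eq_complex.
rewrite Re_mul_real Im_mul_real /=; apply/andP; split; apply/eqP.
  under eq_Rintegral do rewrite mulrC Re_mul_real mulrC.
  by rewrite RintegralZl// mulrC.
under eq_Rintegral do rewrite mulrC Im_mul_real mulrC.
by rewrite RintegralZl// mulrC.
Qed.

Lemma cintegrable_sum D (I : eqType) (s : seq I) (h : I -> T -> R[i]) :
  measurable D -> (forall i, i \in s -> cintegrable mu D (h i)) ->
  cintegrable mu D (fun x => \sum_(i <- s) h i x).
Proof.
move=> mD; elim: s => [_|i s ih H].
  by under eq_fun do rewrite big_nil; exact: cintegrable0.
under eq_fun do rewrite big_cons.
apply: cintegrableD => //; first by apply: H; exact: mem_head.
by apply: ih => j js; apply: H; rewrite in_cons js orbT.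
Qed.

Lemma cintegral_sum D (I : eqType) (s : seq I) (h : I -> T -> R[i]) :
  measurable D -> (forall i, i \in s -> cintegrable mu D (h i)) ->
  cintegral mu D (fun x => \sum_(i <- s) h i x) =
  \sum_(i <- s) cintegral mu D (h i).
Proof.
move=> mD; elim: s => [_|i s ih H].
  rewrite big_nil; under eq_cintegral do rewrite big_nil.
  by rewrite /cintegral /Rintegral integral0.
under eq_cintegral do rewrite big_cons.
have Hs j : j \in s -> cintegrable mu D (h j).
  by move=> js; apply: H; rewrite in_cons js orbT.
rewrite big_cons cintegralD ?ih//; first by apply: H; exact: mem_head.
exact: cintegrable_sum.
Qed.

Lemma cintegralB D h1 h2 : measurable D ->
  cintegrable mu D h1 -> cintegrable mu D h2 ->
  cintegral mu D (fun x => h1 x - h2 x) = cintegral mu D h1 - cintegral mu D h2.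
Proof.
move=> mD i1 i2; have := cintegralD mD i1 (cintegrableZ (-1) mD i2).
rewrite cintegralZ// rmorphN1 mulN1r => <-.
by apply: eq_cintegral => x _; rewrite mulN1r.
Qed.

(** The factor 2 comes from bounding the real and imaginary parts separately by the integral of the
    modulus; it is harmless in [o] estimates. *)
Lemma cabs_cintegral_le D h (K : R) : measurable D -> cmeasurable D h ->
  (\int[mu]_(x in D) (cabs (h x))%:E <= K%:E)%E ->
  cabs (cintegral mu D h) <= 2 * K.
Proof.
move=> mD mh hK.
have [ir ii] : cintegrable mu D h.
  by apply: cintegrable_lty => //; exact: le_lt_trans hK (ltry _).
have [mr mi] := mh.
have bound (g : T -> R) : measurable_fun D g -> mu.-integrable D (EFin \o g) ->
    (forall x, `|g x| <= cabs (h x)) -> `|\int[mu]_(x in D) g x| <= K.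
  move=> mg ig gh; apply: (le_trans (le_normr_Rintegral mD ig)).
  rewrite -lee_fin /Rintegral fineK; last first.
    rewrite ge0_fin_numE ?integral_ge0//.
    by have /integrableP[_] := ig.
  apply: le_trans hK; apply: ge0_le_integral => //.
  - by apply/measurable_EFinP; exact: measurableT_comp.
  - exact/measurable_EFinP/measurable_cabs.
  - by move=> x _; rewrite lee_fin.
rewrite mulr_natl mulr2n; apply: (le_trans (cabs_le_ReIm _)); apply: lerD.
  by apply: bound => // x; have [] := ler_cabs_ReIm (h x).
by apply: bound => // x; have [] := ler_cabs_ReIm (h x).
Qed.

End complex_integration.

(** * Measurability on products *)

Section borel_products.
Context {R : realType}.

Lemma measurable_continuous_real (T : ptopologicalType) (f : T -> R) :
  continuous f -> measurable_fun setT (f : borelType T -> measurableTypeR R).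
Proof.
move=> cf; apply: (measurability _ (RGenOpens.measurableE R)).
move=> _ [_ [a [b ->] <-]]; rewrite setTI; apply: sub_sigma_algebra.
apply: open_comp; last exact: interval_open.
by move=> w _; exact: cf.
Qed.

(* Only the second factor needs a countable basis, since each [V vk] is open. *)
Lemma measurable_open_prod (T : ptopologicalType) d (U : set (T * 'rV[R]_d)) :
  open U -> measurable (U : set (borelType T * borelType 'rV[R]_d)).
Proof.
move=> oU.
pose bll (vk : 'rV[rat]_d * nat) : set 'rV[R]_d :=
  ball (map_mx ratr vk.1 : 'rV[R]_d) vk.2.+1%:R^-1.
pose V vk : set T := \bigcup_(B in [set B | open B /\ B `*` bll vk `<=` U]) B.
rewrite (_ : U = \bigcup_vk (V vk `*` bll vk)); last first.
  apply/seteqP; split => -[x s]; last first.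
    by move=> [vk _ [/= [B [_ BU] Bx] ?]]; exact: BU.
  move=> Uxs; have /= : nbhs (x, s) U by exact: open_nbhs_nbhs.
  move=> [[P Q] /= [nP nQ] PQU].
  have : Q° s by exact: nQ.
  rewrite (open_rV_bigcup (open_interior Q)) => -[vk /= vkQ svk].
  exists vk => //; split => //=; exists P° => //; split; first exact: open_interior.
  move=> [y w] /= [Py wv]; apply: PQU; split => /=; first exact: interior_subset.
  by apply: interior_subset; exact: vkQ.
apply: countable_bigcupT_measurable => // vk; apply: measurableX.
  by apply: sub_sigma_algebra; apply: bigcup_open => B [].
by apply: sub_sigma_algebra; exact: ball_open.
Qed.

(** An open set pulls back to the trace on [A] of an open set [V] of the product; on [D], which lies
    in [A], the preimage is cut out by [V] itself. *)
Lemma measurable_fun_within (T U : ptopologicalType) d (A : set (T * 'rV[R]_d))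
    (D : set (borelType T * borelType 'rV[R]_d)) (F : T * 'rV[R]_d -> U) :
  {within A, continuous F} -> measurable D -> D `<=` A ->
  measurable_fun D (F : borelType T * borelType 'rV[R]_d -> borelType U).
Proof.
move=> /continuousP cF mD DA.
refine (@measurability _ _ (borelType T * borelType 'rV[R]_d)%type (borelType U)
  D F (@open U) erefl _).
move=> _ [W oW <-]; have /open_subspaceP[V oV VA] := cF W oW.
have -> : D `&` F @^-1` W = D `&` V.
  apply/seteqP; split => x [Dx Wx]; split => //.
    by have [] : (V `&` A) x by rewrite VA; split => //; exact: DA.
  by have [] : (F @^-1` W `&` A) x by rewrite -VA; split => //; exact: DA.
by apply: measurableI => //; exact: measurable_open_prod.
Qed.

Lemma measurable_eball d (e : R) : measurable (eball e : set (borelType 'rV[R]_d)).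
Proof.
have m : measurable_fun setT (fun v : borelType 'rV[R]_d => enorm v : measurableTypeR R).
  apply: (measurableT_comp (f := @Num.sqrt R)).
    by apply: continuous_measurable_fun; exact: sqrt_continuous.
  apply: measurable_sum => i; apply: measurable_funX; exact: measurable_coord.
rewrite (_ : eball e = setT `&` (fun v => enorm v) @^-1` `]-oo, e[%classic).
  by apply: m.
by apply/seteqP; split => v; rewrite /= in_itv/=; [|case].
Qed.

End borel_products.

Section sections.
Context d1 d2 (T1 : measurableType d1) (T2 : measurableType d2) (R : realType).
Variable D : set (T1 * T2).
Hypothesis mD : measurable D.

Lemma measurable_section x : measurable [set y | D (x, y)].
Proof. by rewrite -[X in measurable X]setTI; exact: (@pair1_measurable _ _ T1 T2 x). Qed.

Lemma measurable_fun_section d3 (T3 : measurableType d3) (h : T1 * T2 -> T3) x :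
  measurable_fun D h -> measurable_fun [set y | D (x, y)] (fun y => h (x, y)).
Proof.
move=> mh; apply: (measurable_comp mD _ mh); first by move=> _ [y Dy <-].
by apply: measurable_funTS; exact: pair1_measurable.
Qed.

(** Tonelli's theorem concerns nonnegative functions on the full space, hence the extension by 0 and
    the split into positive and negative parts. At infinite values [fine] returns 0, which preserves
    measurability. *)
Lemma measurable_Rintegral_section (mu : {sigma_finite_measure set T2 -> \bar R})
    (h : T1 * T2 -> R) : measurable_fun D h ->
  measurable_fun setT (fun x => \int[mu]_(y in [set y | D (x, y)]) h (x, y)).
Proof.
move=> mh; pose g := (EFin \o h) \_ D.
have mg : measurable_fun setT g.
  by apply/(measurable_restrictT _ _).1 => //; exact/measurable_EFinP.
rewrite (_ : (fun x => _) = fun x => fine (\int[mu]_y (g ^\+ (x, y)) -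
    \int[mu]_y (g ^\- (x, y)))%E); last first.
  apply/funext => x; congr fine; rewrite integral_mkcond integralE.
  have E y : (y \in [set y | D (x, y)]) = ((x, y) \in D).
    by apply/idP/idP; rewrite !inE.
  congr (_ - _)%E; apply: eq_integral => y _.
    by rewrite !funeposE /g !patchE E.
  by rewrite !funenegE /g !patchE E.
apply: (measurableT_comp (fine_measurable measurableT)); apply: emeasurable_funB.
  exact: (@measurable_fun_fubini_tonelli_F d1 d2 T1 T2 R mu (g ^\+)%E
    (measurable_funepos mg) (fun x => funepos_ge0 g x)).
exact: (@measurable_fun_fubini_tonelli_F d1 d2 T1 T2 R mu (g ^\-)%E
  (measurable_funeneg mg) (fun x => funeneg_ge0 g x)).
Qed.

End sections.

(** * Change of variables on a normal piece *)

Section cell_integrals.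
Context {R : realType} {n : nat} {N : riemannianManifold R n}.
Variables (pc : piece N) (e : R).
Let d := pc_codim pc.
Let leb := @lebesgue_rV R d.
Let P : set (borelType N) := pc_base pc.

Section fiber.
Variable C : N -> set 'rV[R]_d.
Hypothesis mC : measurable (fiber_graph C).

Lemma fiberE p : P p -> C p = [set t | fiber_graph C (p, t)].
Proof. by move=> Pp; apply/seteqP; split => t //= [_]. Qed.

Lemma measurable_fiber p : P p -> measurable (C p : set (pc_space pc)).
Proof. by move=> Pp; rewrite fiberE//; exact: measurable_section. Qed.

Lemma measurable_fun_fiber d3 (T3 : measurableType d3)
    (h : borelType N * pc_space pc -> T3) p : P p ->
  measurable_fun (fiber_graph C) h ->
  measurable_fun (C p : set (pc_space pc)) (fun t => h (p, t)).
Proof. by move=> Pp mh; rewrite fiberE//; exact: measurable_fun_section. Qed.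

Lemma cmeasurable_fiber (h : N -> 'rV[R]_d -> R[i]) p : P p ->
  cmeasurable (fiber_graph C) (fun pt => h pt.1 pt.2) ->
  cmeasurable (C p : set (pc_space pc)) (h p).
Proof.
move=> Pp [mr mi].
by split; [exact: (measurable_fun_fiber Pp mr)|exact: (measurable_fun_fiber Pp mi)].
Qed.

Lemma cmeasurable_cintegral_fiber (h : N -> 'rV[R]_d -> R[i]) :
  measurable P -> cmeasurable (fiber_graph C) (fun pt => h pt.1 pt.2) ->
  cmeasurable P (fun p => cintegral leb (C p) (h p)).
Proof.
move=> mP [mr mi]; split.
  apply: (eq_measurable_fun (fun p => \int[leb]_(t in [set t | fiber_graph C (p, t)])
      complex.Re (h p t))).
    by move=> p /set_mem Pp /=; rewrite -fiberE.
  apply: measurable_funTS.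
  exact: (measurable_Rintegral_section mC leb mr).
apply: (eq_measurable_fun (fun p => \int[leb]_(t in [set t | fiber_graph C (p, t)])
    complex.Im (h p t))).
  by move=> p /set_mem Pp /=; rewrite -fiberE.
apply: measurable_funTS.
exact: (measurable_Rintegral_section mC leb mi).
Qed.

End fiber.

Hypothesis mA : measurable (fiber_graph (@pc_A R n N pc)).

Lemma measurable_pc_dom : measurable (@pc_dom R n N pc e).
Proof.
rewrite (_ : @pc_dom R n N pc e =
    fiber_graph (@pc_A R n N pc) `&` (setT `*` eball e)).
  by apply: measurableI => //; apply: measurableX => //; exact: measurable_eball.
by apply/seteqP; split => -[p s] /=; [move=> [? []]|move=> [[? ?] []]].
Qed.

Variables (f : N -> R) (a : N -> R[i]).
Hypothesis cf : continuous f.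
Hypothesis ma : cmeasurable [set: borelType N] a.
Hypothesis cF : {within pc_nbhd pc `*` eball e,
  continuous (fun ps : N * 'rV[R]_d => pc_map ps.1 ps.2)}.
Hypothesis PU : pc_base pc `<=` pc_nbhd pc.
Hypothesis mJ : measurable_fun (@pc_dom R n N pc e) (fun ps => @pc_J _ _ _ pc ps.1 ps.2 : R).

Lemma measurable_pc_map : measurable_fun (@pc_dom R n N pc e)
  (fun ps => pc_map ps.1 ps.2 : borelType N).
Proof.
apply: (@measurable_fun_within R N N d _ (@pc_dom R n N pc e)
  (fun ps => pc_map ps.1 ps.2) cF measurable_pc_dom).
by move=> [p s] /= [Pp [_ es]]; split => //; exact: PU.
Qed.

Lemma cmeasurable_laplace_integrand z : cmeasurable (@pc_dom R n N pc e)
  (fun ps => laplace_integrand f a z ps.1 ps.2).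
Proof.
apply: cmeasurableMr.
  apply: cmeasurableMr; last exact: mJ.
  have [mr mi] := ma.
  split; [exact: (measurableT_comp mr measurable_pc_map)|].
  exact: (measurableT_comp mi measurable_pc_map).
apply: (measurableT_comp (f := @expR R)); first exact: measurable_expR.
apply: measurable_funM => //.
exact: (measurableT_comp (measurable_continuous_real cf) measurable_pc_map).
Qed.

Variables (beta : 'I_d -> R) (S : scaledCellRep (pc := pc) e beta).
Let C := sc_cell S.
Let Q := \sum_i beta i.

Lemma scaled_cellE q p : 0 < q ->
  scaled_cell e beta q p = dilation beta q @^-1` pc_cell e p.
Proof.
move=> q0; apply/seteqP; split => u /=.
  by move=> [s As <-]; rewrite dilationVK.
by move=> As; exists (dilation beta q u) => //; rewrite dilationKV.
Qed.

Lemma measurable_cell p : P p -> measurable (pc_cell e p : set (pc_space pc)).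
Proof. by move=> Pp; apply: measurable_fiber => //; exact: measurable_pc_dom. Qed.

Lemma measurable_scaled_cell q p : P p -> 0 < q ->
  measurable (scaled_cell e beta q p : set (pc_space pc)).
Proof.
move=> Pp q0; rewrite scaled_cellE// -[X in measurable X]setTI.
by apply: measurable_dilation => //; exact: measurable_cell.
Qed.

Lemma sc_map_in_cell q p t : 0 < q -> P p -> C p t -> 0 < sc_jac S q p t ->
  pc_cell e p (dilation beta q (sc_map S q p t)).
Proof.
move=> q0 Pp Ct j0.
by have := sc_map_cell q0 Pp Ct j0; rewrite scaled_cellE.
Qed.

Section change_of_variables.
Variables (q : R) (p : N).
Hypothesis q0 : 0 < q.
Hypothesis Pp : P p.

Lemma measurable_sc_cell : measurable (C p : set (pc_space pc)).
Proof. by apply: measurable_fiber => //; exact: (sc_cell_measurable S). Qed.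

Let mdom : measurable [set x : measurableTypeR R * (borelType N * pc_space pc) |
    0 < x.1 /\ fiber_graph C x.2].
Proof.
rewrite (_ : [set x | _] = `]0, +oo[%classic `*` fiber_graph C).
  by apply: measurableX => //; exact: (sc_cell_measurable S).
by apply/seteqP; split => -[x y] /=; rewrite in_itv/= andbT.
Qed.

Lemma measurable_sc_map : measurable_fun (C p : set (pc_space pc))
  (sc_map S q p : pc_space pc -> pc_space pc).
Proof.
have := @measurable_comp _ _ _ (pc_space pc)
  (measurableTypeR R * (borelType N * pc_space pc))%type (pc_space pc) _ _ (C p)
  (fun t => (q, (p, t))) mdom _ (sc_map_measurable (s:=S)) _.
apply; first by move=> _ [t Ct <-] /=; split => //; split.
by apply: measurable_funTS; apply: measurable_fun_pair => //; exact: measurable_fun_pair.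
Qed.

Lemma measurable_sc_jac : measurable_fun (C p : set (pc_space pc))
  (sc_jac S q p : pc_space pc -> measurableTypeR R).
Proof.
have := @measurable_comp _ _ _ (pc_space pc)
  (measurableTypeR R * (borelType N * pc_space pc))%type (measurableTypeR R) _ _ (C p)
  (fun t => (q, (p, t))) mdom _ (sc_jac_measurable (s:=S)) _.
apply; first by move=> _ [t Ct <-] /=; split => //; split.
by apply: measurable_funTS; apply: measurable_fun_pair => //; exact: measurable_fun_pair.
Qed.

Local Notation j := (sc_jac S q p).
Local Notation theta t := (dilation beta q (sc_map S q p t)).
Local Notation cell := (pc_cell e p : set (pc_space pc)).

Lemma measurable_sc_jac_gt0 :
  measurable_fun (C p : set (pc_space pc)) (fun t => 0 < j t).
Proof. by apply: measurable_fun_ltr => //; exact: measurable_sc_jac. Qed.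

Lemma measurable_pullback d3 (T3 : measurableType d3) (g : pc_space pc -> T3) :
  measurable_fun cell g ->
  measurable_fun
    (C p `&` (fun t => 0 < j t) @^-1` [set true] : set (pc_space pc))
    (fun t => g (theta t)).
Proof.
move=> mg; apply: (measurable_comp (measurable_cell Pp) _ mg).
  by move=> _ [t [Ct j0] <-]; exact: sc_map_in_cell.
apply: (@measurableT_comp _ _ _ _ _ _ (dilation beta q : pc_space pc -> pc_space pc)).
  exact: measurable_dilation.
apply: measurable_funS measurable_sc_map; first exact: measurable_sc_cell.
by move=> t [].
Qed.

(** The explicit 0 matters: where [j] vanishes the map may leave the cell, and [g] is measurable
    only on the cell. *)
Definition transport (g : 'rV[R]_d -> R) (t : 'rV[R]_d) : R :=
  if 0 < j t then g (theta t) * j t else 0.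

Lemma measurable_transport (g : pc_space pc -> R) : measurable_fun cell g ->
  measurable_fun (C p : set (pc_space pc)) (transport g).
Proof.
move=> mg; apply: measurable_fun_if => //.
- exact: measurable_sc_cell.
- exact: measurable_sc_jac_gt0.
- apply: measurable_funM; first exact: measurable_pullback.
  apply: measurable_funS measurable_sc_jac; first exact: measurable_sc_cell.
  by move=> t [].
Qed.

(** The dilation contributes [q^Q]; the scaled cell representation is then applied to [g] composed
    with the dilation. Points with [j = 0] contribute 0 wherever the map sends them. *)
Lemma ge0_integral_transport (g : pc_space pc -> \bar R) : measurable_fun cell g ->
  (forall s, cell s -> 0 <= g s)%E ->
  (\int[leb]_(s in cell) g s = (q `^ Q)%:E *
   \int[leb]_(t in C p) if (0 < j t)%R then g (theta t) * (j t)%:E else 0)%E.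
Proof.
move=> mg g0.
rewrite (ge0_integral_dilation_image beta q0 (measurable_cell Pp) mg g0).
congr (_ * _)%E; rewrite -/(scaled_cell e beta q p).
(* The representation takes functions measurable on the whole space, hence the extension by 0. *)
pose psi : pc_space pc -> \bar R :=
  (fun u => g (dilation beta q u)) \_ (scaled_cell e beta q p).
have mAq := measurable_scaled_cell Pp q0.
have AqE u : scaled_cell e beta q p u -> cell (dilation beta q u).
  by rewrite scaled_cellE.
have mpsi : measurable_fun setT psi.
  apply/(measurable_restrictT _ mAq).
  apply: (measurable_comp (measurable_cell Pp) _ mg).
    by move=> _ [u Au <-]; exact: AqE.
  by apply: measurable_funTS; exact: measurable_dilation.
have psi0 u : (0 <= psi u)%E.
  rewrite /psi patchE; case: ifPn => // /set_mem Au.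
  by apply: g0; exact: AqE.
transitivity (\int[leb]_(u in scaled_cell e beta q p) psi u)%E.
  by apply: eq_integral => u uA; rewrite /psi patchE uA.
rewrite (sc_integral S q0 Pp mpsi psi0); apply: eq_integral => t /set_mem Ct.
case: ifPn => j0.
  by rewrite /psi patchE mem_set//; exact: sc_map_cell.
have -> : j t = 0 by apply/eqP; rewrite eq_le sc_jac_ge0// andbT leNgt.
by rewrite mule0.
Qed.

(** The nonnegative case is applied to the absolute value for integrability, and to the positive and
    negative parts for the value. On [0 < j] the factor [j] commutes with taking these parts. *)
Lemma Rintegral_transport (g : pc_space pc -> R) : measurable_fun cell g ->
  leb.-integrable (C p) (EFin \o transport g) ->
  leb.-integrable cell (EFin \o g) /\
  \int[leb]_(s in cell) g s = q `^ Q * \int[leb]_(t in C p) transport g t.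
Proof.
move=> mg itg.
have mgE : measurable_fun cell (EFin \o g) by exact/measurable_EFinP.
split.
  apply/integrableP; split => //.
  rewrite ge0_integral_transport//; last by apply: measurableT_comp.
  apply: lte_mul_pinfty; rewrite ?lee_fin ?powR_ge0//.
  have /integrableP[_] := itg; congr (_ < _)%E; apply: eq_integral => t _ /=.
  rewrite /transport; case: ifPn => [j0|_]; last by rewrite normr0.
  by rewrite normrM (gtr0_norm j0) EFinM.
have pE : (\int[leb]_(s in cell) (EFin \o g)^\+ s = (q `^ Q)%:E *
    \int[leb]_(t in C p) (EFin \o transport g)^\+ t)%E.
  rewrite ge0_integral_transport//; last by exact: measurable_funepos.
  congr (_ * _)%E; apply: eq_integral => t _; rewrite !funeposE /= /transport.
  case: ifPn => [j0|_]; last by rewrite maxxx.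
  by rewrite -!EFin_max -EFinM maxr_pMl ?mul0r// ltW.
have nE : (\int[leb]_(s in cell) (EFin \o g)^\- s = (q `^ Q)%:E *
    \int[leb]_(t in C p) (EFin \o transport g)^\- t)%E.
  rewrite ge0_integral_transport//; last by exact: measurable_funeneg.
  congr (_ * _)%E; apply: eq_integral => t _; rewrite !funenegE /= /transport.
  case: ifPn => [j0|_]; last by rewrite oppr0 maxxx.
  by rewrite -!EFin_max -EFinM maxr_pMl ?mul0r ?mulNr// ltW.
have := integral_funepos_lt_pinfty measurable_sc_cell itg; have := integral_funeneg_lt_pinfty measurable_sc_cell itg.
have E1 : (\int[leb]_(s in cell) (EFin \o g) s =
    (q `^ Q)%:E * \int[leb]_(t in C p) (EFin \o transport g)^\+ t -
    (q `^ Q)%:E * \int[leb]_(t in C p) (EFin \o transport g)^\- t)%E.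
  by rewrite integralE pE nE.
have E2 : (\int[leb]_(t in C p) (EFin \o transport g) t =
    \int[leb]_(t in C p) (EFin \o transport g)^\+ t -
    \int[leb]_(t in C p) (EFin \o transport g)^\- t)%E.
  by rewrite integralE.
rewrite /Rintegral [X in fine X = _]E1 [X in _ * fine X]E2.
(* Both parts have nonnegative finite integrals, so [q^Q] distributes over a difference of real
   numbers. *)
have := integral_ge0 leb (D := C p) (f := (EFin \o transport g)^\+%E) (fun t _ => funepos_ge0 _ t).
have := integral_ge0 leb (D := C p) (f := (EFin \o transport g)^\-%E) (fun t _ => funeneg_ge0 _ t).
case: (integral _ _ _) => [x||]//= _; case: (integral _ _ _) => [y||]//= _ _ _.
by rewrite mulrBr.
Qed.

Definition ctransport (h : 'rV[R]_d -> R[i]) (t : 'rV[R]_d) : R[i] :=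
  if 0 < j t then h (theta t) * (j t)%:C%C else 0.

Lemma Re_ctransport h t :
  complex.Re (ctransport h t) = transport (fun s => complex.Re (h s)) t.
Proof. by rewrite /ctransport /transport (fun_if (@complex.Re R)) Re_mul_real. Qed.

Lemma Im_ctransport h t :
  complex.Im (ctransport h t) = transport (fun s => complex.Im (h s)) t.
Proof. by rewrite /ctransport /transport (fun_if (@complex.Im R)) Im_mul_real. Qed.

Lemma cmeasurable_ctransport (h : pc_space pc -> R[i]) : cmeasurable cell h ->
  cmeasurable (C p : set (pc_space pc)) (ctransport h).
Proof.
move=> [mr mi]; split.
  by under eq_fun do rewrite Re_ctransport; exact: measurable_transport.
by under eq_fun do rewrite Im_ctransport; exact: measurable_transport.
Qed.

Lemma cintegral_transport (h : pc_space pc -> R[i]) : cmeasurable cell h ->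
  (\int[leb]_(t in C p) (cabs (ctransport h t))%:E < +oo)%E ->
  cintegrable leb cell h /\
  cintegral leb cell h = (q `^ Q)%:C%C * cintegral leb (C p) (ctransport h).
Proof.
move=> mh hoo.
have [ir ii] := cintegrable_lty measurable_sc_cell (cmeasurable_ctransport mh) hoo.
have [mr mi] := mh.
have [ir' rE] : leb.-integrable cell (EFin \o (fun s => complex.Re (h s))) /\
    \int[leb]_(s in cell) complex.Re (h s) =
    q `^ Q * \int[leb]_(t in C p) complex.Re (ctransport h t).
  rewrite [X in _ * X](_ : _ = \int[leb]_(t in C p) transport (fun s => complex.Re (h s)) t); last first.
    by apply: eq_Rintegral => t _; exact: Re_ctransport.
  apply: Rintegral_transport => //.
  by apply: eq_integrable ir => [|t _]; [exact: measurable_sc_cell|rewrite /= Re_ctransport].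
have [ii' iE] : leb.-integrable cell (EFin \o (fun s => complex.Im (h s))) /\
    \int[leb]_(s in cell) complex.Im (h s) =
    q `^ Q * \int[leb]_(t in C p) complex.Im (ctransport h t).
  rewrite [X in _ * X](_ : _ = \int[leb]_(t in C p) transport (fun s => complex.Im (h s)) t); last first.
    by apply: eq_Rintegral => t _; exact: Im_ctransport.
  apply: Rintegral_transport => //.
  by apply: eq_integrable ii => [|t _]; [exact: measurable_sc_cell|rewrite /= Im_ctransport].
split => //; rewrite /cintegral rE iE [RHS]mulrC; apply/eqP; rewrite eq_complex.
by rewrite Re_mul_real Im_mul_real /= ![_ * q `^ Q]mulrC !eqxx.
Qed.

End change_of_variables.

(** At [q = 1 / (c(p) * z)] the rescaled phase is [z * (f - f_0)], so [exp (- z * f)] factors as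
    [exp (- z * f_0) * exp (G - Phi) * exp (- G)]. Where [j = 0] both sides vanish. *)
Lemma ctransport_laplace (c : N -> R) (G : N -> 'rV[R]_d -> R) (z : R) p t :
  0 < z -> 0 < c p ->
  ctransport (c p * z)^-1 p (laplace_integrand f a z p) t =
  (expR (- z * inf (range f)))%:C%C *
  (tdensity f a c G S (c p * z)^-1 p t * (expR (- G p t))%:C%C).
Proof.
move=> z0 c0; rewrite /ctransport /tdensity /tamplitude /tphase.
case: ifPn => j0; last by rewrite !mul0r mulr0.
rewrite /laplace_integrand.
set s := dilation beta _ _; set w := G p t.
have -> : expR (- z * f (pc_map p s)) = expR (- z * inf (range f)) *
    (expR (w - (c p * z)^-1^-1 * phase f c p s) * expR (- w)).
  rewrite -!expRD; congr expR; rewrite /phase invrK; field.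
  exact: lt0r_neq0.
by rewrite !rmorphM/=; ring.
Qed.

End cell_integrals.

(** * Uniform limits and weighted integrals *)

Section suprema.
Context {R : realType}.

Lemma nnsup_le (T : Type) (D : set T) (h : T -> \bar R) (B : R) : 0 <= B ->
  (nnsup D h <= B%:E)%E <-> (forall x, D x -> h x <= B%:E)%E.
Proof.
move=> B0; split => [H x Dx|H].
  by apply: le_trans H; apply: ereal_sup_ubound; right; exists x.
apply: ge_ereal_sup => _ [->|[x Dx <-]]; first by rewrite lee_fin.
exact: H.
Qed.

Lemma nnsup_ge0 (T : Type) (D : set T) (h : T -> \bar R) : (0 <= nnsup D h)%E.
Proof. by apply: ereal_sup_ubound; left. Qed.

Lemma nnsup_cvg0P (T U : Type) (F : set_system U) (FF : Filter F)
    (D : U -> set T) (h : U -> T -> \bar R) :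
  (nnsup (D q) (h q) @[q --> F] --> 0%E) <->
  (forall eps : R, 0 < eps -> \forall q \near F, forall x, D q x ->
    (h q x <= eps%:E)%E).
Proof.
split => [H eps e0|H].
  have : nbhs (0%E : \bar R) [set y | (y < eps%:E)%E].
    apply: open_nbhs_nbhs; split; first exact: open_ereal_lt_ereal.
    by rewrite /= lte_fin.
  move=> /H; rewrite nbhs_filterE/= => /= H'.
  near=> q; apply/(nnsup_le (D q) (h q) (ltW e0)).
  by apply: ltW; near: q; exact: H'.
apply/fine_cvgP; split.
  near=> q; rewrite ge0_fin_numE ?nnsup_ge0//.
  apply: (@le_lt_trans _ _ 1%:E); last exact: ltry.
  apply/nnsup_le => //.
  by near: q; exact: H.
apply/cvgrPdist_le => eps e0; near=> q.
have He : (nnsup (D q) (h q) <= eps%:E)%E.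
  by apply/(nnsup_le _ _ (ltW e0)); near: q; exact: H.
rewrite sub0r normrN ger0_norm ?fine_ge0 ?nnsup_ge0//=.
rewrite -lee_fin fineK// ge0_fin_numE ?nnsup_ge0//.
by apply: le_lt_trans He _; rewrite ltry.
Unshelve. all: by end_near. Qed.

(** An explicit threshold is extracted so that [q] can then vary with [p]. *)
Lemma near0P (A : R -> Prop) : (\forall q \near 0^'+, A q) ->
  exists2 e : R, 0 < e & forall q, 0 < q < e -> A q.
Proof.
rewrite near_withinE => /nbhs_ballP[e /= e0 He]; exists e => // q /andP[q0 qe].
by apply: He => //; rewrite /ball/= sub0r normrN gtr0_norm.
Qed.

End suprema.

Section weighted_integrals.
Context {R : realType} {d : nat}.
Local Notation leb := (@lebesgue_rV R d).

Definition weight_mass : R := fine (\int[leb]_w (cauchy_weight w)%:E)%E.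

Lemma weight_mass_ge0 : 0 <= weight_mass.
Proof.
by rewrite fine_ge0// integral_ge0// => w _; rewrite lee_fin cauchy_weight_ge0.
Qed.

Lemma integral_le_weight (A : set (borelType 'rV[R]_d)) (F : borelType 'rV[R]_d -> R) (K : R) :
  measurable A -> measurable_fun A F -> 0 <= K ->
  (forall t, A t -> 0 <= F t <= K * cauchy_weight t) ->
  (\int[leb]_(t in A) (F t)%:E <= (K * weight_mass)%:E)%E.
Proof.
move=> mA mF K0 H.
have mw : measurable_fun setT
    (fun t : borelType 'rV[R]_d => (cauchy_weight t)%:E).
  by apply/measurable_EFinP; exact: measurable_cauchy_weight.
apply: (@le_trans _ _ (\int[leb]_(t in A) (K%:E * (cauchy_weight t)%:E))%E).
  apply: ge0_le_integral => //.
  - by move=> t /H /andP[? _]; rewrite lee_fin.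
  - exact/measurable_EFinP.
  - by apply: measurable_funTS; apply: emeasurable_funM.
  - by move=> t /H /andP[_ ?]; rewrite -EFinM lee_fin.
apply: (@le_trans _ _ (\int[leb]_t (K%:E * (cauchy_weight t)%:E))%E).
  apply: ge0_subset_integral => //.
  - exact: emeasurable_funM.
  - by move=> t _; rewrite -EFinM lee_fin mulr_ge0 ?cauchy_weight_ge0.
rewrite ge0_integralZl//; last by move=> t _; rewrite lee_fin cauchy_weight_ge0.
rewrite EFinM /weight_mass fineK// ge0_fin_numE; first exact: integral_cauchy_weight_lty.
by apply: integral_ge0 => w _; rewrite lee_fin cauchy_weight_ge0.
Qed.

End weighted_integrals.

(** * Expansion of the Laplace integral *)

Section laplace_expansion.
Context {R : realType} {n : nat} {N : riemannianManifold R n}.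
Variables (pc : piece N) (e : R).
Let d := pc_codim pc.
Let leb := @lebesgue_rV R d.
Let P : set (borelType N) := pc_base pc.
Hypothesis mP : measurable P.
Hypothesis mA : measurable (fiber_graph (@pc_A R n N pc)).
Variables (f : N -> R) (a : N -> R[i]).
Hypothesis cf : continuous f.
Hypothesis ma : cmeasurable [set: borelType N] a.
Hypothesis cF : {within pc_nbhd pc `*` eball e,
  continuous (fun ps : N * 'rV[R]_d => pc_map ps.1 ps.2)}.
Hypothesis PU : pc_base pc `<=` pc_nbhd pc.
Hypothesis mJ : measurable_fun (@pc_dom R n N pc e) (fun ps => @pc_J _ _ _ pc ps.1 ps.2 : R).
Variables (beta : 'I_d -> R) (S : scaledCellRep (pc := pc) e beta).
Hypothesis beta0 : forall i, 0 < beta i.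
Variables (c : N -> R) (c_min : R) (G : N -> 'rV[R]_d -> R).
Hypothesis mc : measurable_fun P (c : borelType N -> measurableTypeR R).
Hypothesis c_min0 : 0 < c_min.
Hypothesis c_ge : forall p, P p -> c_min <= c p.
Hypothesis mG : measurable_fun (P `*` [set: pc_space pc])
  (fun pt => G pt.1 pt.2 : measurableTypeR R).
Variables (r : R) (Lam : set R) (D : R -> N -> 'rV[R]_d -> R[i]).
Hypothesis r0 : 0 < r.
Hypothesis fLam : finite_set Lam.
Hypothesis Lam_ge0 : forall xi, Lam xi -> 0 <= xi.
Let C := sc_cell S.
Let Dt := tdensity f a c G S.
Let Q := \sum_i beta i.
Let f0 := inf (range f).
Let I := laplace f a pc e.
Let weight (F : N -> 'rV[R]_d -> R[i]) p t : R[i] := F p t * (expR (- G p t))%:C%C.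
Let Lxi xi p := cintegral leb (C p) (weight (D xi) p).
Hypothesis mD : forall xi, Lam xi -> cmeasurable (fiber_graph C) (fun pt => D xi pt.1 pt.2).
Hypothesis D_le : forall xi, exists2 K, 0 <= K & forall p t, P p -> C p t ->
  cabs (D xi p t) * expR (- G p t) <= K * cauchy_weight t.
Hypothesis Dt_le : exists2 K, 0 <= K & \forall q \near 0^'+, forall p t, P p -> C p t ->
  cabs (Dt q p t) * expR (- G p t) <= K * cauchy_weight t.
Hypothesis Dt_expansion : forall eps, 0 < eps -> \forall q \near 0^'+,
  forall p t, P p -> C p t ->
  cabs (Dt q p t - \sum_(xi \in Lam) (q `^ xi)%:C%C * D xi p t) * expR (- G p t)
    <= eps * q `^ r * cauchy_weight t.

Let mC : measurable (fiber_graph C).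
Proof. exact: (sc_cell_measurable S). Qed.

Let mCp p : P p -> measurable (C p : set (pc_space pc)).
Proof. exact: measurable_sc_cell. Qed.

Let Q0 : 0 <= Q.
Proof. by apply: sumr_ge0 => i _; rewrite ltW. Qed.

Lemma cabs_weight F p t : cabs (weight F p t) = cabs (F p t) * expR (- G p t).
Proof. by rewrite cabsM cabsR ger0_norm ?expR_ge0. Qed.

Lemma cmeasurable_weight F : cmeasurable (fiber_graph C) (fun pt => F pt.1 pt.2) ->
  cmeasurable (fiber_graph C) (fun pt => weight F pt.1 pt.2).
Proof.
move=> mF; apply: cmeasurableMr => //.
apply: (measurableT_comp (f := @expR R)); first exact: measurable_expR.
apply: measurable_funN; apply: measurable_funS mG; first exact: measurableX.
by move=> [p t] [].
Qed.

Lemma cmeasurable_weighted_coef xi p : Lam xi -> P p ->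
  cmeasurable (C p : set (pc_space pc)) (weight (D xi) p).
Proof.
by move=> Lxi' Pp; apply: cmeasurable_fiber => //; exact: cmeasurable_weight (mD Lxi').
Qed.

Lemma integral_coef_le xi : Lam xi -> exists2 B, 0 <= B & forall p, P p ->
  (\int[leb]_(t in C p) (cabs (weight (D xi) p t))%:E <= B%:E)%E.
Proof.
move=> Lx; have [K K0 HK] := D_le xi.
exists (K * @weight_mass R d); first by rewrite mulr_ge0// weight_mass_ge0.
move=> p Pp; apply: integral_le_weight => //; first exact: mCp.
  exact/measurable_cabs/cmeasurable_weighted_coef.
by move=> t Ct; rewrite cabs_ge0 cabs_weight HK.
Qed.

Lemma cintegrable_coef xi p : Lam xi -> P p ->
  cintegrable leb (C p) (weight (D xi) p).
Proof.
move=> Lx Pp; have [B _ HB] := integral_coef_le Lx.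
apply: cintegrable_lty; [exact: mCp|exact: cmeasurable_weighted_coef|].
exact: le_lt_trans (HB p Pp) (ltry _).
Qed.

(** Measurability comes from the Laplace integrand: for [z = 1 / (c(p) * q)] the weighted density is
    the transport of that integrand times the constant [exp (z * f_0)]. *)
Lemma cmeasurable_density q p : 0 < q -> P p ->
  cmeasurable (C p : set (pc_space pc)) (weight (Dt q) p).
Proof.
move=> q0 Pp; have c0 : 0 < c p by apply: lt_le_trans (c_ge Pp).
have z0 : 0 < (c p * q)^-1 by rewrite invr_gt0 mulr_gt0.
have qE : (c p * (c p * q)^-1)^-1 = q.
  by rewrite invfM invrK mulKf ?gt_eqF.
have h := cmeasurable_fiber (measurable_pc_dom e mA) Pp
  (cmeasurable_laplace_integrand mA cf ma cF PU mJ (c p * q)^-1).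
have := cmeasurable_ctransport mA S q0 Pp h.
move=> /(cmeasurableMr (r := fun=> expR ((c p * q)^-1 * f0))) => /(_ (measurable_cst _)).
apply: eq_cmeasurable => t _.
have := ctransport_laplace f a S G t z0 c0; rewrite qE => ->.
rewrite mulrAC -rmorphM/= -expRD mulNr addrC subrr expR0 mul1r.
by [].
Qed.

Lemma integral_density_le : exists2 B, 0 <= B & \forall q \near 0^'+, forall p, P p ->
  (\int[leb]_(t in C p) (cabs (weight (Dt q) p t))%:E <= B%:E)%E.
Proof.
have [K K0 HK] := Dt_le.
exists (K * @weight_mass R d); first by rewrite mulr_ge0// weight_mass_ge0.
near=> q => p Pp; have q0 : 0 < q by near: q; exact: nbhs_right_gt.
apply: integral_le_weight => //; first exact: mCp.
  exact/measurable_cabs/cmeasurable_density.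
move=> t Ct; rewrite cabs_ge0 cabs_weight/=.
by move: p t Pp Ct; near: q.
Unshelve. all: by end_near. Qed.

Let err q p t : R[i] :=
  weight (Dt q) p t - \sum_(xi <- fset_set Lam) (q `^ xi)%:C%C * weight (D xi) p t.

Lemma err_weight q p t : err q p t =
  (Dt q p t - \sum_(xi \in Lam) (q `^ xi)%:C%C * D xi p t) * (expR (- G p t))%:C%C.
Proof.
rewrite fsbig_finite// mulrBl; congr (_ - _); rewrite big_distrl/=.
by apply: eq_bigr => xi _; rewrite mulrA.
Qed.

Lemma cmeasurable_err q p : 0 < q -> P p ->
  cmeasurable (C p : set (pc_space pc)) (err q p).
Proof.
move=> q0 Pp.
have h1 := cmeasurable_density q0 Pp.
have h2 : cmeasurable (C p : set (pc_space pc))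
    (fun t => \sum_(xi <- fset_set Lam) weight (D xi) p t * (- q `^ xi)%:C%C).
  apply: cmeasurable_sum => xi; rewrite in_fset_set// inE => Lx.
  by apply: cmeasurableMr => //; exact: cmeasurable_weighted_coef.
apply: eq_cmeasurable (cmeasurableD h1 h2) => t _.
rewrite /err -sumrN; congr (_ + _); apply: eq_bigr => xi _.
by rewrite rmorphN mulrN mulrC.
Qed.

Lemma integral_err_le eps : 0 < eps -> \forall q \near 0^'+, forall p, P p ->
  (\int[leb]_(t in C p) (cabs (err q p t))%:E <= (eps * q `^ r)%:E)%E.
Proof.
move=> eps0; pose m := @weight_mass R d + 1.
have m0 : 0 < m by rewrite ltr_wpDl ?weight_mass_ge0.
have em0 : 0 < eps / m by rewrite divr_gt0.
near=> q => p Pp; have q0 : 0 < q by near: q; exact: nbhs_right_gt.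
apply: (@le_trans _ _ ((eps / m * q `^ r * @weight_mass R d)%:E)).
  apply: integral_le_weight; first exact: mCp.
  - exact/measurable_cabs/cmeasurable_err.
  - by rewrite mulr_ge0 ?powR_ge0 ?ltW.
  move=> t Ct; rewrite cabs_ge0 err_weight cabsM cabsR ger0_norm ?expR_ge0//=.
  by move: p t Pp Ct; near: q; exact: Dt_expansion.
rewrite lee_fin mulrAC ler_wpM2r ?powR_ge0// mulrAC ler_pdivrMr//.
by rewrite ler_wpM2l ?(ltW eps0)// lerDl.
Unshelve. all: by end_near. Qed.

Lemma integral_abs_coef_le xi : Lam xi -> exists2 B, 0 <= B & forall p, P p ->
  (\int[leb]_(t in C p) (cabs (D xi p t) * expR (- G p t))%:E <= B%:E)%E.
Proof.
move=> Lx; have [B B0 HB] := integral_coef_le Lx; exists B => // p Pp.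
by under eq_integral do rewrite -cabs_weight; exact: HB.
Qed.

Lemma integral_density_error_le eps : 0 < eps ->
  \forall q \near 0^'+, forall p, P p ->
  (\int[leb]_(t in C p) (cabs (Dt q p t - \sum_(xi \in Lam) (q `^ xi)%:C%C * D xi p t)
    * expR (- G p t))%:E <= (eps * q `^ r)%:E)%E.
Proof.
move=> /integral_err_le H; near=> q => p Pp.
have Hq : forall p, P p ->
  (\int[leb]_(t in C p) (cabs (err q p t))%:E <= (eps * q `^ r)%:E)%E by near: q.
apply: le_trans (Hq p Pp).
under [leRHS]eq_integral do rewrite err_weight cabsM cabsR ger0_norm ?expR_ge0//.
by [].
Unshelve. all: by end_near. Qed.

Let qz (z : R) p := (c p * z)^-1.

(** The scale differs from point to point, but [c >= c_min] keeps it at most [1 / (c_min * z)], so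
    one threshold on [z] works for all [p]. *)
Lemma near_scale (A : R -> N -> Prop) :
  (\forall q \near 0^'+, forall p, P p -> A q p) ->
  \forall z \near +oo, forall p, P p -> A (qz z p) p.
Proof.
move=> /near0P[dl dl0 H]; near=> z => p Pp.
have z0 : 0 < z by near: z; exact: nbhs_pinfty_gt.
have cp := c_ge Pp; have c0 : 0 < c p := lt_le_trans c_min0 cp.
apply: H => //; rewrite /qz invr_gt0 mulr_gt0//=.
rewrite -[ltRHS]invrK ltf_pV2 ?posrE ?invr_gt0 ?mulr_gt0//.
apply: (@lt_le_trans _ _ (c_min * z)); last by rewrite ler_wpM2r ?(ltW z0).
rewrite -ltr_pdivrMl//.
by near: z; apply: nbhs_pinfty_gt; rewrite num_real.
Unshelve. all: by end_near. Qed.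

Lemma cintegrable_laplace : \forall z \near +oo, forall p, P p ->
  cintegrable leb (pc_cell e p) (laplace_integrand f a z p) /\
  I z p = (qz z p `^ Q * expR (- z * f0))%:C%C * cintegral leb (C p) (weight (Dt (qz z p)) p).
Proof.
have [B B0 HB] := integral_density_le.
near=> z => p Pp.
have z0 : 0 < z by near: z; exact: nbhs_pinfty_gt.
have c0 : 0 < c p := lt_le_trans c_min0 (c_ge Pp).
have q0 : 0 < qz z p by rewrite invr_gt0 mulr_gt0.
have h := cmeasurable_fiber (measurable_pc_dom e mA) Pp
  (cmeasurable_laplace_integrand mA cf ma cF PU mJ z).
have md := cmeasurable_density q0 Pp.
have Hd : (\int[leb]_(t in C p) (cabs (weight (Dt (qz z p)) p t))%:E <= B%:E)%E.
  by move: p Pp {c0 q0 h md}; near: z; exact: (near_scale HB).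
have id : cintegrable leb (C p) (weight (Dt (qz z p)) p).
  by apply: cintegrable_lty md _; [exact: mCp|exact: le_lt_trans Hd (ltry _)].
have tE t : ctransport S (qz z p) p (laplace_integrand f a z p) t =
    (expR (- z * f0))%:C%C * weight (Dt (qz z p)) p t.
  exact: ctransport_laplace.
have Hk : (\int[leb]_(t in C p)
    (cabs (ctransport S (qz z p) p (laplace_integrand f a z p) t))%:E < +oo)%E.
  under eq_integral do rewrite tE cabsM cabsR ger0_norm ?expR_ge0// EFinM.
  rewrite ge0_integralZl_EFin ?expR_ge0//.
  - rewrite lte_mul_pinfty ?lee_fin ?expR_ge0//.
    exact: le_lt_trans Hd (ltry _).
  - exact: mCp.
  - by move=> t _; rewrite lee_fin cabs_ge0.
  - exact/measurable_EFinP/measurable_cabs.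
have [it IE] := cintegral_transport mA q0 Pp h Hk.
split => //; rewrite [LHS]IE.
under eq_cintegral do rewrite tE.
rewrite cintegralZ//; last exact: mCp.
by rewrite mulrA -rmorphM.
Unshelve. all: by end_near. Qed.

Lemma powR_qz z p s : 0 < z -> P p -> qz z p `^ s = z `^ (- s) * c p `^ (- s).
Proof.
move=> z0 Pp; have c0 : 0 < c p := lt_le_trans c_min0 (c_ge Pp).
rewrite /qz -powR_inv1 ?mulr_ge0 ?ltW// -powRrM mulN1r.
by rewrite powRM ?ltW// mulrC.
Qed.

Let main z p := (expR (- z * f0))%:C%C * \sum_(xi \in Lam)
  (z `^ (- (Q + xi)) * c p `^ (- (Q + xi)))%:C%C * Lxi xi p.

(** By linearity the difference is [q^Q * exp (- z * f_0)] times the integral of the density error,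
    which is [o(q^r)] uniformly in [p]. *)
Lemma laplace_expansion eps : 0 < eps -> \forall z \near +oo, forall p, P p ->
  cabs (I z p - main z p) <= eps * (expR (- z * f0) * z `^ (- (Q + r))).
Proof.
(* [B] bounds [c(p)^(- (Q + r))] because [c >= c_min] and the exponent is negative; the 2 in
   [eps / (2 * B)] cancels the one from [cabs_cintegral_le]. *)
move=> eps0; pose B := c_min `^ (- (Q + r)).
have B0 : 0 < B by exact: powR_gt0.
have e0 : 0 < eps / (2 * B) by rewrite divr_gt0// mulr_gt0.
near=> z => p Pp.
have z0 : 0 < z by near: z; exact: nbhs_pinfty_gt.
have c0 : 0 < c p := lt_le_trans c_min0 (c_ge Pp).
have q0 : 0 < qz z p by rewrite invr_gt0 mulr_gt0.
have [_ ->] : cintegrable leb (pc_cell e p) (laplace_integrand f a z p) /\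
  I z p = (qz z p `^ Q * expR (- z * f0))%:C%C * cintegral leb (C p) (weight (Dt (qz z p)) p).
  by move: p Pp {c0 q0}; near: z; exact: cintegrable_laplace.
have He : (\int[leb]_(t in C p) (cabs (err (qz z p) p t))%:E <=
    (eps / (2 * B) * qz z p `^ r)%:E)%E.
  by move: p Pp {c0 q0}; near: z; exact: (near_scale (integral_err_le e0)).
have Hd : cintegrable leb (C p) (weight (Dt (qz z p)) p).
  have is_ : cintegrable leb (C p) (err (qz z p) p).
    apply: cintegrable_lty; [exact: mCp|exact: cmeasurable_err|].
    exact: le_lt_trans He (ltry _).
  have ih : cintegrable leb (C p) (fun t => \sum_(xi <- fset_set Lam)
      (qz z p `^ xi)%:C%C * weight (D xi) p t).
    apply: cintegrable_sum; first exact: mCp.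
    move=> xi; rewrite in_fset_set// inE => Lx.
    by apply: cintegrableZ; [exact: mCp|exact: cintegrable_coef].
  have := cintegrableD (mCp Pp) is_ ih.
  by rewrite (_ : (fun _ => _) = weight (Dt (qz z p)) p)//; apply/funext => t; rewrite /err subrK.
have -> : (qz z p `^ Q * expR (- z * f0))%:C%C * cintegral leb (C p) (weight (Dt (qz z p)) p)
    - main z p = (qz z p `^ Q * expR (- z * f0))%:C%C * cintegral leb (C p) (err (qz z p) p).
  rewrite /err cintegralB//; last 2 first.
  - exact: mCp.
  - apply: cintegrable_sum; first exact: mCp.
    move=> xi; rewrite in_fset_set// inE => Lx.
    by apply: cintegrableZ; [exact: mCp|exact: cintegrable_coef].
  rewrite mulrBr; congr (_ - _).
  rewrite cintegral_sum; last 2 first.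
  - exact: mCp.
  - move=> xi; rewrite in_fset_set// inE => Lx.
    by apply: cintegrableZ; [exact: mCp|exact: cintegrable_coef].
  rewrite /main fsbig_finite// [in RHS]mulrC rmorphM/= [RHS]mulrA [RHS]mulrC.
  congr (_ * _); rewrite [RHS]mulrC big_distrr/= big_seq [RHS]big_seq.
  apply: eq_bigr => xi.
  rewrite in_fset_set// inE => Lx.
  rewrite cintegralZ; [|exact: mCp|exact: cintegrable_coef].
  by rewrite mulrA -rmorphM/= -powR_qz// powRD// (gt_eqF q0) implybT.
rewrite cabsM cabsR ger0_norm ?mulr_ge0 ?powR_ge0 ?expR_ge0//.
have := cabs_cintegral_le (mCp Pp) (cmeasurable_err q0 Pp) He.
have qp : 0 <= qz z p `^ Q * expR (- z * f0) by rewrite mulr_ge0 ?powR_ge0 ?expR_ge0.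
move=> /(ler_wpM2l qp) /le_trans; apply.
have -> : qz z p `^ Q * expR (- z * f0) * (2 * (eps / (2 * B) * qz z p `^ r)) =
  eps * (expR (- z * f0) * (qz z p `^ (Q + r) / B)).
  rewrite powRD ?(gt_eqF q0) ?implybT//; field; exact: lt0r_neq0.
rewrite ler_wpM2l ?(ltW eps0)// ler_wpM2l ?expR_ge0// ler_pdivrMr//.
rewrite powR_qz// ler_wpM2l ?powR_ge0//.
rewrite /B !powRN lef_pV2 ?posrE ?powR_gt0//.
by rewrite ge0_ler_powR ?nnegrE ?addr_ge0 ?(ltW r0) ?(ltW c_min0) ?(ltW c0) ?c_ge.
Unshelve. all: by end_near. Qed.

(** * Integration over the base of the piece *)

Section integrated.
Variable mu : {measure set (borelType N) -> \bar R}.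
Hypothesis muP : (mu P < +oo)%E.

Lemma integral_cabs_le (h : N -> R[i]) K : cmeasurable P h ->
  (forall p, P p -> cabs (h p) <= K) ->
  (\int[mu]_(p in P) (cabs (h p))%:E <= (K * fine (mu P))%:E)%E.
Proof.
move=> mh hK.
have fP : mu P \is a fin_num by rewrite ge0_fin_numE ?measure_ge0.
apply: (@le_trans _ _ (\int[mu]_(p in P) (cst K%:E) p)%E).
  apply: ge0_le_integral => //.
  - by move=> p _; rewrite lee_fin cabs_ge0.
  - exact/measurable_EFinP/measurable_cabs.
by rewrite (integral_cst mu mP) EFinM fineK.
Qed.

Lemma cintegrable_bounded (h : N -> R[i]) K : cmeasurable P h ->
  (forall p, P p -> cabs (h p) <= K) -> cintegrable mu P h.
Proof.
move=> mh hK; apply: cintegrable_lty => //.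
exact: le_lt_trans (integral_cabs_le mh hK) (ltry _).
Qed.

Let coef xi p := (c p `^ (- (Q + xi)))%:C%C * Lxi xi p.

Lemma cmeasurable_coef xi : Lam xi -> cmeasurable P (coef xi).
Proof.
move=> Lx; have mL : cmeasurable P (Lxi xi).
  exact: (cmeasurable_cintegral_fiber mC mP (cmeasurable_weight (mD Lx))).
have mp : measurable_fun P (fun p => c p `^ (- (Q + xi)) : R).
  exact: (measurableT_comp (measurable_powR _) mc).
by apply: eq_cmeasurable (cmeasurableMr mL mp) => p _; rewrite mulrC.
Qed.

Lemma cintegrable_integrated_coef xi : Lam xi -> cintegrable mu P (coef xi).
Proof.
move=> Lx; have [B B0 HB] := integral_coef_le Lx.
apply: (@cintegrable_bounded _ (c_min `^ (- (Q + xi)) * (2 * B))).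
  exact: cmeasurable_coef.
move=> p Pp; have c0 : 0 < c p := lt_le_trans c_min0 (c_ge Pp).
rewrite cabsM cabsR ger0_norm ?powR_ge0//; apply: ler_pM; rewrite ?powR_ge0 ?cabs_ge0//.
  rewrite !powRN lef_pV2 ?posrE ?powR_gt0//.
  by rewrite ge0_ler_powR ?nnegrE ?addr_ge0 ?(Lam_ge0 Lx) ?(ltW c_min0) ?(ltW c0) ?c_ge.
exact: (cabs_cintegral_le (mCp Pp) (cmeasurable_weighted_coef Lx Pp) (HB p Pp)).
Qed.

Lemma cmeasurable_laplace z : cmeasurable P (I z).
Proof.
exact: (cmeasurable_cintegral_fiber (measurable_pc_dom e mA) mP
  (cmeasurable_laplace_integrand mA cf ma cF PU mJ z)).
Qed.

(** Separates the factor in [z] from the function of [p], so that integration over the base acts on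
    [coef] alone. *)
Let mainE z p : main z p = \sum_(xi <- fset_set Lam)
  (expR (- z * f0) * z `^ (- (Q + xi)))%:C%C * coef xi p.
Proof.
rewrite /main fsbig_finite// big_distrr/=; apply: eq_bigr => xi _.
by rewrite /coef !rmorphM/= !mulrA.
Qed.

Lemma cintegrable_main z : cintegrable mu P (main z).
Proof.
rewrite (_ : main z = fun p => \sum_(xi <- fset_set Lam)
  (expR (- z * f0) * z `^ (- (Q + xi)))%:C%C * coef xi p); last exact/funext/mainE.
apply: cintegrable_sum => // xi; rewrite in_fset_set// inE => Lx.
by apply: cintegrableZ => //; exact: cintegrable_integrated_coef.
Qed.

Lemma cintegral_main z : cintegral mu P (main z) =
  (expR (- z * f0))%:C%C * \sum_(xi \in Lam)
    (z `^ (- (Q + xi)))%:C%C * cintegral mu P (coef xi).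
Proof.
rewrite (_ : main z = fun p => \sum_(xi <- fset_set Lam)
  (expR (- z * f0) * z `^ (- (Q + xi)))%:C%C * coef xi p); last exact/funext/mainE.
rewrite cintegral_sum//; last first.
  move=> xi; rewrite in_fset_set// inE => Lx.
  by apply: cintegrableZ => //; exact: cintegrable_integrated_coef.
rewrite fsbig_finite// big_distrr/= big_seq [RHS]big_seq; apply: eq_bigr => xi.
rewrite in_fset_set// inE => Lx.
rewrite cintegralZ//; last exact: cintegrable_integrated_coef.
by rewrite rmorphM mulrA.
Qed.

Lemma cmeasurable_laplace_error z : cmeasurable P (fun p => I z p - main z p).
Proof.
have h2 : cmeasurable P (fun p => \sum_(xi <- fset_set Lam)
    coef xi p * (- (expR (- z * f0) * z `^ (- (Q + xi))))%:C%C).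
  apply: cmeasurable_sum => xi; rewrite in_fset_set// inE => Lx.
  by apply: cmeasurableMr => //; exact: cmeasurable_coef.
apply: eq_cmeasurable (cmeasurableD (cmeasurable_laplace z) h2) => p _.
rewrite mainE -sumrN; congr (_ + _); apply: eq_bigr => xi _.
by rewrite rmorphN mulrN mulrC.
Qed.

(** On a base of finite measure the bounded error is integrable; adding the integrable main part
    gives back [I z]. *)
Lemma near_cintegrable_laplace : \forall z \near +oo, cintegrable mu P (I z).
Proof.
near=> z.
have H : forall p, P p ->
    cabs (I z p - main z p) <= 1 * (expR (- z * f0) * z `^ (- (Q + r))).
  by near: z; exact: laplace_expansion.
have := cintegrableD mP (cintegrable_bounded (cmeasurable_laplace_error z) H)
  (cintegrable_main z).
by rewrite (_ : (fun _ => _) = I z)//; apply/funext => p; rewrite subrK.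
Unshelve. all: by end_near. Qed.

(** The expansion is uniform in [p], so integration multiplies the error bound by at most
    [2 * mu P]. *)
Lemma integrated_laplace_expansion :
  cabs (cintegral mu P (I z) - (expR (- z * f0))%:C%C *
    \sum_(xi \in Lam) (z `^ (- (Q + xi)))%:C%C * cintegral mu P (coef xi))
    / (expR (- z * f0) * z `^ (- (Q + r))) @[z --> +oo] --> 0.
Proof.
apply/cvgrPdist_le => eps eps0.
pose m := fine (mu P) + 1.
have m0 : 0 < m by rewrite ltr_wpDl ?fine_ge0 ?measure_ge0.
have e0 : 0 < eps / (2 * m) by rewrite divr_gt0// mulr_gt0.
near=> z.
have z0 : 0 < z by near: z; exact: nbhs_pinfty_gt.
have w0 : 0 < expR (- z * f0) * z `^ (- (Q + r)).
  by rewrite mulr_gt0 ?expR_gt0 ?powR_gt0.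
have iI : cintegrable mu P (I z) by near: z; exact: near_cintegrable_laplace.
have H : forall p, P p -> cabs (I z p - main z p) <=
    eps / (2 * m) * (expR (- z * f0) * z `^ (- (Q + r))).
  by near: z; exact: laplace_expansion.
rewrite sub0r normrN ger0_norm; last by rewrite divr_ge0 ?cabs_ge0 ?(ltW w0).
rewrite ler_pdivrMr// -cintegral_main -cintegralB//; last exact: cintegrable_main.
have := cabs_cintegral_le mP (cmeasurable_laplace_error z)
  (integral_cabs_le (cmeasurable_laplace_error z) H).
move=> /le_trans; apply.
set w := expR _ * _ in w0 *.
rewrite (_ : 2 * _ = eps * w * (fine (mu P) / m)); last first.
  by field; exact: lt0r_neq0.
apply: ler_piMr; first by rewrite mulr_ge0 ?(ltW eps0) ?(ltW w0).
by rewrite ler_pdivrMr// mul1r lerDl.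
Unshelve. all: by end_near. Qed.

End integrated.

End laplace_expansion.

(** * Measurability of the coefficients *)

Section measurable_coefficients.
Context {R : realType} d1 d2 (X : measurableType d1) (Y : measurableType d2).
Variables (Lb Lphi : {fset R}) (r : R).
Variables (b : R -> X -> Y -> R[i]) (phi : R -> X -> Y -> R).
Hypothesis r0 : 0 < r.
Hypothesis Lphi_r : forall nu, nu \in Lphi -> 0 < nu <= r.
Variable A : set (X * Y).
Hypothesis mb : forall l, l \in Lb -> cmeasurable A (fun z => b l z.1 z.2).
Hypothesis mphi : forall nu, nu \in Lphi ->
  measurable_fun A (fun z => phi nu z.1 z.2).

Lemma measurable_exp_coef eta : phase_exponents Lphi r eta ->
  measurable_fun A (fun z => exp_coef Lphi phi eta z.1 z.2).
Proof.
move=> Eeta; have [M HM] := multisum_large r0 Lphi_r.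
have etaE : eta \in fset_set (phase_exponents Lphi r).
  by rewrite in_phase_exponents// inE.
under eq_fun do rewrite (exp_coefE phi r0 Lphi_r HM _ _ etaE).
apply: measurable_sum => m; apply: measurable_funM => //.
under eq_fun do rewrite big_mkcond.
apply: measurable_sum => nu; case: (multisum nu == eta) => //.
apply: measurable_prod => i _; apply: mphi; exact: valP.
Qed.

Lemma cmeasurable_density_coef xi :
  cmeasurable A (fun z => density_coef Lb Lphi b phi r xi z.1 z.2).
Proof.
rewrite /density_coef; set T := [set x | _].
have fT : finite_set T.
  apply: (@sub_finite_set _ _ ([set` Lb] `*` phase_exponents Lphi r)).
    by move=> x [].
  by apply: finite_setX => //; exact: finite_phase_exponents.
apply: (@eq_cmeasurable _ _ _ A (fun z => \sum_(x <- fset_set T)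
    b x.1 z.1 z.2 * (exp_coef Lphi phi x.2 z.1 z.2)%:C%C)).
  by move=> z _; rewrite fsbig_finite.
apply: cmeasurable_sum => x; rewrite in_fset_set// inE => -[x1 x2 _].
by apply: cmeasurableMr; [exact: mb|exact: measurable_exp_coef].
Qed.

End measurable_coefficients.

(** * The uniform and the integrated Laplace expansion *)

Unset Implicit Arguments.

Theorem proposition4p8
  (R : realType) (n : nat) (N : riemannianManifold R n)
  (vol : {measure set (borelType N) -> \bar R})
  (hvol : riemannian_volume n [set: N] vol)
  (f : N -> R) (hf : continuous f) (hfb : has_lbound (range f))
  (a : N -> R[i]) (ha : cmeasurable [set: borelType N] a)
  (hM : argmin f !=set0) (hMc : compact (argmin f))
  (D : normalCells f vol) (al : nc_index D) :
  let pc := nc_piece al in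
  let e := nc_eps D in
  let P : set (borelType N) := pc_base pc in
  let volP := nc_svol D (pc_dim pc) in
  let d := pc_codim pc in
  let leb := @lebesgue_rV R d in
  let f0 := inf (range f) in
  (1 <= d)%N ->
  forall (beta : 'I_d -> R), (forall i, 0 < beta i) ->
  let Q := \sum_i beta i in
  let rho := rho beta in
  forall (c : N -> R) (c_min c_max : R),
    measurable_fun P (c : borelType N -> measurableTypeR R) ->
    0 < c_min -> (forall p, P p -> c_min <= c p <= c_max) ->
  forall (G : N -> 'rV[R]_d -> R),
    measurable_fun (P `*` [set: pc_space pc])
      (fun pt => G pt.1 pt.2 : measurableTypeR R) ->
    (forall p t, P p -> 0 <= G p t) ->
    (forall p t u, P p -> 0 < u -> G p (dilation beta u t) = u * G p t) ->
  forall (S : scaledCellRep e beta),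
  let C := sc_cell S in
  let bt := tamplitude a S in
  let Phi := tphase f c G S in
  let Dt := tdensity f a c G S in
  forall (g_min g_max : R), 0 < g_min -> g_min <= g_max ->
    (forall p t, P p -> C p t -> g_min * rho t <= G p t <= g_max * rho t) ->
  forall (Rtr : R), 0 < Rtr ->
  forall (Lb Lphi : {fset R}),
    (forall l, l \in Lb -> 0 <= l <= Rtr) ->
    (forall nu, nu \in Lphi -> 0 < nu <= Rtr) ->
  forall (b : R -> N -> 'rV[R]_d -> R[i]) (phi : R -> N -> 'rV[R]_d -> R)
    (Lgr : R),
    (forall l, l \in Lb ->
      cmeasurable (fiber_graph C) (fun pt => b l pt.1 pt.2)) ->
    (forall nu, nu \in Lphi ->
      measurable_fun (fiber_graph C)
        (fun pt => phi nu pt.1 pt.2 : measurableTypeR R)) ->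
    (exists K : R, forall p t, P p -> C p t ->
      (forall l, l \in Lb -> cabs (b l p t) <= K * (1 + rho t) `^ Lgr) /\
      (forall nu, nu \in Lphi -> `|phi nu p t| <= K * (1 + rho t) `^ Lgr)) ->
    (let rb q p t := bt q p t - amplitude_sum Lb b q p t in
     let rphi q p t := Phi q p t - (G p t + phase_sum Lphi phi q p t) in
     forall A : R, 0 < A ->
       nnsup [set pt | [/\ P pt.1, C pt.1 pt.2 & rho pt.2 <= A * ln q^-1]]
         (fun pt => ((cabs (rb q pt.1 pt.2) + `|rphi q pt.1 pt.2|) /
                     (q `^ Rtr * (1 + rho pt.2) `^ Lgr))%:E)
       @[q --> 0^'+] --> 0%E) ->
    (exists kG K : R, 0 < kG /\
      \forall q \near 0^'+, forall p t, P p -> C p t ->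
        cabs (bt q p t) <= K * (1 + rho t) `^ Lgr /\ kG * G p t <= Phi q p t) ->
  let Lambda := exponents Lb Lphi Rtr in
  let Dxi := density_coef Lb Lphi b phi Rtr in
  let Lxi xi p := cintegral leb (C p)
    (fun t => Dxi xi p t * (expR (- G p t))%:C%C) in
  let I := laplace f a pc e in
  [/\ forall xi, Lambda xi ->
        (nnsup P (fun p => \int[leb]_(t in C p)
           (cabs (Dxi xi p t) * expR (- G p t))%:E) < +oo)%E,
      nnsup P (fun p => (q `^ (- Rtr))%:E * \int[leb]_(t in C p)
           (cabs (Dt q p t -
                  \sum_(xi \in Lambda) (q `^ xi)%:C%C * Dxi xi p t)
            * expR (- G p t))%:E)%E
        @[q --> 0^'+] --> 0%E,
      (\forall z \near +oo, forall p, P p ->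
         cintegrable leb (pc_cell e p) (laplace_integrand f a z p)) /\
      nnsup P (fun p =>
           (cabs (I z p - (expR (- z * f0))%:C%C *
                    \sum_(xi \in Lambda)
                      (z `^ (- (Q + xi)) * c p `^ (- (Q + xi)))%:C%C * Lxi xi p)
            / (expR (- z * f0) * z `^ (- (Q + Rtr))))%:E)
        @[z --> +oo] --> 0%E
    & (volP P < +oo)%E ->
      [/\ \forall z \near +oo, cintegrable volP P (I z),
          forall xi, Lambda xi -> cintegrable volP P
            (fun p => (c p `^ (- (Q + xi)))%:C%C * Lxi xi p)
        & cabs (cintegral volP P (I z) - (expR (- z * f0))%:C%C *
                  \sum_(xi \in Lambda) (z `^ (- (Q + xi)))%:C%C *
                     cintegral volP P
                       (fun p => (c p `^ (- (Q + xi)))%:C%C * Lxi xi p))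
          / (expR (- z * f0) * z `^ (- (Q + Rtr)))
          @[z --> +oo] --> 0]].
Proof.
move=> pc e P volP d leb f0 d1 beta beta0 Q rho' c c_min c_max mc c_min0 cb
  G mG G0 Ghom S C bt Phi Dt g_min g_max g0 _ Gb r r0 Lb Lphi Lb_r Lphi_r
  b phi Lgr mb mphi [K HK] Hexp [kG [Kb [kG0 Hbt]]] Lambda Dxi Lxi I.
have pcP := nc_pieceP al; rewrite /= -/pc in pcP.
have mP : measurable P := pc_base_measurable pcP.
have mA := pc_A_measurable pcP.
have [cF _] := pc_map_C1 pcP.
have PU := pc_nbhd_base pcP.
have mJ := pc_J_measurable pcP.
have c_ge p : P p -> c_min <= c p by move=> /cb /andP[].
pose D0 : set (N * 'rV[R]_d) := [set z | P z.1 /\ C z.1 z.2].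
pose rh (z : N * 'rV[R]_d) := rho' z.2.
have rh0 z : D0 z -> 0 <= rh z by move=> _; exact: rho_ge0.
(* The real growth exponent is traded for a natural one here; the absolute value in [powR_absorb]
   admits constants of any sign. *)
have [Mgr HMgr] := powR_weight_le rh0 Lgr.
have powR_absorb k z : D0 z -> k * (1 + rh z) `^ Lgr <= `|k| * (1 + rh z) ^+ Mgr.
  move=> Dz; apply: (@le_trans _ _ (`|k| * (1 + rh z) `^ Lgr)).
    by rewrite ler_wpM2r ?powR_ge0 ?ler_norm.
  by rewrite ler_wpM2l ?normr_ge0 ?HMgr.
have b_poly l : l \in Lb -> polybounded D0 rh (fun z => cabs (b l z.1 z.2)).
  move=> lL; exists Mgr, `|K|; split=> // -[p t] [/= Pp Ct].
  rewrite ger0_norm ?cabs_ge0//; have [/(_ l lL) H _] := HK p t Pp Ct.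
  exact: le_trans H (powR_absorb K (p, t) (conj Pp Ct)).
have phi_poly nu : nu \in Lphi -> polybounded D0 rh (fun z => phi nu z.1 z.2).
  move=> nuL; exists Mgr, `|K|; split=> // -[p t] [/= Pp Ct].
  have [_ /(_ nu nuL) H] := HK p t Pp Ct.
  exact: le_trans H (powR_absorb K (p, t) (conj Pp Ct)).
pose bt' q (z : N * 'rV[R]_d) := bt q z.1 z.2.
pose Phi' q (z : N * 'rV[R]_d) := Phi q z.1 z.2.
pose G' (z : N * 'rV[R]_d) := G z.1 z.2.
(* The hypothesis controls the sum of the two remainders; each is then dominated by this sum. *)
have rest_small A : 0 < A -> small_o D0 rh A r (fun q z =>
    cabs (bt' q z - amplitude_sum Lb b q z.1 z.2) +
    `|Phi' q z - (G' z + phase_sum Lphi phi q z.1 z.2)|).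
  move=> A0; have {}Hexp := Hexp A A0.
  exists Mgr => eps eps0.
  have H := (nnsup_cvg0P _ _ _).1 Hexp eps eps0.
  near=> q => -[p t] [/= Pp Ct] ptq.
  have q0 : 0 < q by near: q; exact: nbhs_right_gt.
  have w0 : 0 < 1 + rho' t by rewrite ltr_pwDl// rho_ge0.
  rewrite ger0_norm; last by rewrite addr_ge0 ?cabs_ge0.
  apply: (@le_trans _ _ (eps * (q `^ r * (1 + rho' t) `^ Lgr))).
    rewrite -ler_pdivrMr ?mulr_gt0 ?powR_gt0// -lee_fin.
    have Hq : forall x : N * 'rV[R]_d,
        [/\ P x.1, C x.1 x.2 & rho' x.2 <= A * ln q^-1] ->
        (((cabs (bt q x.1 x.2 - amplitude_sum Lb b q x.1 x.2) +
        `|Phi q x.1 x.2 - (G x.1 x.2 + phase_sum Lphi phi q x.1 x.2)|) /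
         (q `^ r * (1 + rho' x.2) `^ Lgr))%:E <= eps%:E)%E.
      by near: q; exact: H.
    exact: (Hq (p, t) (And3 Pp Ct ptq)).
  rewrite -mulrA ler_wpM2l ?(ltW eps0)// ler_wpM2l ?powR_ge0//.
  exact: (HMgr (p, t) (conj Pp Ct)).
have bt_small A : 0 < A -> small_o D0 rh A r (fun q z =>
    cabs (bt' q z - amplitude_sum Lb b q z.1 z.2)).
  move=> /rest_small; apply: small_o_le; apply: nearW => q z _ _.
  by rewrite [leLHS]ger0_norm ?[leRHS]ger0_norm ?addr_ge0 ?cabs_ge0// lerDl.
have Phi_small A : 0 < A -> small_o D0 rh A r (fun q z =>
    Phi' q z - (G' z + phase_sum Lphi phi q z.1 z.2)).
  move=> /rest_small; apply: small_o_le; apply: nearW => q z _ _.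
  by rewrite [leRHS]ger0_norm ?addr_ge0 ?cabs_ge0// lerDr cabs_ge0.
have G_ge z : D0 z -> g_min * rh z <= G' z by move=> [Pp Ct]; case/andP: (Gb _ _ Pp Ct).
have bt_le : \forall q \near 0^'+, forall z, D0 z ->
    cabs (bt' q z) <= `|Kb| * (1 + rh z) ^+ Mgr.
  near=> q => z Dz; apply: le_trans (powR_absorb Kb z Dz).
  have Hq : forall p t, P p -> C p t ->
    cabs (bt q p t) <= Kb * (1 + rho' t) `^ Lgr /\ kG * G p t <= Phi q p t.
    by near: q.
  by case: Dz => Pp Ct; case: (Hq _ _ Pp Ct).
have Phi_ge : \forall q \near 0^'+, forall z, D0 z -> kG * G' z <= Phi' q z.
  near=> q => z Dz.
  have Hq : forall p t, P p -> C p t ->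
    cabs (bt q p t) <= Kb * (1 + rho' t) `^ Lgr /\ kG * G p t <= Phi q p t.
    by near: q.
  by case: Dz => Pp Ct; case: (Hq _ _ Pp Ct).
have [M [k [k0 Hw]]] := weighted_density_expansion r0 Lb_r Lphi_r rh0 b_poly
  phi_poly bt_small Phi_small g0 G_ge kG0 (normr_ge0 Kb) bt_le Phi_ge.
have Hd := density_decay rh0 g0 G_ge kG0 bt_le Phi_ge.
have decay0 : 0 < g_min * Num.min 1 kG by rewrite mulr_gt0// lt_min ltr01.
have Dt_expansion eps : 0 < eps -> \forall q \near 0^'+,
  forall p t, P p -> C p t ->
  cabs (Dt q p t - \sum_(xi \in Lambda) (q `^ xi)%:C%C * Dxi xi p t) * expR (- G p t)
    <= eps * q `^ r * cauchy_weight t.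
  (* The decay left over is converted into the Cauchy weight; dividing [eps] by [Kw + 1] absorbs the
     constant, and [+ 1] excludes a zero divisor. *)
  move=> eps0; have [Kw Kw0 HKw] := rho_weight_le beta0 M k0.
  have e0 : 0 < eps / (Kw + 1) by rewrite divr_gt0// ltr_wpDl.
  near=> q => p t Pp Ct.
  apply: (@le_trans _ _ (eps / (Kw + 1) * q `^ r * (Kw * cauchy_weight t))).
    apply: (@le_trans _ _ (eps / (Kw + 1) * q `^ r *
      ((1 + rho' t) ^+ M * expR (- (k * rho' t))))).
      have Hq : forall z, D0 z -> cabs (bt' q z * (expR (G' z - Phi' q z))%:C%C -
        \sum_(xi \in exponents Lb Lphi r)
        (q `^ xi)%:C%C * density_coef Lb Lphi b phi r xi z.1 z.2) *
          expR (- G' z) <=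
        eps / (Kw + 1) * q `^ r * ((1 + rh z) ^+ M * expR (- (k * rh z))).
        by near: q; exact: Hw.
      exact: (Hq (p, t) (conj Pp Ct)).
    by apply: ler_wpM2l (HKw t); rewrite mulr_ge0 ?powR_ge0 ?(ltW e0).
  have -> : eps / (Kw + 1) * q `^ r * (Kw * cauchy_weight t) =
    eps * q `^ r * cauchy_weight t * (Kw / (Kw + 1)).
    by field; rewrite gt_eqF// ltr_wpDl.
  apply: ler_piMr.
    by rewrite !mulr_ge0 ?powR_ge0 ?cauchy_weight_ge0 ?(ltW eps0).
  by rewrite ler_pdivrMr ?ltr_wpDl// mul1r lerDl.
(* A crude bound without expansion: it gives the integrability behind the change of variables. *)
have Dt_le : exists2 B, 0 <= B & \forall q \near 0^'+, forall p t, P p -> C p t ->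
    cabs (Dt q p t) * expR (- G p t) <= B * cauchy_weight t.
  have [Kw Kw0 HKw] := rho_weight_le beta0 Mgr decay0.
  exists (`|Kb| * Kw); first by rewrite mulr_ge0.
  near=> q => p t Pp Ct.
  apply: (@le_trans _ _ (`|Kb| * (1 + rho' t) ^+ Mgr *
     expR (- (g_min * Num.min 1 kG * rho' t)))).
    have Hq : forall z, D0 z ->
      cabs (bt' q z * (expR (G' z - Phi' q z))%:C%C) * expR (- G' z) <=
      `|Kb| * (1 + rh z) ^+ Mgr * expR (- (g_min * Num.min 1 kG * rh z)).
      by near: q; exact: Hd.
    exact: (Hq (p, t) (conj Pp Ct)).
  by rewrite -[leLHS]mulrA -[leRHS]mulrA; apply: ler_wpM2l (HKw t).
have D_le xi : exists2 B, 0 <= B & forall p t, P p -> C p t ->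
    cabs (Dxi xi p t) * expR (- G p t) <= B * cauchy_weight t.
  have [MD [KD [KD0 HD]]] := polybounded_density_coef r0 Lphi_r rh0 b_poly phi_poly xi.
  have [Kw Kw0 HKw] := rho_weight_le beta0 MD g0.
  exists (KD * Kw); first by rewrite mulr_ge0.
  move=> p t Pp Ct; rewrite -mulrA.
  apply: (@le_trans _ _ (KD * ((1 + rho' t) ^+ MD * expR (- (g_min * rho' t))))).
    rewrite mulrA; apply: ler_pM; rewrite ?cabs_ge0 ?expR_ge0//.
      by have := HD (p, t) (conj Pp Ct); rewrite ger0_norm ?cabs_ge0.
    by rewrite ler_expR lerN2; exact: (G_ge (p, t) (conj Pp Ct)).
  by apply: ler_wpM2l (HKw t).
have mD xi : Lambda xi -> cmeasurable (fiber_graph C) (fun pt => Dxi xi pt.1 pt.2).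
  by move=> _; exact: (cmeasurable_density_coef r0 Lphi_r mb mphi).
have fLam : finite_set Lambda by exact: finite_exponents.
have Lam_ge0 xi : Lambda xi -> 0 <= xi by move=> [/andP[]].
split.
- move=> xi Lx.
  have [B B0 HB] := integral_abs_coef_le mP mG mD D_le Lx.
  by apply: le_lt_trans (ltry B); apply/(nnsup_le _ _ B0).
- apply/nnsup_cvg0P => eps eps0.
  have H := integral_density_error_le mP mA hf ha cF PU mJ c_min0 c_ge mG fLam
    mD Dt_expansion eps0.
  near=> q => p Pp.
  have q0 : 0 < q by near: q; exact: nbhs_right_gt.
  have -> : eps%:E = ((q `^ (- r))%:E * (eps * q `^ r)%:E)%E.
    by rewrite -EFinM powRN mulrCA mulVf ?mulr1// gt_eqF// powR_gt0.
  rewrite lee_pmul2l ?lte_fin ?powR_gt0//.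
  by move: p Pp; near: q; exact: H.
- split.
    have H := cintegrable_laplace mA hf ha cF PU mJ c_min0 c_ge Dt_le.
    by apply: filterS H => z Hz p /Hz[].
  apply/nnsup_cvg0P => eps eps0.
  have H := laplace_expansion mP mA hf ha cF PU mJ beta0 c_min0 c_ge mG r0
    fLam mD D_le Dt_le Dt_expansion eps0.
  near=> z => p Pp.
  have z0 : 0 < z by near: z; exact: nbhs_pinfty_gt.
  rewrite lee_fin ler_pdivrMr ?mulr_gt0 ?expR_gt0 ?powR_gt0//.
  by move: p Pp; near: z; exact: H.
- move=> vP; split.
  + exact: (near_cintegrable_laplace mP mA hf ha cF PU mJ beta0 mc c_min0 c_ge mG
      r0 fLam Lam_ge0 mD D_le Dt_le Dt_expansion vP).
  + move=> xi Lx; exact: (cintegrable_integrated_coef mP beta0 mc c_min0 c_ge mG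
      Lam_ge0 mD D_le vP Lx).
  + exact: (integrated_laplace_expansion mP mA hf ha cF PU mJ beta0 mc c_min0 c_ge mG
      r0 fLam Lam_ge0 mD D_le Dt_le Dt_expansion vP).
Unshelve. all: by end_near. Qed.
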